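(* Let $p\in(1,2)$ and let $\mu$ be a Borel probability measure on a compact set $\Omega$. There is a constant $C=C(p)$, depending only on $p$, such that, if $L$ is an $N$-dimensional subspace of $L^p(\mu)\cap C(\Omega)$ such that $$\|f\|_\infty\le MN^{1/2}\|f\|_2\quad\forall f\in L,$$ then for every integer $m\ge2$ $$\mathbb{E}\sup_{f\in B_p(L)}\Bigl|\frac1m\sum_{j=1}^m|f(X_j)|^p-\|f\|_p^p\Bigr|\le C\Bigl(\frac{[\log m]^{1+\frac p2}[\log 4M^2N]^{1-\frac p2}}{m}M^2N+\Bigl[\frac{[\log m]^{1+\frac p2}[\log 4M^2N]^{1-\frac p2}}{m}M^2N\Bigr]^{1/2}\Bigr),$$ where $B_p(L):=\{f\in L:\|f\|_p\le1\}$ and $X_1,\dots,X_m$ are independent random points of $\Omega$ distributed according to $\mu$. In particular, for every $\varepsilon\in(0,1)$ and every $\delta\in(0,1)$ there is a big enough constant $c=c(p,\varepsilon,\delta)$ such that for every integer $m\ge cM^2N[\log(4M^2N)]^2$ one has $$(1-\varepsilon)\|f\|_p^p\le\frac1m\sum_{j=1}^m|f(X_j)|^p\le(1+\varepsilon)\|f\|_p^p\quad\forall f\in L$$ with probability greater than $1-\delta$, for any such subspace $L$.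
   Context: $\|f\|_r:=\bigl(\int_\Omega|f|^r\,d\mu\bigr)^{1/r}$ for $r\in[1,\infty)$ and $\|f\|_\infty:=\sup_{x\in\Omega}|f(x)|$. *)

(* Defs.v *)
From HB Require Import structures.
From mathcomp Require Import all_boot all_order all_algebra.
From mathcomp Require Import all_classical all_reals all_analysis.

Set Implicit Arguments.
Unset Strict Implicit.
Unset Printing Implicit Defensive.

Import Order.TTheory GRing.Theory Num.Theory.
Import numFieldNormedType.Exports.

Local Open Scope classical_set_scope.
Local Open Scope ring_scope.

(* An alias of Omega carrying its Borel sigma-algebra. The base point required
   by ptopologicalType is no restriction: Omega carries a probability measure,
   hence is nonempty. *)
Definition borel (Omega : ptopologicalType) :=
  g_sigma_algebraType (@open Omega).

Section norms.
Context (R : realType) (Omega : ptopologicalType).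
Variable mu : probability (borel Omega) R.

(* The library's 'N[mu]_+oo is the essential supremum, so the pointwise
   supremum norm is defined separately. *)
Definition supnorm (f : Omega -> R) : R :=
  sup [set `|f x| | x in [set: Omega]].

Definition rnorm (r : R) (f : Omega -> R) : R :=
  fine ('N[mu]_(r%:E)[EFin \o (f : borel Omega -> R)])%E.

Definition unit_ball (p : R) (L : set (Omega -> R)) : set (Omega -> R) :=
  [set f | L f /\ rnorm p f <= 1].

End norms.

Definition subspace_of_dim (R : realType) (V : lmodType R) (N : nat)
    (L : set V) : Prop :=
  exists e : 'I_N -> V,
    (forall c : 'I_N -> R, \sum_i c i *: e i = 0 -> forall i, c i = 0) /\
    L = [set \sum_i c i *: e i | c in [set: 'I_N -> R]].

Definition nikolskii_subspace (R : realType) (Omega : ptopologicalType)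
    (mu : probability (borel Omega) R) (p : R) (N : nat) (M : R)
    (L : set (Omega -> R)) : Prop :=
  [/\ subspace_of_dim N L,
      forall f, L f -> (f : borel Omega -> R) \in Lfun mu p%:E,
      forall f, L f -> continuous f
    & forall f, L f -> supnorm f <= M * Num.sqrt N%:R * rnorm mu 2 f].

Definition independent_RVs (R : realType) (d d' : measure_display)
    (T : measurableType d) (T' : measurableType d') (P : probability T R)
    (I : finType) (X : I -> {RV P >-> T'}) : Prop :=
  forall (J : {set I}) (A : I -> set T'),
    (forall i, i \in J -> measurable (A i)) ->
    P (\bigcap_(i in [set` J]) (X i @^-1` A i)) =
    (\prod_(i in J) P (X i @^-1` A i))%E.

Definition iid_sample (R : realType) (Omega : ptopologicalType)
    (mu : probability (borel Omega) R) (d : measure_display)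
    (T : measurableType d) (P : probability T R) (m : nat)
    (X : 'I_m -> {RV P >-> borel Omega}) : Prop :=
  independent_RVs X /\
  forall j A, measurable A -> distribution P (X j) A = mu A.

Definition sample_mean (R : realType) (Omega : Type) (p : R)
    (f : Omega -> R) (m : nat) (x : 'I_m -> Omega) : R :=
  m%:R^-1 * \sum_(j < m) `|f (x j)| `^ p.

Definition rate (R : realType) (p : R) (m N : nat) (M : R) : R :=
  ln m%:R `^ (1 + p / 2) * ln (4 * M ^+ 2 * N%:R) `^ (1 - p / 2) / m%:R
  * (M ^+ 2 * N%:R).

(* Main.v *)
Require Import Defs.
From HB Require Import structures.
From mathcomp Require Import all_boot all_order all_algebra.
From mathcomp Require Import all_classical all_reals all_analysis.
From mathcomp Require Import measurable_realfun.
From mathcomp Require Import ring lra.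

Import Order.TTheory GRing.Theory Num.Theory.
Import numFieldNormedType.Exports.

Set Implicit Arguments.
Unset Strict Implicit.
Unset Printing Implicit Defensive.

Local Open Scope classical_set_scope.
Local Open Scope ring_scope.

(** Write K = M^2 N. On the unit ball B of L the Nikolskii inequality gives
    |f|^p <= K, and |f(x)|^2 <= K ||f||_2^2.

    Entropy. If two elements of B differ by at most t in sup norm, then their
    squared L^2 distance is O(t^(2-p)); and a Euclidean ball of radius r is
    covered, in the max norm over a set Y of points, by |Y|^(O(K r^2/t^2)) balls
    of radius t, because the perceptron algorithm stops after K r^2/t^2 steps.
    Iterating over dyadic t with Y a pool of poly(K) points that captures the L^2
    norm, and then taking for Y the sample itself, the entropy of B at scale t in
    the max norm over the sample is
    O(K t^(-p) (log m)^(p/2) (log 4K)^(1-p/2)).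

    Chaining. Let f_k approximate f at scale t_k = K^(1/p) 2^(-k). Instead of
    |f_k|^p one chains the soft thresholds (|f_k| - 2 t_k)_+^p: their increments
    vanish where |f| is below t_k, and the squares of the increments weighted by
    t_k^(-p) sum, because p < 2, to O(sum_j |f(X_j)|^p). By Cauchy-Schwarz
    the Rademacher process is controlled with the single extra factor log m, the
    number of scales. After log_2 m scales the remainder is O(K), and the factor
    sum_j |f(X_j)|^p is absorbed into the deviation being estimated.

    Quantization of Omega by the values of an orthonormal basis reduces the
    expectation to finite sums, where the symmetrization is a reindexing. The
    second part follows from the first by Markov's inequality. *)

(** Chaining [|f_k|^p] itself fails at points where [|f|] is far below [t_k]: an increment can be of
    size [t_k^p] there, its weighted square is again of size [t_k^p], and the sample total [m t_k^p]
    is not dominated by [sum_j |f(X_j)|^p]. The thresholds remove exactly these points. Only one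
    factor [log m] is lost because [t_k^p] times the entropy at scale [t_k] is the same for every
    [k], so all scales cost equally much. The exponents [p/2] and [1 - p/2] come from the last
    covering step: the L^2 cover is stopped at the scale where its cost, governed by [log 4K],
    equals the cost of refining it on the sample, governed by [log m]. Cauchy-Schwarz leaves a free
    parameter, finally set to [4 c + r^(-1/2)] with [c] the constant [chain_const p] and [r] the
    rate: the summand [4 c] makes the absorption possible, and [r^(-1/2)] splits the bound into [r]
    and its square root. *)

(** * Elementary inequalities for logarithms and powers *)

Lemma ln2_ge_half (R : realType) : 2^-1 <= ln 2 :> R.
Proof.
rewrite -ler_expR lnK ?posrE//.
have h := expR_ge1Dx (- 2^-1 : R); rewrite expRN in h.
have g0 := expR_gt0 (2^-1 : R).
have : 2^-1 <= (expR 2^-1)^-1 :> R by lra.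
by rewrite lef_pV2 ?posrE.
Qed.

(** This is what the 4 in [ln (4 K)] is good for: the logarithm is at least 1 as soon as
    [K >= 1]. *)
Lemma expR1_le4 (R : realType) : expR 1 <= 4 :> R.
Proof.
have h := ln2_ge_half R; have -> : 1 = 2^-1 + 2^-1 :> R by lra.
have h2 : expR 2^-1 <= 2 :> R by rewrite -[leRHS]lnK ?posrE// ler_expR.
rewrite expRD; apply: (@le_trans _ _ (2 * 2)); last lra.
by rewrite ler_pM ?expR_ge0.
Qed.

(** For [v <= u] and [r = v / u], division by [u^p] reduces the claim to [1 - r^p <= 2 (1 - r)],
    which follows from [r^2 <= r^p] and [1 - r^2 <= 2 (1 - r)]. *)
Lemma powR_lipschitz (R : realType) (p u v c : R) : 1 < p < 2 ->
  0 <= u <= c -> 0 <= v <= c ->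
  `|u `^ p - v `^ p| <= 2 * `|u - v| * c `^ (p - 1).
Proof.
move=> /andP[p1 p2].
wlog vu : u v / v <= u.
  move=> H uc vc; case: (leP v u) => [vu|/ltW uv]; first exact: H.
  by rewrite distrC (distrC u); exact: H.
move=> /andP[u0 uc] /andP[v0 vc].
have [u00|une0] := eqVneq u 0.
  have -> : v = u by lra.
  by rewrite !subrr normr0 mulr0 mul0r.
have ugt0 : 0 < u by rewrite lt_def une0.
have h1 : v `^ p <= u `^ p by rewrite ge0_ler_powR ?nnegrE//; lra.
rewrite ger0_norm ?subr_ge0// ger0_norm ?subr_ge0//.
apply: (@le_trans _ _ (2 * (u - v) * u `^ (p - 1))); last first.
  rewrite ler_wpM2l//; first by rewrite mulr_ge0// subr_ge0.
  by rewrite ge0_ler_powR ?nnegrE//; lra.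
have up : u `^ p = u * u `^ (p - 1) by rewrite mulr_powRB1//; lra.
have [v00|vne0] := eqVneq v 0.
  have p0 : p != 0 by apply/eqP; lra.
  have := powR_ge0 u (p - 1); rewrite v00 powR0// up; nra.
have vgt0 : 0 < v by rewrite lt_def vne0.
set r := v / u.
have r0 : 0 < r by rewrite divr_gt0.
have r1 : r <= 1 by rewrite ler_pdivrMr// mul1r.
have vE : v = r * u by rewrite /r divfK.
have : r `^ 2 <= r `^ p by apply: ger_powR; [rewrite r0 r1|exact: ltW].
rewrite (powR_mulrn 2 (ltW r0)) => hr.
rewrite vE (powRM p (ltW r0) u0) up.
move: (r `^ p) hr => y hr.
have := powR_gt0 (p - 1) ugt0; set w := u `^ (p - 1) => w0.
have uw : 0 <= u * w by rewrite mulr_ge0// ltW.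
have h2 : 0 <= (y - r ^+ 2) * (u * w) by rewrite mulr_ge0 ?subr_ge0.
have h3 : 0 <= (1 - r) ^+ 2 * (u * w) by rewrite mulr_ge0// sqr_ge0.
clear -h2 h3; rewrite !expr2 in h2 h3; lra.
Qed.

(** The difference is at most twice the larger absolute value, and [2^p <= 4]. After integration
    this serves in place of the triangle inequality of L^p. *)
Lemma powR_normB (R : realType) (p x y : R) : 1 < p < 2 ->
  `|x - y| `^ p <= 4 * (`|x| `^ p + `|y| `^ p).
Proof.
move=> /andP[p1 p2].
wlog yx : x y / `|y| <= `|x|.
  move=> H; case: (leP `|y| `|x|) => [|/ltW] yx; first exact: H.
  by rewrite distrC [X in _ * X]addrC; exact: H.
have : `|x - y| `^ p <= (2 * `|x|) `^ p.
  rewrite ge0_ler_powR ?nnegrE ?mulr_ge0//; first by lra.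
  by have := ler_normB x y; lra.
rewrite powRM// => /le_trans; apply.
have : 2 `^ p <= (4 : R).
  apply: (@le_trans _ _ (2 `^ 2)); last by rewrite powR_mulrn//; lra.
  by apply: ler_powR; lra.
have := powR_ge0 `|x| p; have := powR_ge0 `|y| p; nra.
Qed.

(** * Covering numbers *)

(* B bounds the logarithm of the covering number of S: the labels are the pieces
   of a cover, and D holds between any two elements of the same piece. *)
Definition entropy_le (R : realType) (V : Type) (S : set V)
    (D : V -> V -> Prop) (B : R) : Prop :=
  exists (n : nat) (label : V -> 'I_n), n%:R <= expR B /\
    forall c c', S c -> S c' -> label c = label c' -> D c c'.

Section entropy.
Context {R : realType} {V : Type}.
Implicit Types (S : set V) (D : V -> V -> Prop) (B : R).

Lemma entropy_le_fin (I : finType) (label : V -> I) S D B :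
  #|I|%:R <= expR B ->
  (forall c c', S c -> S c' -> label c = label c' -> D c c') ->
  entropy_le S D B.
Proof.
move=> IB HD; exists #|I|, (fun c => enum_rank (label c)); split => //.
by move=> c c' Sc Sc' /enum_rank_inj; exact: HD.
Qed.

Lemma entropy_le_sub S S' D D' B B' : S' `<=` S -> B <= B' ->
  (forall c c', S' c -> S' c' -> D c c' -> D' c c') ->
  entropy_le S D B -> entropy_le S' D' B'.
Proof.
move=> SS' BB' DD' [n [l [nB lD]]]; exists n, l; split.
  by rewrite (le_trans nB)// ler_expR.
by move=> c c' Sc Sc' /lD - /(_ (SS' _ Sc) (SS' _ Sc')); exact: DD'.
Qed.

(** A piece of the first cover lies in [D1 c1] for any of its elements [c1], so one cover of [D1 c1]
    refines it. All refinements share the labels below [floor (exp B2)], hence the logarithms add;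
    [0 <= B2] provides a label for empty pieces. *)
Lemma entropy_le_comp S D1 D2 B1 B2 : 0 <= B2 ->
  entropy_le S D1 B1 ->
  (forall c0, S c0 -> entropy_le (S `&` D1 c0) D2 B2) ->
  entropy_le S D2 (B1 + B2).
Proof.
move=> B20 [n1 [l1 [n1B l1D]]] H2.
have e0 : 0 <= expR B2 by exact: expR_ge0.
set n2 := Num.truncn (expR B2).
have n2le : n2%:R <= expR B2 by rewrite truncn_le.
have n2gt n : n%:R <= expR B2 -> (n <= n2)%N.
  by move=> nB; rewrite truncn_ge_nat.
have n20 : (0 < n2)%N by apply: n2gt; rewrite -expR0 ler_expR.
have /choice[l2 l2P] : forall i : 'I_n1, exists l : V -> 'I_n2,
    forall c0, S c0 -> l1 c0 = i ->
    exists2 c1, S c1 /\ l1 c1 = i & forall c c', S c -> S c' ->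
      D1 c1 c -> D1 c1 c' -> l c = l c' -> D2 c c'.
  move=> i.
  have [[c0 [Sc0 lc0]]|no] := pselect (exists c0, S c0 /\ l1 c0 = i).
    have [n [l [nB lD]]] := H2 _ Sc0.
    exists (fun c => widen_ord (n2gt _ nB) (l c)) => c _ _; exists c0 => // c1 c2.
    move=> S1 S2 d1 d2 /(congr1 val) /= l12; apply: lD => //.
    exact/val_inj.
  by exists (fun=> Ordinal n20) => c Sc lc; exfalso; apply: no; exists c.
apply: (@entropy_le_fin ('I_n1 * 'I_n2)%type (fun c => (l1 c, l2 (l1 c) c))).
  rewrite card_prod !card_ord natrM expRD ler_pM//.
move=> c c' Sc Sc' [l11 l22].
have [c1 [Sc1 l1c1] H] := l2P (l1 c) _ Sc erefl.
apply: H => //.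
- exact: l1D.
- by apply: l1D => //; rewrite l1c1.
- by rewrite l22 l11.
Qed.

End entropy.

(** * The Euclidean inner product of coefficient vectors *)

Section dot.
Context {R : realType} {N : nat}.
Implicit Types (c v w : 'rV[R]_N).

Definition dot c v : R := \sum_i c 0 i * v 0 i.

Lemma dotC c v : dot c v = dot v c.
Proof. by apply: eq_bigr => i _; rewrite mulrC. Qed.

Lemma dotDl c v w : dot (c + v) w = dot c w + dot v w.
Proof. by rewrite -big_split; apply: eq_bigr => i _; rewrite mxE mulrDl. Qed.

Lemma dotZl a v w : dot (a *: v) w = a * dot v w.
Proof. by rewrite mulr_sumr; apply: eq_bigr => i _; rewrite mxE mulrA. Qed.

Lemma dotNl v w : dot (- v) w = - dot v w.
Proof. by rewrite -scaleN1r dotZl mulN1r. Qed.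

Lemma dotBl c v w : dot (c - v) w = dot c w - dot v w.
Proof. by rewrite dotDl dotNl. Qed.

Lemma dotBr c v w : dot w (c - v) = dot w c - dot w v.
Proof. by rewrite !(dotC w) dotBl. Qed.

Lemma dot0l w : dot 0 w = 0.
Proof. by rewrite -(scale0r 0) dotZl mul0r. Qed.

Lemma dotvv_ge0 v : 0 <= dot v v.
Proof. by apply: sumr_ge0 => i _; rewrite -expr2 sqr_ge0. Qed.

Lemma dot_sub_sqr v w : dot (v - w) (v - w) = dot v v - 2 * dot v w + dot w w.
Proof. by rewrite dotBl !dotBr (dotC w v); ring. Qed.

Lemma dot_sub_le v w : dot (v - w) (v - w) <= 2 * (dot v v + dot w w).
Proof.
have := dotvv_ge0 (v - - w).
rewrite !dot_sub_sqr (dotC v (- w)) !dotNl (dotC w (- w)) dotNl (dotC w v); lra.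
Qed.

Lemma sqr_le_dot v i : v 0 i ^+ 2 <= dot v v.
Proof.
rewrite /dot (bigD1 i)//= -expr2 lerDl.
by apply: sumr_ge0 => j _; rewrite -expr2 sqr_ge0.
Qed.

Lemma dot_le_sum v w a b : (forall i, `|v 0 i| <= a) ->
  (forall i, `|w 0 i| <= b) -> `|dot v w| <= N%:R * (a * b).
Proof.
move=> va wb; rewrite (le_trans (ler_norm_sum _ _ _))//.
apply: (@le_trans _ _ (\sum_(i < N) (a * b))).
  by apply: ler_sum => i _; rewrite normrM ler_pM.
by rewrite sumr_const card_ord mulr_natl.
Qed.

Lemma dot_subC c v : dot (c - v) (c - v) = dot (v - c) (v - c).
Proof. by rewrite !dot_sub_sqr (dotC c v); ring. Qed.

Lemma dot_suml (I : Type) (s : seq I) (a : I -> 'rV[R]_N) w :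
  dot (\sum_(i <- s) a i) w = \sum_(i <- s) dot (a i) w.
Proof.
by elim: s => [|i s IH]; rewrite ?big_nil ?dot0l// !big_cons dotDl IH.
Qed.

Lemma dot_cauchy c v : dot c v ^+ 2 <= dot c c * dot v v.
Proof.
have [v0|v0] := eqVneq (dot v v) 0.
  have -> : v = 0.
    apply/rowP => i; rewrite mxE; apply/eqP; rewrite -sqrf_eq0 eq_le sqr_ge0 andbT.
    by rewrite -v0 sqr_le_dot.
  by rewrite dotC dot0l expr0n /= dot0l mulr0.
have vgt0 : 0 < dot v v by rewrite lt_def v0 dotvv_ge0.
have := dotvv_ge0 (dot v v *: c - dot c v *: v).
rewrite dot_sub_sqr !dotZl !(dotC _ (_ *: _)) !dotZl (dotC v c).
have -> : dot v v * (dot v v * dot c c) - 2 * (dot v v * (dot c v * dot c v)) +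
   dot c v * (dot c v * dot v v) = dot v v * (dot c c * dot v v - dot c v ^+ 2).
  by ring.
by rewrite pmulr_rge0// subr_ge0.
Qed.

End dot.

(** * Covering Euclidean balls by runs of the perceptron algorithm *)

Section perceptron.
Context {R : realType} {N : nat} {J : finType} (v : J -> 'rV[R]_N) (K t : R).
Hypotheses (K0 : 0 < K) (t0 : 0 < t) (vK : forall j, dot (v j) (v j) <= K).

(** [None] is an idle step. Padding with it gives all runs the same length, so they form a finite
    type of known size. *)
Let step (o : option (J * bool)) : 'rV[R]_N :=
  if o is Some (j, b) then ((if b then 1 else -1) * (t / K)) *: v j else 0.

(* Greedy approximation (perceptron): as long as some |<e, v j>| exceeds t,
   subtracting (t / K) v j with the right sign decreases |e|^2 by t^2 / K. *)
Lemma perceptron n (e : 'rV[R]_N) : dot e e < n.+1%:R * (t ^+ 2 / K) ->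
  exists s : n.-tuple (option (J * bool)),
    forall j, `|dot (e - \sum_(o <- s) step o) (v j)| <= t.
Proof.
have t2K : t ^+ 2 / K = t * (t / K) by rewrite expr2 mulrA.
have tK0 : 0 < t / K by rewrite divr_gt0.
have drop (f : 'rV[R]_N) j : t < `|dot f (v j)| -> exists b,
    dot (f - step (Some (j, b))) (f - step (Some (j, b))) < dot f f - t ^+ 2 / K.
  move=> tj; exists (0 <= dot f (v j)).
  set s : R := if 0 <= dot f (v j) then 1 else -1.
  have s2 : s * s = 1 by rewrite /s; case: ifP => _; lra.
  have sE : s * dot f (v j) = `|dot f (v j)|.
    rewrite /s; case: leP => h; first by rewrite ger0_norm// mul1r.
    by rewrite ltr0_norm// mulN1r.
  rewrite dot_sub_sqr /step -/s (dotC f) !dotZl (dotC (v j) (_ *: _)) dotZl.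
  rewrite (dotC (v j) f) t2K.
  have -> : s * (t / K) * (s * (t / K) * dot (v j) (v j)) =
     (s * s) * (t / K) ^+ 2 * dot (v j) (v j) by ring.
  have -> : 2 * (s * (t / K) * dot f (v j)) = 2 * (t / K) * (s * dot f (v j)).
    by ring.
  rewrite s2 sE mul1r.
  have : (t / K) ^+ 2 * dot (v j) (v j) <= t * (t / K).
    rewrite -[leRHS](_ : (t / K) ^+ 2 * K = _); last by field; rewrite gt_eqF.
    by rewrite ler_wpM2l// sqr_ge0.
  have : (t / K) * t < (t / K) * `|dot f (v j)| by rewrite ltr_pM2l.
  lra.
have t2K0 : 0 < t ^+ 2 / K by rewrite t2K mulr_gt0.
elim: n e => [|n IH] e en; have [[j tj]|no] := pselect (exists j, t < `|dot e (v j)|).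
- have [b hb] := drop _ _ tj.
  have := dotvv_ge0 (e - step (Some (j, b))); lra.
- exists [tuple] => j; rewrite big_nil subr0 leNgt; apply/negP => tj.
  by apply: no; exists j.
- have [b hb] := drop _ _ tj.
  have [|s sP] := IH (e - step (Some (j, b))).
    by move: en; rewrite (mulrSr _ n.+1) mulrDl; lra.
  exists [tuple of Some (j, b) :: s] => i.
  by rewrite big_cons opprD addrA; exact: sP.
- exists (nseq_tuple n.+1 None) => j.
  rewrite big1_seq ?subr0; last first.
    by move=> o /andP[_]; rewrite mem_nseq => /andP[_ /eqP ->].
  by rewrite leNgt; apply/negP => tj; apply: no; exists j.
Qed.

(** The label of [c] is the run of the perceptron on [c - c0]. Two vectors with the same run are
    both within [t] of one common vector when tested on each [v j], hence the [2 * t]. There are at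
    most [K r / t^2] steps with [2 |J| + 1] choices each, so the dimension does not enter the
    bound. *)
Lemma entropy_le_perceptron (S : set 'rV[R]_N) c0 r : 0 <= r ->
  (forall c, S c -> dot (c - c0) (c - c0) <= r) ->
  entropy_le S (fun c c' => forall j, `|dot (c - c') (v j)| <= 2 * t)
    (K * r / t ^+ 2 * ln (2 * #|J|%:R + 1)).
Proof.
move=> r0 Sr; set n := Num.truncn (K * r / t ^+ 2).
have t20 : 0 < t ^+ 2 by rewrite exprn_gt0.
have x0 : 0 <= K * r / t ^+ 2 by rewrite divr_ge0// ?mulr_ge0// ltW.
have /choice[l lP] : forall c, exists s : n.-tuple (option (J * bool)),
    S c -> forall j, `|dot (c - c0 - \sum_(o <- s) step o) (v j)| <= t.
  move=> c; have [Sc|nSc] := pselect (S c); last by exists (nseq_tuple n None).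
  have [|s sP] := @perceptron n (c - c0); last by exists s.
  apply: (le_lt_trans (Sr _ Sc)).
  have := truncnS_gt (K * r / t ^+ 2); rewrite -/n => h.
  rewrite mulrA ltr_pdivlMr// mulrC -ltr_pdivrMr//.
apply: (@entropy_le_fin _ _ _ l); last first.
  move=> c c' Sc Sc' ll j.
  have := lP _ Sc j; have := lP _ Sc' j; rewrite ll => h' h.
  have -> : c - c' = (c - c0 - \sum_(o <- l c') step o)
     - (c' - c0 - \sum_(o <- l c') step o).
    by apply/rowP => i; rewrite !mxE; ring.
  rewrite dotBl (le_trans (ler_normB _ _))//; lra.
rewrite card_tuple card_option card_prod card_bool natrX.
have -> : (#|J| * 2).+1%:R = 2 * #|J|%:R + 1 :> R.
  by rewrite -addn1 natrD natrM mulrC.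
set q := _ + 1; have q1 : 1 <= q by rewrite lerDr mulr_ge0.
have q0 : 0 < q by lra.
rewrite -{1}(lnK q0) -expRM_natl ler_expR ler_wpM2r//.
  by rewrite ln_ge0.
by rewrite truncn_le.
Qed.

End perceptron.

(** * Grids on a cube *)

Section grid.
Context {R : realType} {N : nat}.

(** The label of the cell of side [d] in the cube [[-r, r]^N]; [inord] loses nothing on the cube,
    where the truncation is at most [2 r / d]. It serves both for covers and for the quantization of
    the sample space. *)
Definition grid_label (r d : R) (c : 'rV[R]_N) :
    {ffun 'I_N -> 'I_(Num.truncn (2 * r / d)).+1} :=
  [ffun i => inord (Num.truncn ((c 0 i + r) / d))].

Lemma grid_label_eq (r d : R) (c c' : 'rV[R]_N) : 0 < d -> (forall i, `|c 0 i| <= r) ->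
  (forall i, `|c' 0 i| <= r) -> grid_label r d c = grid_label r d c' ->
  forall i, `|c 0 i - c' 0 i| <= d.
Proof.
move=> d0 cr cr' /ffunP cc i; have := cc i; rewrite !ffunE => /(congr1 val) /=.
have h x : `|x| <= r -> 0 <= (x + r) / d <= 2 * r / d.
  rewrite ler_norml => /andP[h1 h2].
  rewrite divr_ge0 ?ler_pM2r ?invr_gt0//=; lra.
have h2 x : `|x| <= r -> (Num.truncn ((x + r) / d) < (Num.truncn (2 * r / d)).+1)%N.
  by move=> /h/andP[_ ?]; rewrite ltnS le_truncn.
rewrite !inordK ?h2// => e.
have /andP[/truncn_itv/andP[a1 a2] _] := h _ (cr i).
have /andP[/truncn_itv/andP[b1 b2] _] := h _ (cr' i).
move: b1 b2; rewrite -e => b1 b2.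
have -> : c 0 i - c' 0 i = ((c 0 i + r) / d - (c' 0 i + r) / d) * d.
  by field; rewrite gt_eqF.
rewrite normrM (gtr0_norm d0) ler_piMl//; first exact: ltW.
by rewrite ler_norml; move: a1 a2 b1 b2; rewrite -natr1; lra.
Qed.

Lemma card_grid (r d : R) : 0 < d -> 0 <= r ->
  #|{: {ffun 'I_N -> 'I_(Num.truncn (2 * r / d)).+1}}|%:R
    <= expR (N%:R * ln (2 * r / d + 1)).
Proof.
move=> d0 r0; rewrite card_ffun !card_ord natrX.
have x0 : 0 <= 2 * r / d by rewrite divr_ge0// ?mulr_ge0// ltW.
have q0 : 0 < 2 * r / d + 1 by lra.
rewrite expRM_natl lnK ?posrE// lerXn2r ?nnegrE//; first exact: ltW.
by rewrite -natr1 lerD2r truncn_le.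
Qed.

Lemma entropy_le_grid (S : set 'rV[R]_N) r d : 0 < d -> 0 <= r ->
  (forall c, S c -> forall i, `|c 0 i| <= r) ->
  entropy_le S (fun c c' => forall i, `|c 0 i - c' 0 i| <= d)
    (N%:R * ln (2 * r / d + 1)).
Proof.
move=> d0 r0 Sr; apply: (entropy_le_fin (card_grid d0 r0)).
by move=> c c' Sc Sc'; apply: grid_label_eq => //; exact: Sr.
Qed.

End grid.

(** * Rademacher averages *)

Section average.
Context {R : realType} {I : finType}.
Implicit Types f g : I -> R.

Definition avg f : R := #|I|%:R^-1 * \sum_i f i.

Lemma le_avg f g : (forall i, f i <= g i) -> avg f <= avg g.
Proof. by move=> fg; rewrite ler_wpM2l ?invr_ge0// ler_sum. Qed.

Lemma avgD f g : avg (fun i => f i + g i) = avg f + avg g.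
Proof. by rewrite /avg big_split mulrDr. Qed.

Lemma avgZ a f : avg (fun i => a * f i) = a * avg f.
Proof. by rewrite /avg -mulr_sumr mulrCA. Qed.

Lemma avg_cst a : (0 < #|I|)%N -> avg (fun=> a) = a.
Proof.
move=> I0; rewrite /avg sumr_const -[a *+ _]mulr_natl mulrA mulVf ?mul1r//.
by rewrite pnatr_eq0 -lt0n.
Qed.

Lemma avg_sum (K : Type) (s : seq K) (F : K -> I -> R) :
  avg (fun i => \sum_(k <- s) F k i) = \sum_(k <- s) avg (F k).
Proof. by rewrite /avg exchange_big /= mulr_sumr. Qed.

Lemma avg_inj h f : injective h -> avg (fun i => f (h i)) = avg f.
Proof. by move=> hi; rewrite /avg [in RHS](reindex_inj hi). Qed.

End average.

Section rademacher.
Context {R : realType}.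

(** The coefficient 2 is not optimal, but keeps the proof elementary: for [|x| >= 1/2] already
    [|x| <= 2 x^2], and for smaller [|x|] the bound [exp y <= 1 / (1 - y)] gives the sum
    [2 / (1 - x^2)]. *)
Lemma cosh_le (x : R) : expR x + expR (- x) <= 2 * expR (2 * x ^+ 2).
Proof.
have [x2|x2] := leP 2^-1 `|x|.
  have xx : `|x| <= 2 * x ^+ 2.
    by rewrite -(real_normK (num_real x)) expr2; nra.
  have h1 : expR x <= expR (2 * x ^+ 2).
    by rewrite ler_expR (le_trans (ler_norm _)).
  have h2 : expR (- x) <= expR (2 * x ^+ 2).
    by rewrite ler_expR (le_trans _ xx)// -normrN ler_norm.
  lra.
have [xl xu] : - 2^-1 < x /\ x < 2^-1 by move: x2; rewrite ltr_norml => /andP.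
have h3 := expR_ge1Dx (2 * x ^+ 2).
have inv (y : R) : y < 2^-1 -> expR y <= (1 - y)^-1.
  move=> y1; rewrite -[y]opprK expRN opprK lef_pV2 ?posrE ?expR_gt0//; last by lra.
  by have := expR_ge1Dx (- y).
have h1 := inv _ xu; have h2 : expR (- x) <= (1 - - x)^-1 by apply: inv; lra.
apply: (le_trans (lerD h1 h2)); apply: (@le_trans _ _ (2 * (1 + 2 * x ^+ 2))); last lra.
have -> : (1 - x)^-1 + (1 - - x)^-1 = 2 / (1 - x ^+ 2).
  by field; rewrite !gt_eqF//; nra.
rewrite ler_pdivrMr; last by nra.
have : x ^+ 2 * (x ^+ 2 * 2) <= x ^+ 2 by rewrite ler_piMr ?sqr_ge0//; nra.
nra.
Qed.

(** Expanding the squares leaves the cross terms [x] and [-x] with [x = y a / (4 w)], [w = v + a^2].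
    By [cosh_le] they cost [2 x^2 = y^2 a^2 / (8 w^2)], which is paid for by passing from the
    denominator [8 w] to the smaller [8 v]. *)
Lemma expR_sqr_flip (y a v : R) : 0 < v ->
  expR ((y + a) ^+ 2 / (8 * (v + a ^+ 2))) + expR ((y - a) ^+ 2 / (8 * (v + a ^+ 2)))
    <= 2 * expR ((y ^+ 2 + a ^+ 2) / (8 * v)).
Proof.
move=> v0; set w := v + a ^+ 2.
have a2 : 0 <= a ^+ 2 by exact: sqr_ge0.
have y2 : 0 <= y ^+ 2 by exact: sqr_ge0.
have w0 : 0 < w by rewrite /w; lra.
set x := y * a / (4 * w).
have -> : (y + a) ^+ 2 / (8 * w) = (y ^+ 2 + a ^+ 2) / (8 * w) + x.
  by rewrite /x; field; rewrite gt_eqF.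
have -> : (y - a) ^+ 2 / (8 * w) = (y ^+ 2 + a ^+ 2) / (8 * w) - x.
  by rewrite /x; field; rewrite gt_eqF.
rewrite !expRD -mulrDr.
apply: (@le_trans _ _ (expR ((y ^+ 2 + a ^+ 2) / (8 * w)) * (2 * expR (2 * x ^+ 2)))).
  by rewrite ler_wpM2l ?expR_ge0// cosh_le.
rewrite mulrCA -expRD ler_wpM2l// ler_expR.
rewrite -subr_ge0.
have -> : (y ^+ 2 + a ^+ 2) / (8 * v) - ((y ^+ 2 + a ^+ 2) / (8 * w) + 2 * x ^+ 2)
  = (y ^+ 2 * (a ^+ 2 * a ^+ 2) + a ^+ 2 * a ^+ 2 * w) / (8 * v * w ^+ 2).
  by rewrite /x /w; field; rewrite !gt_eqF.
have w0' := ltW w0; have v0' := ltW v0.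
have hw : 0 <= w ^+ 2 by exact: sqr_ge0.
exact: divr_ge0 (addr_ge0 (mulr_ge0 y2 (mulr_ge0 a2 a2))
  (mulr_ge0 (mulr_ge0 a2 a2) w0')) (mulr_ge0 (mulr_ge0 (ler0n _ 8) v0') hw).
Qed.

Context {J : finType}.
Implicit Types (e : {ffun J -> bool}) (a : J -> R).

Definition rsum e a : R := \sum_j (-1) ^+ (e j) * a j.

(** Signs are removed one at a time. Averaging over [e j] pairs [e] with its flip at [j];
    [expR_sqr_flip], with [v + A] for [v], then leaves the exponent belonging to the shorter
    list. *)
Lemma avg_expR_sqr_seq a (s : seq J) y v : uniq s -> 0 < v ->
  avg (fun e : {ffun J -> bool} =>
    expR ((y + \sum_(j <- s) (-1) ^+ (e j) * a j) ^+ 2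
          / (8 * (v + \sum_(j <- s) a j ^+ 2))))
  <= expR ((y ^+ 2 + \sum_(j <- s) a j ^+ 2) / (8 * v)).
Proof.
move=> + v0; elim: s => [_|j s IH /= /andP[js us]].
  under [X in avg X]eq_fun do rewrite !big_nil !addr0.
  rewrite avg_cst ?big_nil ?addr0//.
  by rewrite card_ffun card_bool expn_gt0.
under [X in avg X]eq_fun do rewrite !big_cons.
rewrite big_cons.
set A := \sum_(i <- s) a i ^+ 2.
have A0 : 0 <= A by apply: sumr_ge0 => i _; exact: sqr_ge0.
have vA : 0 < v + A by lra.
pose F (b : bool) (e : {ffun J -> bool}) : R :=
  expR ((y + \sum_(i <- s) (-1) ^+ (e i) * a i + (-1) ^+ b * a j) ^+ 2 /
    (8 * (v + A + a j ^+ 2))).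
pose flip (e : {ffun J -> bool}) := [ffun i => if i == j then ~~ e i else e i].
have flipi : injective flip.
  move=> e e' /ffunP H; apply/ffunP => i; have := H i; rewrite !ffunE.
  by case: eqP => // _; apply: negb_inj.
have flipF e b : F b (flip e) = F b e.
  rewrite /F; set z := \sum_(i <- s) _; set z' := \sum_(i <- s) _.
  suff -> : z = z' by [].
  apply: eq_big_seq => i si; rewrite ffunE ifN//.
  by apply: contraNneq js => <-.
have FE : (fun e : {ffun J -> bool} =>
    expR ((y + ((-1) ^+ e j * a j + \sum_(i <- s) (-1) ^+ e i * a i)) ^+ 2 /
     (8 * (v + (a j ^+ 2 + A))))) = (fun e => F (e j) e).
  apply/funext => e; rewrite /F [(-1) ^+ e j * a j + _]addrC !addrA.
  by rewrite [v + a j ^+ 2 + A]addrAC.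
rewrite FE.
have Ff : avg (fun e => F (e j) e) = avg (fun e : {ffun J -> bool} => F (~~ e j) e).
  rewrite -(avg_inj _ flipi); congr (avg _); apply/funext => e.
  by rewrite flipF /flip ffunE eqxx.
have h : 2 * avg (fun e => F (e j) e) <=
    2 * avg (fun e => expR (a j ^+ 2 / (8 * (v + A))) *
     expR ((y + \sum_(i <- s) (-1) ^+ (e i) * a i) ^+ 2 / (8 * (v + A)))).
  have -> : 2 * avg (fun e => F (e j) e) =
      avg (fun e => F (e j) e) + avg (fun e : {ffun J -> bool} => F (~~ e j) e).
    by rewrite -Ff; ring.
  rewrite -avgD -avgZ; apply: le_avg => e.
  have -> : F (e j) e + F (~~ e j) e = F false e + F true e.
    by case: (e j) => //=; rewrite addrC.
  rewrite /F /= expr0 expr1 mul1r mulN1r.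
  by rewrite -expRD -mulrDl [a j ^+ 2 + _]addrC; exact: expR_sqr_flip.
have {h} := h; rewrite ler_pM2l// => /le_trans; apply.
rewrite avgZ.
apply: (le_trans (ler_wpM2l (expR_ge0 _) (IH us))).
rewrite -expRD ler_expR -/A.
have -> : (y ^+ 2 + (a j ^+ 2 + A)) / (8 * v) = a j ^+ 2 / (8 * v) + (y ^+ 2 + A) / (8 * v).
  by ring.
rewrite lerD2r ler_wpM2l ?sqr_ge0// lef_pV2 ?posrE ?mulr_gt0//; lra.
Qed.

(** The choice [v = A] in the preceding estimate turns [8 (v + A)] into [16 A] and the right side
    into [exp (1/8)]. When [A = 0] the quotient is 0 by the convention on division. *)
Lemma avg_expR_sqr a : avg (fun e => expR (rsum e a ^+ 2 / (16 * \sum_j a j ^+ 2)))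
  <= expR 8^-1.
Proof.
have cJ : (0 < #|{: {ffun J -> bool}}|)%N by rewrite card_ffun card_bool expn_gt0.
set A := \sum_j a j ^+ 2.
have A0 : 0 <= A by apply: sumr_ge0 => i _; exact: sqr_ge0.
have [->|An0] := eqVneq A 0.
  under [X in avg X]eq_fun do rewrite mulr0 invr0 mulr0 expR0.
  by rewrite avg_cst// leNgt expR_lt1; lra.
have {}A0 : 0 < A by rewrite lt_def An0.
have := @avg_expR_sqr_seq a (index_enum J) 0 A (index_enum_uniq J) A0.
rewrite -/A expr0n add0r.
under [X in avg X]eq_fun do rewrite add0r.
have -> : A / (8 * A) = 8^-1 by field; rewrite gt_eqF.
by have -> : 8 * (A + A) = 16 * A by ring.
Qed.

(** A maximal inequality without Jensen: the tangent bound [z <= b - 1 + exp (z - b)], with the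
    maximum over [l] of the exponentials replaced by their sum, defines [G]. With [b = ln |L| + 1]
    the averaged sum is at most [exp (-b + ln |L| + 1/8) = exp (-7/8)], below 1. *)
Lemma rademacher_max (L : finType) (a : L -> J -> R) : (0 < #|L|)%N ->
  exists G : {ffun J -> bool} -> R,
    [/\ avg G <= 16 * (ln #|L|%:R + 1),
        forall e, 0 <= G e &
        forall e l, rsum e (a l) ^+ 2 <= G e * \sum_j a l j ^+ 2].
Proof.
move=> L0; have L0' : (0 : R) < #|L|%:R by rewrite ltr0n.
have cJ : (0 < #|{: {ffun J -> bool}}|)%N by rewrite card_ffun card_bool expn_gt0.
set b : R := ln #|L|%:R + 1.
pose z l e := rsum e (a l) ^+ 2 / (16 * \sum_j a l j ^+ 2).
exists (fun e => 16 * ((b - 1) + expR (- b) * \sum_l expR (z l e))).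
have key e l : 16 * z l e <= 16 * ((b - 1) + expR (- b) * \sum_l expR (z l e)).
  rewrite ler_pM2l//.
  apply: (@le_trans _ _ (b - 1 + expR (- b) * expR (z l e))).
    by rewrite -expRD; have := expR_ge1Dx (- b + z l e); lra.
  rewrite lerD2l ler_wpM2l ?expR_ge0// (bigD1 l)//= lerDl.
  by apply: sumr_ge0 => *; exact: expR_ge0.
have D0 l : 0 <= \sum_j a l j ^+ 2 by apply: sumr_ge0 => i _; exact: sqr_ge0.
split.
- rewrite avgZ ler_pM2l// avgD avg_cst// avgZ (avg_sum (index_enum L)).
  have : \sum_l avg (fun e => expR (z l e)) <= #|L|%:R * expR 8^-1.
    rewrite mulr_natl -sumr_const.
    by apply: ler_sum => l _; exact: avg_expR_sqr.
  move=> h; suff : expR (- b) * (\sum_l avg (fun e => expR (z l e))) <= 1 by rewrite /b; lra.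
  apply: (le_trans (ler_wpM2l (expR_ge0 _) h)).
  rewrite -[X in _ * (X * _)](lnK L0') -!expRD expR_le1 /b; lra.
- move=> e; have /card_gt0P[l _] := L0.
  apply: le_trans (key e l); rewrite mulr_ge0// divr_ge0 ?sqr_ge0//.
  by rewrite mulr_ge0.
- move=> e l; have [DE|Dn0] := eqVneq (\sum_j a l j ^+ 2) 0.
    rewrite DE mulr0 /rsum big1 ?expr0n// => j _.
    move/eqP: DE; rewrite psumr_eq0; last by move=> *; exact: sqr_ge0.
    by move=> /allP/(_ j (mem_index_enum _)); rewrite implyTb sqrf_eq0 => /eqP ->; rewrite mulr0.
  rewrite -ler_pdivrMr; last by rewrite lt_def Dn0 D0.
  apply: le_trans (key e l); rewrite le_eqVlt; apply/orP; left; apply/eqP.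
  by rewrite /z; field; rewrite Dn0.
Qed.

End rademacher.

(** * Chaining *)

Section threshold.
Context {R : realType} (p : R).
Hypothesis p12 : 1 < p < 2.

Let p1 : 0 <= p - 1. Proof. by move: p12 => /andP[]; lra. Qed.
Let p0 : p != 0. Proof. by apply/eqP; move: p12 => /andP[]; lra. Qed.
Let p2 : 0 <= 2 - p. Proof. by move: p12 => /andP[]; lra. Qed.

(* The soft threshold kills the points where |x| is below the scale t: the
   squared increments, weighted by t^(-p), then sum to a multiple of |x|^p. *)
Definition thr (t x : R) : R := Num.max (`|x| - 2 * t) 0 `^ p.

Let maxP (y : R) : (0 <= y /\ Num.max y 0 = y) \/ (y <= 0 /\ Num.max y 0 = 0).
Proof.
by case: (leP 0 y) => [y0|/ltW y0]; [left|right].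
Qed.

Lemma thr_eq0 (t x : R) : `|x| <= 2 * t -> thr t x = 0.
Proof.
by move=> xt; rewrite /thr max_r ?powR0//; lra.
Qed.

(** If [2 |x| <= t], both thresholds vanish. Otherwise the truncated arguments differ by at most
    [5 t / 2], and both stay in [[0, |x|]] because the threshold is twice the approximation error;
    so the Lipschitz factor is [|x|^(p-1)] without any addition of [t]. *)
Lemma thr_incr (t x y y' : R) : 0 <= t -> `|y - x| <= t -> `|y' - x| <= t / 2 ->
  `|thr (t / 2) y' - thr t y| <= (5 * t * `|x| `^ (p - 1)) * (t < 2 * `|x|)%R%:R.
Proof.
move=> t0 yx yx'.
have hy : `|y| <= `|x| + t by have := ler_normD (y - x) x; rewrite subrK; lra.
have hy' : `|y'| <= `|x| + t / 2 by have := ler_normD (y' - x) x; rewrite subrK; lra.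
have hx : `|x| <= `|y| + t.
  by have := ler_normB y (y - x); rewrite opprB addrC subrK; lra.
have hx' : `|x| <= `|y'| + t / 2.
  by have := ler_normB y' (y' - x); rewrite opprB addrC subrK; lra.
have [tx|xt] := ltP t (2 * `|x|); last first.
  by rewrite mulr0 !thr_eq0 ?subrr ?normr0//; lra.
rewrite mulr1.
have hu : 0 <= Num.max (`|y'| - 2 * (t / 2)) 0 <= `|x|.
  by case: (maxP (`|y'| - 2 * (t / 2))) => -[h ->]; apply/andP; split => //; lra.
have hv : 0 <= Num.max (`|y| - 2 * t) 0 <= `|x|.
  by case: (maxP (`|y| - 2 * t)) => -[h ->]; apply/andP; split => //; lra.
apply: (le_trans (powR_lipschitz p12 hu hv)).
rewrite ler_wpM2r ?powR_ge0//.
have -> : 5 * t = 2 * (5 / 2 * t) by lra.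
rewrite ler_pM2l// ler_norml.
case: (maxP (`|y'| - 2 * (t / 2))) => -[h ->]; case: (maxP (`|y| - 2 * t)) => -[h' ->];
  apply/andP; split; lra.
Qed.

Lemma thr_last (t T x y : R) : 0 <= t -> `|y - x| <= t -> `|x| <= T ->
  `| `|x| `^ p - thr t y| <= 6 * t * T `^ (p - 1).
Proof.
move=> t0 yx xT.
have hy : `|y| <= `|x| + t by have := ler_normD (y - x) x; rewrite subrK; lra.
have hx : `|x| <= `|y| + t.
  by have := ler_normB y (y - x); rewrite opprB addrC subrK; lra.
have hu : 0 <= `|x| <= T by rewrite normr_ge0.
have hv : 0 <= Num.max (`|y| - 2 * t) 0 <= T.
  by case: (maxP (`|y| - 2 * t)) => -[h ->]; apply/andP; split => //; lra.
apply: (le_trans (powR_lipschitz p12 hu hv)).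
rewrite ler_wpM2r ?powR_ge0//.
have -> : 6 * t = 2 * (3 * t) by lra.
rewrite ler_pM2l// ler_norml.
by case: (maxP (`|y| - 2 * t)) => -[h ->]; apply/andP; split; lra.
Qed.

(** The 50 is [5^2], from the increments, times 2, from [2^(2-p) <= 2]; the denominator sums a
    geometric series of ratio [2^(p-2)], which is where [p < 2] matters. *)
Definition chain_const : R := 50 / (1 - 2 `^ (p - 2)).

Let r01 : 2 `^ (p - 2) < (1 : R).
Proof.
have l2 : 0 < ln 2 :> R by rewrite ln_gt0// ltr1n.
by rewrite /powR pnatr_eq0 expR_lt1 pmulr_llt0//; move: p12 => /andP[]; lra.
Qed.

Lemma chain_const_gt0 : 0 < chain_const.
Proof. by rewrite divr_gt0// subr_gt0. Qed.

(** With [a = |x|], the term of scale [t] is [25 a^(2p-2) t^(2-p)] when [t < 2 a] and 0 otherwise: a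
    geometric series dominated by its largest term, of order [a^p], whatever the number of
    scales. *)
Lemma sum_scales (T x : R) n : 0 < T ->
  \sum_(k < n) ((T / 2 ^+ k) `^ p)^-1 *
    ((5 * (T / 2 ^+ k) * `|x| `^ (p - 1)) * (T / 2 ^+ k < 2 * `|x|)%R%:R) ^+ 2
  <= chain_const * `|x| `^ p.
Proof.
move=> T0; set a := `|x|.
have [a0|a0] := leP a 0.
  rewrite big1; first exact: (mulr_ge0 (ltW chain_const_gt0) (powR_ge0 _ _)).
  move=> k _.
  rewrite ltNge (_ : 2 * a <= _) ?mulr0 ?expr0n ?mulr0//.
  have : 0 < T / 2 ^+ k by rewrite divr_gt0// exprn_gt0.
  by lra.
set r := 2 `^ (p - 2).
(* Capping the scale at [2 a] makes the series telescope: [g k - g k.+1] is [(1 - r) t^(2-p)] for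
   active scales and nonnegative for the others. *)
pose g k := Num.min (T / 2 ^+ k) (2 * a) `^ (2 - p).
have r1 : 0 < 1 - r by rewrite subr_gt0.
apply: (@le_trans _ _ (\sum_(k < n) (25 * a `^ (2 * p - 2) / (1 - r)) * (g k - g k.+1))).
  apply: ler_sum => k _; set t := T / 2 ^+ k.
  have t0 : 0 < t by rewrite divr_gt0// exprn_gt0.
  have gS : g k.+1 = Num.min (t / 2) (2 * a) `^ (2 - p).
    by rewrite /g exprS invfM mulrA mulrAC (mulrAC _ _ (2^-1)).
  have C0 : 0 <= 25 * a `^ (2 * p - 2) / (1 - r).
    by rewrite divr_ge0 ?mulr_ge0 ?powR_ge0// ltW.
  have [ta|ta] := ltP t (2 * a); last first.
    rewrite mulr0 expr0n mulr0; apply: mulr_ge0 => //.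
    rewrite subr_ge0 gS /g -/t (min_r ta).
    have m1 : 0 <= Num.min (t / 2) (2 * a) by rewrite le_min; apply/andP; split; lra.
    by rewrite ge0_ler_powR ?nnegrE// ?ge_min ?lexx ?orbT//; lra.
  have -> : g k = t `^ (2 - p) by rewrite /g min_l// ltW.
  have -> : g k.+1 = r * t `^ (2 - p).
    rewrite gS min_l; last lra.
    rewrite powRM ?invr_ge0// ?ltW// mulrC; congr (_ * _).
    by rewrite -powR_inv1// -powRrM; congr (_ `^ _); lra.
  have -> : t `^ (2 - p) - r * t `^ (2 - p) = (1 - r) * t `^ (2 - p) by ring.
  rewrite mulr1 [leRHS](_ : _ = 25 * a `^ (2 * p - 2) * t `^ (2 - p)); last first.
    by field; rewrite gt_eqF.
  rewrite le_eqVlt; apply/orP; left; apply/eqP.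
  rewrite (exprMn _ (5 * t)) (exprMn _ 5 t) -[(_ `^ (p-1)) ^+ 2]powR_mulrn ?powR_ge0// -powRrM.
  have -> : (p - 1) * 2%:R = 2 * p - 2 by ring.
  rewrite (@powRB _ t 2); last by rewrite (gt_eqF t0) implybT.
  rewrite (powR_mulrn 2 (ltW t0)).
  ring.
rewrite -mulr_sumr -(big_mkord xpredT (fun k => g k - g k.+1)).
have -> : \sum_(0 <= k < n) (g k - g k.+1) = g 0%N - g n.
  rewrite -[RHS]opprB -telescope_sumr// -sumrN.
  by apply: eq_bigr => k _; rewrite opprB.
have gn : 0 <= g n by exact: powR_ge0.
have g0 : g 0%N <= 2 * a `^ (2 - p).
  apply: (@le_trans _ _ ((2 * a) `^ (2 - p))).
    have m1 : 0 <= Num.min (T / 2 ^+ 0) (2 * a).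
      by rewrite expr0 divr1 le_min; apply/andP; split; lra.
    by rewrite ge0_ler_powR ?nnegrE// ?ge_min ?lexx ?orbT//; lra.
  rewrite powRM ?(ltW a0)//; apply: ler_wpM2r; first exact: powR_ge0.
  by apply: ler1_powR; [rewrite ler1n|move: p12 => /andP[]; lra].
have -> : chain_const * a `^ p = (25 * a `^ (2 * p - 2) / (1 - r)) * (2 * a `^ (2 - p)).
  have -> : a `^ p = a `^ (2 * p - 2) * a `^ (2 - p).
    rewrite -powRD; first by congr (_ `^ _); lra.
    by rewrite (gt_eqF a0) implybT.
  by rewrite /chain_const -/r; ring.
rewrite ler_wpM2l//; last lra.
by rewrite divr_ge0 ?mulr_ge0 ?powR_ge0// ltW.
Qed.

End threshold.

Section rsum_theory.
Context {R : realType} {J : finType}.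
Implicit Types (e : {ffun J -> bool}) (a b : J -> R).

Lemma rsumD e a b : rsum e (fun j => a j + b j) = rsum e a + rsum e b.
Proof. by rewrite /rsum -big_split; apply: eq_bigr => j _; rewrite mulrDr. Qed.

Lemma rsum_sum (K : Type) (s : seq K) e (a : K -> J -> R) :
  rsum e (fun j => \sum_(k <- s) a k j) = \sum_(k <- s) rsum e (a k).
Proof. by rewrite /rsum exchange_big; apply: eq_bigr => j _; rewrite mulr_sumr. Qed.

Lemma ler_rsum e a b : (forall j, `|a j| <= b j) -> `|rsum e a| <= \sum_j b j.
Proof.
move=> ab; apply: (le_trans (ler_norm_sum _ _ _)); apply: ler_sum => j _.
by rewrite normrM normrX normrN1 expr1n mul1r.
Qed.

End rsum_theory.

Section chaining.
Context {R : realType} (p : R) (V : Type) (S : set V) (J : finType).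
Variables (a : V -> J -> R) (T H : R) (v0 : V).
Hypotheses (p12 : 1 < p < 2) (T0 : 0 < T) (H0 : 0 <= H).
Hypothesis aT : forall c j, S c -> `|a c j| <= T.
Hypothesis ent : forall t, 0 < t ->
  entropy_le S (fun c c' => forall j, `|a c j - a c' j| <= t) (H * (t `^ p)^-1).

(** Representatives are taken inside [S], so that the bound by [T] holds for the approximations as
    well. *)
Let projection (t : R) : 0 < t -> exists (f : V -> V) (n : nat),
  n%:R <= expR (H * (t `^ p)^-1) /\
  (exists (l : V -> 'I_n) (r : 'I_n -> V), forall c, f c = r (l c)) /\
  forall c, S c -> S (f c) /\ forall j, `|a (f c) j - a c j| <= t.
Proof.
move=> t0; have [n [l [nB lD]]] := ent t0.
have /choice[r rP] : forall i : 'I_n, exists v, forall c, S c -> l c = i ->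
    S v /\ l v = i.
  move=> i; have [[c [Sc lc]]|no] := pselect (exists c, S c /\ l c = i).
    by exists c.
  by exists v0 => c Sc lc; exfalso; apply: no; exists c.
exists (r \o l), n; split => //; split; first by exists l, r.
move=> c Sc; have [Sr lr] := rP _ _ Sc erefl; split => // j.
exact: lD.
Qed.

Let t (k : nat) : R := T / 2 ^+ k.

Let t_gt0 k : 0 < t k. Proof. by rewrite divr_gt0// exprn_gt0. Qed.

Let tS k : t k.+1 = t k / 2.
Proof. by rewrite /t exprS invfM mulrA mulrAC. Qed.

Let tp_gt0 k : 0 < t k `^ p. Proof. exact: powR_gt0. Qed.

Let tpS k : (t k.+1 `^ p)^-1 <= 4 * (t k `^ p)^-1.
Proof.
rewrite tS powRM ?invr_ge0// ?(ltW (t_gt0 _))// invfM mulrC.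
apply: ler_wpM2r; first by rewrite invr_ge0 ltW.
rewrite -powRN -powR_inv1// -powRrM.
have -> : -1 * - p = p by ring.
apply: (@le_trans _ _ (2 `^ 2)); last by rewrite powR_mulrn//; lra.
by apply: ler_powR; move: p12 => /andP[]; lra.
Qed.

Let tp_le k : t k `^ p <= T `^ p.
Proof.
rewrite ge0_ler_powR ?nnegrE ?(ltW (t_gt0 _)) ?(ltW T0)//.
  by move: p12 => /andP[]; lra.
by rewrite ler_pdivrMr ?exprn_gt0// ler_peMr ?exprn_ege1 ?ler1n// ltW.
Qed.

(** The bound [Psi] depends on the signs but not on [c]; all dependence on [c] is in the term
    proportional to [sum_j |a c j|^p], which is later absorbed. Each of the [n] scales contributes
    at most [5 H + T^p] to the average, up to the factor [16 th]. *)
Lemma chaining (n : nat) (th : R) : (#|J| <= 2 ^ n)%N -> 0 < th ->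
  exists Psi : {ffun J -> bool} -> R,
    [/\ avg Psi <= 6 * T `^ p + 16 * th * n%:R * (5 * H + T `^ p),
        forall e, 0 <= Psi e &
        forall e c, S c -> `|rsum e (fun j => `|a c j| `^ p)| <=
          Psi e + chain_const p / th * \sum_j `|a c j| `^ p].
Proof.
move=> Jn th0.
have /choice[f /choice[N fP]] : forall k, exists (f : V -> V) (n : nat),
    n%:R <= expR (H * (t k `^ p)^-1) /\
    (exists (l : V -> 'I_n) (r : 'I_n -> V), forall c, f c = r (l c)) /\
    forall c, S c -> S (f c) /\ forall j, `|a (f c) j - a c j| <= t k.
  by move=> k; exact: projection.
pose D k c j := thr p (t k.+1) (a (f k.+1 c) j) - thr p (t k) (a (f k c) j).
have /choice[G GP] : forall k, exists G : {ffun J -> bool} -> R,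
    [/\ avg G <= 16 * (5 * H * (t k `^ p)^-1 + 1), forall e, 0 <= G e &
      forall e c, rsum e (D k c) ^+ 2 <= G e * \sum_j D k c j ^+ 2].
  move=> k; have [NB [[l [r frl]] _]] := fP k.
  have [NB' [[l' [r' frl']] _]] := fP k.+1.
  have L0 : (0 < #|{: 'I_(N k) * 'I_(N k.+1)}|)%N.
    by apply/card_gt0P; exists (l v0, l' v0).
  have [G [G1 G2 G3]] := @rademacher_max R J ('I_(N k) * 'I_(N k.+1))%type
    (fun i j => thr p (t k.+1) (a (r' i.2) j) - thr p (t k) (a (r i.1) j)) L0.
  exists G; split => //; last first.
    move=> e c; have := G3 e (l c, l' c) => /=.
    by rewrite -frl -frl'.
  (* The 5 is 1 + 4: an increment is determined by its labels at two consecutive scales, and halving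
     the scale multiplies the entropy by at most 4. *)
  apply: (le_trans G1); rewrite ler_pM2l// lerD2r.
  rewrite -ler_expR lnK ?posrE ?ltr0n//.
  rewrite card_prod !card_ord natrM.
  apply: (@le_trans _ _ (expR (H * (t k `^ p)^-1) * expR (H * (t k.+1 `^ p)^-1))).
    exact: (ler_pM (ler0n _ _) (ler0n _ _) NB NB').
  rewrite -expRD ler_expR.
  apply: le_trans (lerD (lexx _) (ler_wpM2l H0 (tpS k))) _.
  by rewrite le_eqVlt; apply/orP; left; apply/eqP; ring.
pose Psi e := 6 * T `^ p + th * \sum_(k < n) t k `^ p * G k e.
exists Psi; split.
- rewrite /Psi avgD avg_cst; last by rewrite card_ffun card_bool expn_gt0.
  rewrite lerD2l avgZ (avg_sum (index_enum 'I_n)).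
  have -> : 16 * th * n%:R * (5 * H + T `^ p) = th * (n%:R * (16 * (5 * H + T `^ p))) by ring.
  rewrite ler_pM2l// mulr_natl -[n in leRHS]card_ord -sumr_const.
  apply: ler_sum => k _; rewrite avgZ; have [G1 _ _] := GP k.
  apply: (le_trans (ler_wpM2l (ltW (tp_gt0 k)) G1)).
  have -> : t k `^ p * (16 * (5 * H / t k `^ p + 1)) = 16 * (5 * H + t k `^ p).
    by field; rewrite gt_eqF.
  by rewrite ler_pM2l// lerD2l.
- move=> e; rewrite addr_ge0 ?mulr_ge0 ?powR_ge0 ?(ltW th0)//.
  by apply: sumr_ge0 => k _; have [_ G2 _] := GP k; rewrite mulr_ge0 ?powR_ge0.
move=> e c Sc.
(* The chain starts from 0: at the scale [t 0 = T] the threshold [2 T] exceeds every value. *)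
have tele j : thr p (t n) (a (f n c) j) = \sum_(k < n) D k c j.
  rewrite -(big_mkord xpredT (fun k => D k c j)) telescope_sumr//.
  rewrite [X in _ - X]thr_eq0 ?subr0//.
  have [_ [_ /(_ _ Sc)[Sf _]]] := fP 0%N.
  by have := aT j Sf; have := T0; rewrite /t expr0 divr1; lra.
have -> : (fun j => `|a c j| `^ p) =
    (fun j => (`|a c j| `^ p - thr p (t n) (a (f n c) j)) + \sum_(k < n) D k c j).
  by apply/funext => j; rewrite -tele subrK.
rewrite rsumD rsum_sum.
have [_ [_ /(_ _ Sc)[_ fn]]] := fP n.
(* The remainder has [|J|] terms of size [6 t_n T^(p-1)], and [t_n = T / 2^n] with [|J| <= 2^n]. *)
have h1 : `|rsum e (fun j => `|a c j| `^ p - thr p (t n) (a (f n c) j))| <= 6 * T `^ p.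
  apply: (le_trans (ler_rsum e (fun j => thr_last p12 (ltW (t_gt0 n)) (fn j) (aT j Sc)))).
  rewrite sumr_const -[_ *+ #|J|]mulr_natl.
  have -> : #|J|%:R * (6 * t n * T `^ (p - 1)) = 6 * (T * T `^ (p - 1)) * (#|J|%:R / 2 ^+ n).
    by rewrite /t; ring.
  rewrite mulr_powRB1 ?(ltW T0)//; last by move: p12 => /andP[]; lra.
  rewrite ler_piMr ?mulr_ge0 ?powR_ge0//.
  by rewrite ler_pdivrMr ?exprn_gt0// mul1r -natrX ler_nat.
(* Arithmetic-geometric mean with weight [th * t_k^p]: this power cancels the entropy in [G k] and
   gives the second term the weight required by [sum_scales]. *)
have h2 k : `|rsum e (D k c)| <= th * (t k `^ p * G k e)
    + th^-1 * ((t k `^ p)^-1 * \sum_j D k c j ^+ 2).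
  have [_ G2 G3] := GP k; have := G3 e c; have := G2 e.
  set x := rsum _ _; set g := G k e; set d := \sum_j _ => g0 xgd.
  have d0 : 0 <= d by apply: sumr_ge0 => j _; exact: sqr_ge0.
  set al := th * t k `^ p; have al0 : 0 < al by rewrite mulr_gt0.
  rewrite !mulrA -invfM -/al.
  have ineq : x ^+ 2 <= (al * g + al^-1 * d) ^+ 2.
    apply: (le_trans xgd).
    have : 0 <= (al * g - al^-1 * d) ^+ 2 by exact: sqr_ge0.
    have -> : (al * g - al^-1 * d) ^+ 2 = (al * g + al^-1 * d) ^+ 2 - 4 * (g * d).
      by field; rewrite gt_eqF.
    have : 0 <= g * d by rewrite mulr_ge0.
    lra.
  have s0 : 0 <= al * g + al^-1 * d.
    by rewrite addr_ge0// mulr_ge0// ?invr_ge0 ltW.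
  by rewrite -(ler_pXn2r (ltn0Sn 1)) ?nnegrE// real_normK ?num_real.
apply: (le_trans (ler_normD _ _)); rewrite /Psi -addrA.
apply: lerD; first exact: h1.
apply: (le_trans (ler_norm_sum _ _ _)).
apply: (@le_trans _ _ (\sum_(k < n) (th * (t k `^ p * G k e)
    + th^-1 * ((t k `^ p)^-1 * \sum_j D k c j ^+ 2)))).
  by apply: ler_sum => k _; exact: h2.
rewrite big_split /= mulr_sumr lerD2l -mulr_sumr.
rewrite [X in _ <= X * _]mulrC -mulrA ler_pM2l ?invr_gt0//.
rewrite (eq_bigr (fun k : 'I_n => \sum_j (t k `^ p)^-1 * D k c j ^+ 2)); last first.
  by move=> k _; rewrite mulr_sumr.
rewrite exchange_big mulr_sumr /=; apply: ler_sum => j _.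
apply: le_trans (sum_scales p12 (a c j) n T0).
apply: ler_sum => k _; rewrite ler_pM2l ?invr_gt0//.
rewrite -(real_normK (num_real (D k c j))) lerXn2r ?nnegrE//.
  apply: mulr_ge0 => //; apply: mulr_ge0; last exact: powR_ge0.
  by apply: mulr_ge0 => //; exact: ltW (t_gt0 k).
have [_ [_ /(_ _ Sc)[_ fk]]] := fP k.
have [_ [_ /(_ _ Sc)[_ fk']]] := fP k.+1.
rewrite /D tS; apply: thr_incr => //; first exact: ltW (t_gt0 k).
by rewrite -tS.
Qed.

End chaining.

(** * Symmetrization on a finite product *)

Section sup_over.
Context {R : realType} {V : Type} (S : set V).
Implicit Types h : V -> R.

Definition sup_over h : R := sup [set h c | c in S].

Lemma sup_over_ub h B c : (forall c, S c -> h c <= B) -> S c -> h c <= sup_over h.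
Proof.
move=> hB Sc; apply: ub_le_sup; last by exists c.
by exists B => _ [c' Sc' <-]; exact: hB.
Qed.

Lemma sup_over_le h b v : S v -> (forall c, S c -> h c <= b) -> sup_over h <= b.
Proof.
move=> Sv hb; apply: ge_sup; first by exists (h v), v.
by move=> _ [c Sc <-]; exact: hb.
Qed.

End sup_over.

Section symmetrization.
Context {R : realType} {I : finType} (w : I -> R) {m : nat} {V : Type}.
Variables (S : set V) (g : V -> I -> R) (B : R) (v0 : V).
Hypotheses (w0 : forall i, 0 <= w i) (w1 : \sum_i w i = 1) (Sv0 : S v0).
Hypothesis gB : forall c i, S c -> 0 <= g c i <= B.

Local Notation sample := {ffun 'I_m -> I}.

Definition weight (x : sample) : R := \prod_j w (x j).

Lemma weight_ge0 x : 0 <= weight x. Proof. by apply: prodr_ge0. Qed.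

Lemma sum_weight : \sum_x weight x = 1.
Proof.
rewrite -(bigA_distr_bigA (fun (_ : 'I_m) i => w i)) big1// => j _.
Qed.

Lemma sum_weight_coord (f : I -> R) j :
  \sum_x weight x * f (x j) = \sum_i w i * f i.
Proof.
pose F (k : 'I_m) i := w i * (if k == j then f i else 1).
have -> : \sum_i w i * f i = \prod_k \sum_i F k i.
  rewrite (bigD1 j)//= [X in _ * X]big1 ?mulr1; last first.
    move=> k kj; rewrite -w1; apply: eq_bigr => i _.
    by rewrite /F (negbTE kj) mulr1.
  by apply: eq_bigr => i _; rewrite /F eqxx.
rewrite bigA_distr_bigA; apply: eq_bigr => x _.
rewrite /F big_split /= /weight; congr (_ * _).
by rewrite -big_mkcond /= big_pred1_eq.
Qed.

Definition wmean c : R := \sum_i w i * g c i.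
Definition deviation (x : sample) : R :=
  sup_over S (fun c => `|\sum_j (g c (x j) - wmean c)|).
Definition rad_sup (e : {ffun 'I_m -> bool}) (x : sample) : R :=
  sup_over S (fun c => `|rsum e (fun j => g c (x j))|).

(** The deviation of the sample [x] from an independent copy [y]. *)
Let H (x y : sample) : R :=
  sup_over S (fun c => `|\sum_j (g c (x j) - g c (y j))|).

Let sum_le (F : 'I_m -> R) (b : R) : (forall j, `|F j| <= b) -> `|\sum_j F j| <= m%:R * b.
Proof.
move=> Fb; apply: (le_trans (ler_norm_sum _ _ _)).
by rewrite mulr_natl -[m in leRHS]card_ord -sumr_const; apply: ler_sum => j _.
Qed.

Let g_le c i : S c -> `|g c i| <= B.
Proof. by move=> Sc; have /andP[h1 h2] := gB i Sc; rewrite ger0_norm. Qed.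

Let gg_le c i i' : S c -> `|g c i - g c i'| <= B.
Proof.
move=> Sc; have /andP[h1 h2] := gB i Sc; have /andP[h3 h4] := gB i' Sc.
by rewrite ler_norml; apply/andP; split; lra.
Qed.

Let wmean_itv c : S c -> 0 <= wmean c <= B.
Proof.
move=> Sc; apply/andP; split.
  by apply: sumr_ge0 => i _; have /andP[h1 h2] := gB i Sc; rewrite mulr_ge0.
rewrite -[leRHS]mul1r -w1 mulr_suml; apply: ler_sum => i _.
by have /andP[h1 h2] := gB i Sc; rewrite ler_wpM2l.
Qed.

Lemma deviation_ub (x : sample) c : S c -> `|\sum_j (g c (x j) - wmean c)| <= deviation x.
Proof.
move=> Sc.
apply: (@sup_over_ub _ _ _ (fun c => `|\sum_j (g c (x j) - wmean c)|) (m%:R * B)) => // c' Sc'.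
apply: sum_le => j; have /andP[h1 h2] := gB (x j) Sc'.
by have /andP[h3 h4] := wmean_itv Sc'; rewrite ler_norml; apply/andP; split; lra.
Qed.

(** The mean of [g c] is an average over the copy [y], and a supremum of averages is at most the
    average of the suprema. *)
Let deviation_le_H (x : sample) : deviation x <= \sum_y weight y * H x y.
Proof.
apply: (sup_over_le Sv0) => c Sc.
have -> : \sum_j (g c (x j) - wmean c) =
    \sum_y weight y * \sum_j (g c (x j) - g c (y j)).
  under [RHS]eq_bigr do rewrite mulr_sumr.
  rewrite exchange_big; apply: eq_bigr => j _ /=.
  under eq_bigr do rewrite mulrBr.
  by rewrite sumrB -mulr_suml sum_weight mul1r sum_weight_coord.
apply: (le_trans (ler_norm_sum _ _ _)); apply: ler_sum => y _.
rewrite normrM (ger0_norm (weight_ge0 y)) ler_wpM2l ?weight_ge0//.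
apply: (@sup_over_ub _ _ _ (fun c => `|\sum_j (g c (x j) - g c (y j))|) (m%:R * B)) => // c' Sc'.
by apply: sum_le => j; exact: gg_le.
Qed.

Let swap (e : {ffun 'I_m -> bool}) (xy : sample * sample) : sample * sample :=
  ([ffun j => if e j then xy.2 j else xy.1 j],
   [ffun j => if e j then xy.1 j else xy.2 j]).

Let swapK e : involutive (swap e).
Proof.
move=> [x y]; rewrite /swap /=; congr pair; apply/ffunP => j;
  by rewrite !ffunE /=; case: (e j).
Qed.

Let swap_weight e xy :
  weight (swap e xy).1 * weight (swap e xy).2 = weight xy.1 * weight xy.2.
Proof.
rewrite /weight -!big_split; apply: eq_bigr => j _ /=.
by rewrite !ffunE; case: (e j); rewrite // mulrC.
Qed.

Let H_swap e xy : H (swap e xy).1 (swap e xy).2 <= rad_sup e xy.1 + rad_sup e xy.2.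
Proof.
apply: (sup_over_le Sv0) => c Sc.
have -> : \sum_j (g c ((swap e xy).1 j) - g c ((swap e xy).2 j)) =
    rsum e (fun j => g c (xy.1 j)) - rsum e (fun j => g c (xy.2 j)).
  rewrite /rsum -sumrB; apply: eq_bigr => j _; rewrite !ffunE.
  by case: (e j); rewrite /= ?expr0 ?expr1; ring.
have h (x : sample) : `|rsum e (fun j => g c (x j))| <= rad_sup e x.
  apply: (@sup_over_ub _ _ _ (fun c => `|rsum e (fun j => g c (x j))|) (m%:R * B)) => // c' Sc'.
  apply: sum_le => j.
  by rewrite normrM normrX normrN1 expr1n mul1r; exact: g_le.
by apply: (le_trans (ler_normB _ _)); rewrite lerD.
Qed.

(* Exchanging x_j with its independent copy y_j for the j with e j = 1 preserves
   the product weight. *)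
Lemma symmetrization :
  \sum_x weight x * deviation x <=
  2 * \sum_x weight x * avg (fun e => rad_sup e x).
Proof.
(* The inequality holds for each sign pattern separately; averaging over the patterns comes last. *)
have key e : \sum_x weight x * deviation x <= 2 * \sum_x weight x * rad_sup e x.
  apply: (@le_trans _ _ (\sum_x \sum_y weight x * weight y * H x y)).
    apply: ler_sum => x _; under [leRHS]eq_bigr do rewrite -mulrA.
    by rewrite -mulr_sumr ler_wpM2l ?weight_ge0.
  rewrite pair_bigA /= (reindex_inj (inv_inj (swapK e))) /=.
  apply: (@le_trans _ _ (\sum_(xy : sample * sample)
     weight xy.1 * weight xy.2 * (rad_sup e xy.1 + rad_sup e xy.2))).
    apply: ler_sum => xy _; rewrite swap_weight.
    by apply: ler_wpM2l (H_swap e xy); rewrite mulr_ge0// weight_ge0.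
  rewrite [leLHS](_ : _ = \sum_(x : sample) \sum_(y : sample)
    weight x * weight y * (rad_sup e x + rad_sup e y)); last by rewrite pair_bigA.
  have -> : \sum_x \sum_y weight x * weight y * (rad_sup e x + rad_sup e y) =
     \sum_x (weight x * rad_sup e x * \sum_y weight y +
        weight x * \sum_y weight y * rad_sup e y).
    apply: eq_bigr => x _; rewrite !mulr_sumr -big_split; apply: eq_bigr => y _ /=.
    by ring.
  rewrite big_split /= -mulr_suml -mulr_suml sum_weight; lra.
have cJ : (0 < #|{: {ffun 'I_m -> bool}}|)%N by rewrite card_ffun card_bool expn_gt0.
rewrite -(avg_cst (\sum_x weight x * deviation x) cJ).
apply: (le_trans (le_avg key)).
rewrite avgZ (avg_sum (index_enum sample)) ler_pM2l//.
by apply: ler_sum => x _; rewrite avgZ.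
Qed.

(** Absorption: [sum_j g c (x j) <= m D + deviation x], so the expected deviation [E] satisfies
    [E <= 2 (A + eta (m D + E))]. Since [eta <= 1/4], the term [2 eta E] is at most [E / 2]. *)
Lemma deviation_le_chaining (A eta D : R) : 0 <= eta <= 4^-1 ->
  (forall c, S c -> wmean c <= D) ->
  (forall x : sample, exists Psi : {ffun 'I_m -> bool} -> R,
    avg Psi <= A /\ forall e c, S c ->
     `|rsum e (fun j => g c (x j))| <= Psi e + eta * \sum_j g c (x j)) ->
  \sum_x weight x * deviation x <= 4 * A + 4 * eta * m%:R * D.
Proof.
move=> /andP[eta0 eta4] gD H1.
set E := \sum_x weight x * deviation x.
have cJ : (0 < #|{: {ffun 'I_m -> bool}}|)%N by rewrite card_ffun card_bool expn_gt0.
have E0 : 0 <= E.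
  apply: sumr_ge0 => x _; rewrite mulr_ge0 ?weight_ge0//.
  exact: le_trans (deviation_ub x Sv0).
suff : E <= 2 * (A + eta * (m%:R * D + E)) by nra.
apply: (le_trans symmetrization); rewrite ler_pM2l//.
apply: (@le_trans _ _ (\sum_x weight x * (A + eta * (m%:R * D + deviation x)))).
  apply: ler_sum => x _; rewrite ler_wpM2l ?weight_ge0//.
  have [Psi [PA PP]] := H1 x.
  apply: (@le_trans _ _ (avg (fun e => Psi e + eta * (m%:R * D + deviation x)))).
    apply: le_avg => e; apply: (sup_over_le Sv0) => c Sc.
    apply: (le_trans (PP e c Sc)); rewrite lerD2l ler_wpM2l//.
    have := deviation_ub x Sc; have := gD c Sc => gDc.
    rewrite sumrB sumr_const card_ord -[_ *+ m]mulr_natl ler_norml => /andP[_].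
    have : m%:R * wmean c <= m%:R * D by rewrite ler_wpM2l.
    lra.
  by rewrite avgD avg_cst// lerD2r.
have -> : \sum_x weight x * (A + eta * (m%:R * D + deviation x)) =
    \sum_x weight x * (A + eta * (m%:R * D)) + \sum_x eta * (weight x * deviation x).
  by rewrite -big_split; apply: eq_bigr => x _ /=; ring.
rewrite -mulr_suml sum_weight -mulr_sumr -/E; lra.
Qed.

End symmetrization.

(** * Means of bounded measurable functions *)

Section bounded_measurable.
Context {d : measure_display} {T : measurableType d} {R : realType}.
Variable mu : probability T R.
Implicit Types f g : T -> R.

(** Such functions are stable under the operations below and integrable for every probability
    measure, so linearity of [mean] asks for nothing but membership. *)
Definition bmeas f := measurable_fun [set: T] f /\ exists B, forall x, `|f x| <= B.

Lemma bmeas_cst c : bmeas (fun=> c).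
Proof. by split; [exact: measurable_cst|exists `|c|]. Qed.

Lemma bmeasD f g : bmeas f -> bmeas g -> bmeas (fun x => f x + g x).
Proof.
move=> [mf [B fB]] [mg [C gC]]; split; first exact: measurable_funD.
by exists (B + C) => x; rewrite (le_trans (ler_normD _ _))// lerD.
Qed.

Lemma bmeasM f g : bmeas f -> bmeas g -> bmeas (fun x => f x * g x).
Proof.
move=> [mf [B fB]] [mg [C gC]]; split; first exact: measurable_funM.
by exists (B * C) => x; rewrite normrM ler_pM.
Qed.

Lemma bmeasZ a f : bmeas f -> bmeas (fun x => a * f x).
Proof. by move=> bf; apply: bmeasM => //; exact: bmeas_cst. Qed.

Lemma bmeasX f n : bmeas f -> bmeas (fun x => f x ^+ n).
Proof.
move=> bf; elim: n => [|n IH]; first exact: bmeas_cst.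
rewrite (_ : (fun x => _) = (fun x => f x * f x ^+ n)); first exact: bmeasM.
by apply/funext => x; rewrite exprS.
Qed.

Lemma bmeas_sum (I : Type) (s : seq I) (F : I -> T -> R) :
  (forall i, bmeas (F i)) -> bmeas (fun x => \sum_(i <- s) F i x).
Proof.
move=> bF; elim: s => [|i s IH].
  by rewrite (_ : (fun x => _) = (fun=> 0)); [exact: bmeas_cst|apply/funext => x; rewrite big_nil].
rewrite (_ : (fun x => _) = (fun x => F i x + \sum_(i <- s) F i x)); first exact: bmeasD.
by apply/funext => x; rewrite big_cons.
Qed.

Lemma bmeas_norm f : bmeas f -> bmeas (fun x => `|f x|).
Proof.
move=> [mf [B fB]]; split; first exact: measurableT_comp.
by exists B => x; rewrite normr_id.
Qed.

Lemma bmeas_powR p f : 0 <= p -> bmeas f -> bmeas (fun x => `|f x| `^ p).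
Proof.
move=> p0 /bmeas_norm[mf [B fB]]; split.
  by apply: (measurableT_comp (measurable_powR p)).
exists (B `^ p) => x; rewrite ger0_norm ?powR_ge0//.
have B0 : 0 <= B by exact: le_trans (fB x).
by rewrite ge0_ler_powR ?nnegrE// -(normr_id (f x)).
Qed.

Lemma bmeas_bool (P : T -> bool) : measurable_fun [set: T] P ->
  bmeas (fun x => (P x)%:R).
Proof.
move=> mP; split; last by exists 1 => x; case: (P x); rewrite ?normr1 ?normr0.
have mb : measurable_fun [set: bool] (fun b : bool => b%:R : R) by move=> _ Y _.
exact: (measurableT_comp mb mP).
Qed.

Lemma bmeas_lt t f : bmeas f -> bmeas (fun x => (t < `|f x|)%R%:R).
Proof.
move=> /bmeas_norm[mf _]; apply: bmeas_bool; apply: measurable_fun_ltr => //.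
Qed.

Lemma bmeas_integrable f : bmeas f -> mu.-integrable setT (EFin \o f).
Proof.
move=> [mf [B fB]]; apply: measurable_bounded_integrable => //.
  by apply: (le_lt_trans (probability_le1 mu measurableT)); rewrite ltry.
exists B; split; first by rewrite num_real.
by move=> x Bx y _ /=; exact: le_trans (ltW Bx).
Qed.

Definition mean f : R := \int[mu]_x f x.

Lemma mean_cst c : mean (fun=> c) = c.
Proof.
rewrite /mean Rintegral_cst// -[RHS]mulr1; congr (c * _).
exact: (congr1 fine (probability_setT mu)).
Qed.

Lemma le_mean f g : bmeas f -> bmeas g -> (forall x, f x <= g x) -> mean f <= mean g.
Proof. by move=> bf bg fg; apply: le_Rintegral => //; exact: bmeas_integrable. Qed.

Lemma mean_ge0 f : (forall x, 0 <= f x) -> 0 <= mean f.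
Proof. by move=> f0; apply: Rintegral_ge0. Qed.

Lemma meanD f g : bmeas f -> bmeas g -> mean (fun x => f x + g x) = mean f + mean g.
Proof. by move=> bf bg; apply: RintegralD => //; exact: bmeas_integrable. Qed.

Lemma meanZ a f : bmeas f -> mean (fun x => a * f x) = a * mean f.
Proof. by move=> bf; apply: RintegralZl => //; exact: bmeas_integrable. Qed.

Lemma meanB f g : bmeas f -> bmeas g -> mean (fun x => f x - g x) = mean f - mean g.
Proof. by move=> bf bg; apply: RintegralB => //; exact: bmeas_integrable. Qed.

Lemma mean_sum (I : Type) (s : seq I) (F : I -> T -> R) : (forall i, bmeas (F i)) ->
  mean (fun x => \sum_(i <- s) F i x) = \sum_(i <- s) mean (F i).
Proof.
move=> bF; elim: s => [|i s IH].
  rewrite big_nil -[RHS]mean_cst; congr mean; apply/funext => x; rewrite big_nil//.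
rewrite big_cons -IH -meanD//; last exact: bmeas_sum.
by congr mean; apply/funext => x; rewrite big_cons.
Qed.

Lemma mean_EFin f : bmeas f -> (mean f)%:E = (\int[mu]_x (f x)%:E)%E.
Proof.
move=> bf; rewrite /mean /Rintegral fineK//.
exact: (integrable_fin_num _ (bmeas_integrable bf)).
Qed.

(* Greedy choice: some point lies in at least the average proportion kappa of
   the remaining sets. *)
Lemma greedy_hitting (G : finType) (P : G -> T -> bool) (kappa : R) :
  (forall h, bmeas (fun x => (P h x)%:R)) -> 0 < kappa <= 1 ->
  exists Y : seq T, (size Y)%:R <= ln #|G|%:R / kappa + 1 /\
    forall h, kappa <= mean (fun x => (P h x)%:R) -> has (P h) Y.
Proof.
move=> bP /andP[k0 k1].
pose A := [set h | kappa <= mean (fun x => (P h x)%:R)]%SET.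
(* The number of remaining sets containing [y] has mean at least [kappa |B|]. It takes finitely many
   values, so some [y] attains its maximum and hence reaches the mean. *)
have pick (B : {set G}) : B \subset A ->
    exists y, kappa * #|B|%:R <= #|[set h in B | P h y]%SET|%:R.
  move=> BA.
  pose cnt y := #|[set h in B | P h y]%SET|.
  have cntE y : (cnt y)%:R = \sum_(h in B) (P h y)%:R :> R.
    rewrite /cnt -sum1_card natr_sum [RHS]big_mkcond [LHS]big_mkcond /=.
    apply: eq_bigr => h _; rewrite inE.
    by case: (h \in B) => //=; case: (P h y).
  have exP : exists k, `[< exists y, cnt y = k >].
    by exists (cnt point); apply/asboolP; exists point.
  have ubP k : `[< exists y, cnt y = k >] -> (k <= #|G|)%N.
    by move=> /asboolP[y <-]; exact: max_card.
  case: (ex_maxnP exP ubP) => k /asboolP[y yk] kmax.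
  exists y; rewrite -/(cnt y) -[leRHS](mean_cst (cnt y)%:R).
  apply: (@le_trans _ _ (mean (fun y => (cnt y)%:R))); last first.
    apply: le_mean; [|exact: bmeas_cst|].
      under eq_fun do rewrite cntE.
      under eq_fun do rewrite big_mkcond.
      apply: bmeas_sum => h; case: (h \in B) => //; exact: bmeas_cst.
    move=> z; rewrite ler_nat yk; apply: kmax; apply/asboolP; by exists z.
  have -> : mean (fun y => (cnt y)%:R) = \sum_(h in B) mean (fun x => (P h x)%:R).
    under eq_fun do rewrite cntE.
    by rewrite -big_enum -mean_sum//; congr mean; apply/funext => z; rewrite big_enum.
  rewrite mulr_natr -sumr_const; apply: ler_sum => h gB.
  by have := fintype.subsetP BA _ gB; rewrite inE.
have greedy n : exists Y : seq T, size Y = n /\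
    #|[set h in A | ~~ has (P h) Y]%SET|%:R <= (1 - kappa) ^+ n * #|G|%:R.
  elim: n => [|n [Y [sY hY]]].
    by exists [::]; split => //; rewrite expr0 mul1r ler_nat max_card.
  set B := [set h in A | ~~ has (P h) Y]%SET in hY.
  have [|y hy] := pick B; first by apply/fintype.subsetP => h; rewrite inE => /andP[].
  exists (y :: Y); split; first by rewrite /= sY.
  have -> : [set h in A | ~~ has (P h) (y :: Y)]%SET = (B :\: [set h in B | P h y])%SET.
    apply/setP => h; rewrite !inE /= negb_or.
    by case: (P h y); case: (has _ _); case: (_ <= _).
  have -> : #|(B :\: [set h in B | P h y])%SET|%:R = #|B|%:R - #|[set h in B | P h y]%SET|%:R :> R.
    rewrite finset.cardsD natrB; last by rewrite subset_leq_card// finset.subsetIl.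
    congr (_ - _%:R); congr #|pred_of_set _|; apply/setP => h; rewrite !inE.
    by case: (_ <= _); case: (has _ _); case: (P h y).
  rewrite exprS -mulrA.
  apply: (@le_trans _ _ ((1 - kappa) * #|B|%:R)); first lra.
  by rewrite ler_wpM2l// subr_ge0.
have [G0|G0] := posnP #|G|.
  exists [::]; rewrite G0 ln0// mul0r add0r; split => // h.
  by have := fintype0 h G0.
(* For this [n], [(1 - kappa)^n |G| <= exp (- kappa n) |G| < 1], so no large set remains unhit. *)
set n := (Num.truncn (ln #|G|%:R / kappa)).+1.
have G0' : (0 : R) < #|G|%:R by rewrite ltr0n.
have lG : 0 <= ln #|G|%:R / kappa.
  by apply: divr_ge0; [apply: ln_ge0; rewrite ler1n|exact: ltW].
have [Y [sY hY]] := greedy n; exists Y; split.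
  by rewrite sY /n -natr1 lerD2r truncn_le.
have {}hY : #|[set h in A | ~~ has (P h) Y]%SET|%:R < (1 : R).
  apply: (le_lt_trans hY).
  apply: (@le_lt_trans _ _ (expR (- kappa) ^+ n * #|G|%:R)).
    rewrite ler_wpM2r// lerXn2r ?nnegrE ?expR_ge0 ?subr_ge0//.
    exact: (expR_ge1Dx (- kappa)).
  rewrite -expRM_natl -[X in _ * X](lnK G0') -expRD expR_lt1.
  have := truncnS_gt (ln #|G|%:R / kappa); rewrite -/n ltr_pdivrMr// => h.
  by rewrite mulrN addrC subr_lt0.
move=> h gk; apply: contraT => gY.
move: hY; rewrite ltrn1 ltnS leqn0 cards_eq0 => /eqP/setP/(_ h).
by rewrite !inE gk gY.
Qed.

End bounded_measurable.

(** * Entropy of the unit ball *)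

Section subspace.
Context {d : measure_display} {T : measurableType d} {R : realType}.
Variables (mu : probability T R) (N : nat) (u : T -> 'rV[R]_N) (K p : R).
Hypotheses (p12 : 1 < p < 2) (N0 : (0 < N)%N).
Hypothesis bu : forall i, bmeas (fun x => u x 0 i).
Hypothesis ortho : forall i j, mean mu (fun x => u x 0 i * u x 0 j) = (i == j)%:R.
Hypothesis uK : forall x, dot (u x) (u x) <= K.

Implicit Types c : 'rV[R]_N.

(** [u x] lists the values at [x] of an orthonormal system, so [dot] on coefficient vectors is the
    L^2 inner product of the functions [ev c]. *)
Definition ev c x : R := dot c (u x).
Definition npow c : R := mean mu (fun x => `|ev c x| `^ p).
Definition lball : set 'rV[R]_N := [set c | npow c <= 1].

Let p0 : 0 <= p. Proof. by move: p12 => /andP[]; lra. Qed.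
Let pn0 : p != 0. Proof. by apply/eqP; move: p12 => /andP[]; lra. Qed.
Let p2 : 0 <= 2 - p. Proof. by move: p12 => /andP[]; lra. Qed.

Lemma bmeas_ev c : bmeas (ev c).
Proof. by apply: bmeas_sum => i; exact: bmeasZ. Qed.

Let bmeas_evp c : bmeas (fun x => `|ev c x| `^ p).
Proof. by apply: bmeas_powR => //; exact: bmeas_ev. Qed.

Lemma mean_ev_sqr c : mean mu (fun x => ev c x ^+ 2) = dot c c.
Proof.
have -> : (fun x => ev c x ^+ 2) =
    (fun x => \sum_i \sum_j (c 0 i * c 0 j) * (u x 0 i * u x 0 j)).
  apply/funext => x; rewrite expr2 /ev /dot mulr_suml; apply: eq_bigr => i _.
  by rewrite mulr_sumr; apply: eq_bigr => j _; ring.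
have b i j : bmeas (fun x => c 0 i * c 0 j * (u x 0 i * u x 0 j)).
  by apply: bmeasZ; exact: bmeasM.
rewrite mean_sum; last by move=> i; exact: bmeas_sum.
apply: eq_bigr => i _; rewrite mean_sum//.
rewrite (bigD1 i)//= big1 ?addr0.
  by rewrite meanZ; [rewrite ortho eqxx mulr1|exact: bmeasM].
move=> j ji; rewrite meanZ; last exact: bmeasM.
by rewrite ortho eq_sym (negbTE ji) mulr0.
Qed.

(** The function [dot (u x) (u x)] is the diagonal of the reproducing kernel; its integral is
    [N]. *)
Lemma dim_le : N%:R <= K.
Proof.
have -> : N%:R = mean mu (fun x => dot (u x) (u x)).
  rewrite /dot mean_sum; last by move=> i; exact: bmeasM.
  under eq_bigr do rewrite ortho eqxx.
  by rewrite sumr_const card_ord.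
rewrite -[leRHS](mean_cst mu K); apply: le_mean => //; last exact: bmeas_cst.
by apply: bmeas_sum => i; exact: bmeasM.
Qed.

Lemma K_ge1 : 1 <= K.
Proof. by apply: le_trans dim_le; rewrite ler1n. Qed.

Let K0 : 0 < K. Proof. by have := K_ge1; lra. Qed.

Lemma ev_sqr_le c x : ev c x ^+ 2 <= K * dot c c.
Proof.
rewrite mulrC; apply: (le_trans (dot_cauchy _ _)).
by rewrite ler_wpM2l ?dotvv_ge0.
Qed.

Lemma evB c c' x : ev (c - c') x = ev c x - ev c' x.
Proof. exact: dotBl. Qed.

Let sqr_powR (y : R) : 0 <= y -> y ^+ 2 = y `^ (2 - p) * y `^ p.
Proof.
move=> y0; rewrite -powRD; last by apply/implyP => /eqP; move: p12 => /andP[]; lra.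
by rewrite -powR_mulrn//; congr (_ `^ _); ring.
Qed.

(** Where [|ev c| <= t] the square is at most [t^(2-p) |ev c|^p], and elsewhere at most [B^2]. This
    is the only passage from the p-norm to the Euclidean norm, in which the coverings are made. *)
Lemma dot_le_npow c t B : 0 <= t -> (forall x, `|ev c x| <= B) ->
  dot c c <= t `^ (2 - p) * npow c + B ^+ 2 * mean mu (fun x => (t < `|ev c x|)%R%:R).
Proof.
move=> t0 cB; rewrite -mean_ev_sqr -!meanZ//; last first.
  by apply: bmeas_lt; exact: bmeas_ev.
have b1 := bmeasZ (t `^ (2 - p)) (bmeas_evp c).
have b2 := bmeasZ (B ^+ 2) (bmeas_lt t (bmeas_ev c)).
rewrite -meanD//; apply: le_mean; [|exact: bmeasD|].
  by apply: bmeasX; exact: bmeas_ev.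
move=> x; rewrite -(real_normK (num_real _)).
have [tx|xt] := ltP t `|ev c x|.
  rewrite mulr1 -[leLHS]add0r lerD ?mulr_ge0 ?powR_ge0//.
  by rewrite lerXn2r ?nnegrE// (le_trans _ (cB x)).
rewrite mulr0 addr0 sqr_powR//.
by rewrite ler_wpM2r ?powR_ge0// ge0_ler_powR ?nnegrE.
Qed.

Definition Tmax : R := K `^ p^-1.

Lemma TmaxE : Tmax `^ p = K.
Proof. by rewrite -powRrM mulVf// powRr1// ltW. Qed.

Lemma Tmax_gt0 : 0 < Tmax. Proof. exact: powR_gt0. Qed.

Lemma Tmax_leK : Tmax <= K.
Proof.
apply: ler1_powR; first exact: K_ge1.
by rewrite invf_le1; move: p12 => /andP[]; lra.
Qed.

(** Self-improvement of a sup bound: [s = (K |c|^2)^(1/2)] bounds [|ev c|], so splitting at level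
    [s] gives [s^2 <= K s^(2-p)], that is [s^p <= K]. *)
Lemma lball_ev c x : lball c -> `|ev c x| <= Tmax.
Proof.
move=> Sc; set s := Num.sqrt (K * dot c c).
have Kd : 0 <= K * dot c c by rewrite mulr_ge0 ?dotvv_ge0// ltW.
have evs y : `|ev c y| <= s by rewrite -sqrtr_sqr ler_wsqrtr// ev_sqr_le.
have s0 : 0 <= s by exact: sqrtr_ge0.
apply: (le_trans (evs x)).
have [->|sn0] := eqVneq s 0; first exact: ltW Tmax_gt0.
have sgt0 : 0 < s by rewrite lt_def sn0.
have := @dot_le_npow c s s s0 evs.
have -> : (fun y => (s < `|ev c y|)%R%:R) = (fun=> 0) :> (T -> R).
  by apply/funext => y; rewrite ltNge evs.
rewrite mean_cst mulr0 addr0 => h.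
have h2 : s ^+ 2 <= K * s `^ (2 - p).
  rewrite sqr_sqrtr// ler_pM2l// (le_trans h)// ler_piMr ?powR_ge0//.
have : s `^ p <= K.
  by move: h2; rewrite sqr_powR// mulrC ler_pM2r// powR_gt0.
move=> /(ge0_ler_powR (ltW _)) => /(_ p^-1).
rewrite !nnegrE => H.
have pV : 0 < p^-1 by rewrite invr_gt0; move: p12 => /andP[]; lra.
by have := H pV (powR_ge0 _ _) (ltW K0); rewrite -powRrM mulfV// powRr1.
Qed.

Lemma lball_dot c : lball c -> dot c c <= Tmax `^ (2 - p).
Proof.
move=> Sc; have := @dot_le_npow c Tmax Tmax (ltW Tmax_gt0) (fun x => lball_ev x Sc).
have -> : (fun y => (Tmax < `|ev c y|)%R%:R) = (fun=> 0) :> (T -> R).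
  by apply/funext => y; rewrite ltNge lball_ev.
rewrite mean_cst mulr0 addr0 => /le_trans; apply.
by rewrite ler_piMr ?powR_ge0.
Qed.

Lemma lball_coord c i : lball c -> `|c 0 i| <= K.
Proof.
move=> /lball_dot h; have T1 : 1 <= Tmax.
  by rewrite -(powRr0 K); apply: ler_powR; [exact: K_ge1|rewrite invr_ge0].
have : Tmax `^ (2 - p) <= K.
  by apply: (le_trans _ Tmax_leK); apply: ler1_powR => //; move: p12 => /andP[]; lra.
have := sqr_le_dot c i; have := K_ge1; move=> K1 h1 h2.
rewrite -(@ler_pXn2r _ 2) ?nnegrE// ?(ltW K0)// real_normK ?num_real//.
by have : K <= K ^+ 2 by [rewrite expr2 ler_peMl// ltW]; lra.
Qed.

Lemma npowB_le c c' : lball c -> lball c' -> npow (c - c') <= 8.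
Proof.
move=> Sc Sc'; apply: (@le_trans _ _ (4 * (npow c + npow c'))); last first.
  have -> : 8 = 4 * (1 + 1) :> R by ring.
  by rewrite ler_pM2l//; exact: lerD Sc Sc'.
rewrite -meanD// -meanZ; last exact: bmeasD.
apply: le_mean => //; first by apply: bmeasZ; exact: bmeasD.
by move=> x; rewrite evB; exact: powR_normB.
Qed.

Lemma evB_lball c c' x : lball c -> lball c' -> `|ev (c - c') x| <= 2 * Tmax.
Proof.
move=> /(lball_ev x) h /(lball_ev x) h'.
by rewrite evB (le_trans (ler_normB _ _))//; lra.
Qed.

Definition logK : R := ln (4 * K).

Lemma logK_ge1 : 1 <= logK.
Proof.
have e4 := expR1_le4 R.
rewrite /logK -ler_expR lnK ?posrE; last by have := K_ge1; lra.
by have := K_ge1; lra.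
Qed.

(* Only the logarithm of the size of a net of differences enters the size of
   the pool, so the pool is polynomial in K although the net is exponential. *)
Lemma detecting_pool t : 1 <= t ->
  exists Y : seq T, ln (2 * (size Y)%:R + 1) <= 5 * logK /\
    forall c c', lball c -> lball c' ->
      (forall y, y \in Y -> `|ev (c - c') y| <= t / 2) ->
      mean mu (fun x => (t < `|ev (c - c') x|)%R%:R) <= K ^- 2.
Proof.
move=> t1; have K1 := K_ge1.
have dl : 0 < (4 * K)^-1 by rewrite invr_gt0 mulr_gt0.
have KK : 0 <= 2 * K by lra.
pose gl := @grid_label R N (2 * K) (4 * K)^-1.
pose bad e := K ^- 2 <= mean mu (fun x => (t < `|ev e x|)%R%:R).
pose diff e := exists c c', [/\ lball c, lball c' & e = c - c'].
(* Each grid cell that meets the bad differences gets a bad difference as representative; it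
   suffices that the pool detects these finitely many. *)
have /choice[rep repP] : forall g, exists e, forall e', diff e' -> bad e' ->
    gl e' = g -> [/\ diff e, bad e & gl e = g].
  move=> g; have [[e [de be eg]]|no] :=
    pselect (exists e, [/\ diff e, bad e & gl e = g]); first by exists e.
  by exists 0 => e de be eg; exfalso; apply: no; exists e.
have kap : 0 < K ^- 2 <= 1.
  by rewrite invr_gt0 exprn_gt0//= invf_le1 ?exprn_gt0// exprn_ege1.
have [|Y [sY hY]] := @greedy_hitting _ _ _ mu _ (fun g x => (t < `|ev (rep g) x|)%R) (K ^- 2) _ kap.
  by move=> g; apply: bmeas_lt; exact: bmeas_ev.
exists Y; split.
  set G := #|_| in sY.
  have G0 : (0 < G)%N by apply/card_gt0P; exists (gl 0).
  have lG : ln G%:R <= 16 * K ^+ 3.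
    rewrite -(expRK (16 * K ^+ 3)) ler_ln ?posrE ?expR_gt0 ?ltr0n//.
    apply: (le_trans (card_grid dl KK)); rewrite ler_expR.
    have -> : 2 * (2 * K) / (4 * K)^-1 = 16 * K ^+ 2 by rewrite invrK; ring.
    apply: (@le_trans _ _ (K * (16 * K ^+ 2))); last first.
      by rewrite le_eqVlt; apply/orP; left; apply/eqP; ring.
    have K20 := sqr_ge0 K; have h : 0 < 16 * K ^+ 2 + 1 by lra.
    apply: ler_pM; rewrite ?dim_le//.
      by rewrite ln_ge0//; lra.
    rewrite -ler_expR lnK ?posrE//.
    by have := expR_ge1Dx (16 * K ^+ 2); lra.
  (* The logarithm [16 K^3] of the number of cells, divided by the proportion [K^-2], plus 1. Below,
     [(4 K)^5 = 1024 K^5] leaves ample room for [2 * 17 K^5 + 1]. *)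
  have sY' : (size Y)%:R <= 17 * K ^+ 5.
    apply: (le_trans sY); rewrite invrK.
    have : ln G%:R * K ^+ 2 <= 16 * K ^+ 3 * K ^+ 2 by rewrite ler_wpM2r ?sqr_ge0.
    have -> : 16 * K ^+ 3 * K ^+ 2 = 16 * K ^+ 5 by ring.
    have : 1 <= K ^+ 5 by rewrite exprn_ege1.
    lra.
  rewrite -[leRHS](_ : ln ((4 * K) ^+ 5) = _); last by rewrite lnXn ?mulr_gt0// [RHS]mulr_natl.
  have Y0 : (0 : R) <= (size Y)%:R by exact: ler0n.
  have K5 : 0 < (4 * K) ^+ 5 by rewrite exprn_gt0// mulr_gt0.
  have Y1 : 0 < 2 * (size Y)%:R + 1 :> R by rewrite ltr_wpDl// mulr_ge0.
  rewrite ler_ln ?posrE//.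
  have -> : (4 * K) ^+ 5 = 1024 * K ^+ 5 by ring.
  have : 1 <= K ^+ 5 by rewrite exprn_ege1.
  lra.
move=> c c' Sc Sc' cY; set e := c - c'.
rewrite leNgt; apply/negP => /ltW be.
have de : diff e by exists c, c'.
have [[c1 [c1' [Sc1 Sc1' e1E]]] be1 ge1] := repP (gl e) e de be erefl.
set e1 := rep (gl e) in e1E be1 ge1.
have /hasP[y Yy /=] := hY (gl e) be1.
rewrite -/e1; apply/negP; rewrite -leNgt.
have coord f : diff f -> forall i, `|f 0 i| <= 2 * K.
  move=> [b [b' [Sb Sb' ->]]] i; rewrite !mxE (le_trans (ler_normB _ _))//.
  by have := lball_coord i Sb; have := lball_coord i Sb'; lra.
have de1 : diff e1 by exists c1, c1'.
have ee1 := grid_label_eq dl (coord _ de1) (coord _ de) ge1.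
(* The side [1 / (4 K)] gives [K N / (4 K)^2 <= 1/16]. As [t >= 1], a value at most [t / 2] for [e]
   stays below [t] for its representative, against the choice of [y]. *)
have small : `|ev (e1 - e) y| <= 4^-1.
  rewrite -(@ler_pXn2r _ 2) ?nnegrE// real_normK ?num_real//.
  apply: (le_trans (ev_sqr_le _ _)).
  apply: (@le_trans _ _ (K * (N%:R * (4 * K)^-1 ^+ 2))).
    rewrite ler_pM2l// mulr_natl -[N in leRHS]card_ord -sumr_const.
    apply: ler_sum => i _; rewrite -expr2 -(real_normK (num_real _)).
    have -> : (e1 - e) 0 i = e1 0 i - e 0 i by rewrite !mxE.
    by apply: lerXn2r (ee1 i); rewrite ?nnegrE// (ltW dl).
  apply: (@le_trans _ _ (K * (K * (4 * K)^-1 ^+ 2))).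
    by rewrite ler_pM2l// ler_wpM2r ?sqr_ge0// dim_le.
  rewrite le_eqVlt; apply/orP; left; apply/eqP; field; rewrite gt_eqF//.
have -> : ev e1 y = ev (e1 - e) y + ev e y by rewrite evB subrK.
by have := cY _ Yy; have := ler_normD (ev (e1 - e) y) (ev e y); rewrite -/e; lra.
Qed.

End subspace.

(** * Dyadic induction over the scales, and passage to the sample *)

Section ball_entropy.
Context {d : measure_display} {T : measurableType d} {R : realType}.
Variables (mu : probability T R) (N : nat) (u : T -> 'rV[R]_N) (K p : R).
Variable C : R.
Hypotheses (p12 : 1 < p < 2) (N0 : (0 < N)%N) (C_ge : 3840 <= C).
Hypothesis bu : forall i, bmeas (fun x => u x 0 i).
Hypothesis ortho : forall i j, mean mu (fun x => u x 0 i * u x 0 j) = (i == j)%:R.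
Hypothesis uK : forall x, dot (u x) (u x) <= K.

Local Notation ball := (lball mu u p).
Local Notation q := (logK K).

Let K1 : 1 <= K. Proof. exact: K_ge1 N0 bu ortho uK. Qed.
Let q1 : 1 <= q. Proof. exact: logK_ge1 N0 bu ortho uK. Qed.
Let K0 : 0 < K. Proof. by have := K1; lra. Qed.
Let K0' : 0 <= K. Proof. exact: ltW. Qed.
Let q0 : 0 <= q. Proof. by have := q1; lra. Qed.
Let Kq0 : 0 <= K * q. Proof. exact: mulr_ge0. Qed.
Let C0 : 0 <= C. Proof. by have := C_ge; lra. Qed.
Let p2 : 0 <= 2 - p. Proof. by move: p12 => /andP[]; lra. Qed.
Let p0 : 0 <= p. Proof. by move: p12 => /andP[]; lra. Qed.

Let powR2p (t : R) : 0 < t -> t `^ (2 - p) = t ^+ 2 / t `^ p.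
Proof.
by move=> t0; rewrite powRB ?(gt_eqF t0) ?implybT// (powR_mulrn 2 (ltW t0)).
Qed.

Let powR_double (t r : R) : 0 <= t -> 0 <= r <= 1 -> (2 * t) `^ r <= 2 * t `^ r.
Proof.
move=> t0 /andP[r0 r1]; rewrite powRM// ler_wpM2r ?powR_ge0//.
by apply: ler1_powR; rewrite ?ler1n.
Qed.

Let powRV_half (t : R) : 0 < t -> ((2 * t) `^ p)^-1 <= (t `^ p)^-1 / 2.
Proof.
move=> t0; rewrite powRM ?(ltW t0)// invfM mulrC ler_pM2l ?invr_gt0 ?powR_gt0//.
rewrite lef_pV2 ?posrE ?powR_gt0//.
by apply: le1r_powR; [rewrite ler1n|move: p12 => /andP[]; lra].
Qed.

(** The 12 is 8 + 4: [8 t^(2-p)] from the p-norm of a difference, and 4 from an exceptional set of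
    measure at most [K^-2], on which the square is at most [4 K^2]. *)
Let close2 (t : R) (c c' : 'rV[R]_N) : Prop :=
  dot (c - c') (c - c') <= 12 * t `^ (2 - p).

Let entropy_coarse t : Tmax K p <= t ->
  entropy_le ball (close2 t) (C * (K * q) * (t `^ p)^-1).
Proof.
move=> Tt; exists 1%N, (fun=> ord0); split.
  by rewrite -[leLHS]expR0 ler_expR !mulr_ge0// invr_ge0 powR_ge0.
move=> c c' Sc Sc' _; apply: (le_trans (dot_sub_le _ _)).
have h := lball_dot p12 N0 bu ortho uK Sc.
have h' := lball_dot p12 N0 bu ortho uK Sc'.
have T0 : 0 < Tmax K p by exact: powR_gt0.
have : Tmax K p `^ (2 - p) <= t `^ (2 - p).
  by rewrite ge0_ler_powR ?nnegrE// ?(ltW T0)// (le_trans (ltW T0)).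
have := powR_ge0 t (2 - p); lra.
Qed.

(** Below scale 1 a grid of side [t / K] is enough: its cost [N ln (2 K^2 / t + 1)] is at most
    [K (2 q + 1/t)], which [3 K q t^(-p)] dominates because [p > 1]. *)
Let entropy_fine t : 0 < t <= 1 ->
  entropy_le ball (close2 t) (C * (K * q) * (t `^ p)^-1).
Proof.
move=> /andP[t0 t1]; have tK : 0 < t / K by rewrite divr_gt0.
have tp1 : t `^ p <= t by apply: ge1r_powR; [rewrite t0|move: p12 => /andP[]; lra].
have tp0 : 0 < t `^ p by exact: powR_gt0.
have tpV : t^-1 <= (t `^ p)^-1 by rewrite lef_pV2.
have tV1 : 1 <= t^-1 by rewrite invf_ge1.
apply: entropy_le_sub (@entropy_le_grid _ _ ball K (t / K) tK (ltW K0) _) => //.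
- have -> : 2 * K / (t / K) + 1 = 2 * K ^+ 2 / t + 1 by field; rewrite !gt_eqF.
  have K2 : 1 <= K ^+ 2 by rewrite exprn_ege1.
  apply: (@le_trans _ _ (K * (2 * q + t^-1))).
    apply: ler_pM => //; [|exact: (dim_le bu ortho uK)|].
      by rewrite ln_ge0// lerDr divr_ge0 ?mulr_ge0// ?sqr_ge0// (ltW t0).
    apply: (@le_trans _ _ (ln ((4 * K) ^+ 2 * t^-1))).
      have h1 : 0 <= 2 * K ^+ 2 / t by rewrite divr_ge0 ?mulr_ge0// ?sqr_ge0// (ltW t0).
      have h2 : 1 <= K ^+ 2 * t^-1 by rewrite -[leLHS]mulr1 ler_pM.
      have e2 : (4 * K) ^+ 2 / t = 16 * (K ^+ 2 * t^-1) by ring.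
      rewrite ler_ln ?posrE ?e2; lra.
    have K4 : 0 < 4 * K by rewrite mulr_gt0.
    rewrite lnM ?posrE ?exprn_gt0// ?invr_gt0//.
    rewrite lnXn// -[ln _ *+ 2]mulr_natl -/q lerD2l.
    by rewrite -ler_expR lnK ?posrE ?invr_gt0//; have := expR_ge1Dx (t^-1); lra.
  have h0 : 1 <= (t `^ p)^-1 by lra.
  have h : (t `^ p)^-1 <= q * (t `^ p)^-1 by rewrite ler_peMl//; lra.
  have h' : q <= q * (t `^ p)^-1 by rewrite ler_peMr.
  have h1 : 2 * q + t^-1 <= 3 * (q * (t `^ p)^-1) by lra.
  apply: (le_trans (ler_wpM2l K0' h1)).
  have h2 : 0 <= K * (q * (t `^ p)^-1) by rewrite !mulr_ge0//; lra.
  have : 3 * (K * (q * (t `^ p)^-1)) <= C * (K * (q * (t `^ p)^-1)).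
    by rewrite ler_wpM2r//; have := C_ge; lra.
  lra.
- move=> c c' Sc Sc' cc'; rewrite /close2.
  apply: (@le_trans _ _ (N%:R * (t / K) ^+ 2)).
    rewrite mulr_natl -[N in leRHS]card_ord -sumr_const.
    apply: ler_sum => i _; rewrite -expr2 -(real_normK (num_real _)).
    have -> : (c - c') 0 i = c 0 i - c' 0 i by rewrite !mxE.
    by apply: lerXn2r (cc' i); rewrite ?nnegrE// (ltW tK).
  apply: (@le_trans _ _ (K * (t / K) ^+ 2)).
    by rewrite ler_wpM2r ?sqr_ge0// (dim_le bu ortho uK).
  have -> : K * (t / K) ^+ 2 = t ^+ 2 / K by field; rewrite gt_eqF.
  apply: (@le_trans _ _ (t ^+ 2)).
    by rewrite ler_pdivrMr// ler_peMr// sqr_ge0.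
  rewrite powR2p// mulrCA ler_peMr ?sqr_ge0//; lra.
- by move=> c Sc i; exact: lball_coord p12 N0 bu ortho uK _ _ Sc.
Qed.

(** Each L^2 piece of scale [2 t] is refined by the perceptron on the pool with threshold [t / 4].
    Then two functions of one piece differ by at most [t / 2] on the pool, hence by at most [t] off
    a set of measure [K^-2], and [dot_le_npow] returns to L^2. The old cover costs half the target
    since [(2 t)^(-p) <= t^(-p) / 2], and the refinement may use the other half. *)
Let entropy_step t : 1 <= t ->
  entropy_le ball (close2 (2 * t)) (C * (K * q) * ((2 * t) `^ p)^-1) ->
  entropy_le ball (close2 t) (C * (K * q) * (t `^ p)^-1).
Proof.
move=> t1 H; have t0 : 0 < t by lra.
have tp0 : 0 < t `^ p by exact: powR_gt0.
have [Y [sY hY]] := detecting_pool p12 N0 bu ortho uK t1.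
have B0 : 0 <= C / 2 * (K * q) * (t `^ p)^-1.
  by rewrite !mulr_ge0// invr_ge0 powR_ge0.
suff H2 c0 : ball c0 -> entropy_le (ball `&` close2 (2 * t) c0) (close2 t)
    (C / 2 * (K * q) * (t `^ p)^-1).
  apply: entropy_le_sub (entropy_le_comp B0 H H2); [by []| |by move=> c c' _ _].
  have : C * (K * q) * ((2 * t) `^ p)^-1 <= C * (K * q) * ((t `^ p)^-1 / 2).
    by rewrite ler_wpM2l ?powRV_half// mulr_ge0.
  lra.
move=> Sc0.
have r0 : 0 <= 12 * (2 * t) `^ (2 - p) by rewrite mulr_ge0 ?powR_ge0.
have t4 : 0 < t / 4 by rewrite divr_gt0.
have := @entropy_le_perceptron _ _ 'I_(size Y) (fun j => u (nth point Y j)) K (t / 4)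
  K0 t4 (fun j => uK _) (ball `&` close2 (2 * t) c0) c0 _ r0.
case=> [c [_]|n [l [nB lP]]]; first by rewrite /close2 dot_subC.
exists n, l; split; last first.
  move=> c c' BSc BSc' ll; have [Sc _] := BSc; have [Sc' _] := BSc'; rewrite /close2.
  have h y : y \in Y -> `|ev u (c - c') y| <= t / 2.
    move=> yY; have iY : (index y Y < size Y)%N by rewrite index_mem.
    have := lP _ _ BSc BSc' ll (Ordinal iY); rewrite /= nth_index//.
    by have -> : 2 * (t / 4) = t / 2 by field.
  have m0 := hY c c' Sc Sc' h.
  have tn0 : 0 <= t by lra.
  apply: (le_trans (dot_le_npow p12 bu ortho tn0 (fun x => evB_lball p12 N0 bu ortho uK x Sc Sc'))).
  have n8 := npowB_le p12 bu Sc Sc'.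
  have t2 : 1 <= t `^ (2 - p) by rewrite -[leLHS](powRr0 t); apply: ler_powR.
  have h1 : t `^ (2 - p) * npow mu u p (c - c') <= t `^ (2 - p) * 8.
    by rewrite ler_wpM2l ?powR_ge0.
  have TK := Tmax_leK p12 N0 bu ortho uK.
  have h2 : (2 * Tmax K p) ^+ 2 * mean mu (fun x => (t < `|ev u (c - c') x|)%R%:R) <= 4.
    apply: (@le_trans _ _ ((2 * K) ^+ 2 * K ^- 2)).
      apply: ler_pM => //; first exact: sqr_ge0.
        by apply: mean_ge0 => x.
      rewrite lerXn2r ?nnegrE ?mulr_ge0 ?powR_ge0//.
      by rewrite ler_pM2l.
    by rewrite le_eqVlt; apply/orP; left; apply/eqP; field; rewrite gt_eqF.
  lra.
apply: (le_trans nB); rewrite ler_expR card_ord.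
apply: (@le_trans _ _ ((K * (384 * t `^ (2 - p)) / t ^+ 2) * (5 * q))).
  have w0 : 0 <= K * (12 * (2 * t) `^ (2 - p)) / (t / 4) ^+ 2.
    by rewrite divr_ge0 ?sqr_ge0// mulr_ge0.
  apply: ler_pM => //; first by rewrite ln_ge0// lerDr mulr_ge0.
  have -> : K * (12 * (2 * t) `^ (2 - p)) / (t / 4) ^+ 2 =
      K * (192 * (2 * t) `^ (2 - p)) / t ^+ 2.
    by field; rewrite gt_eqF.
  rewrite ler_pM2r ?invr_gt0 ?exprn_gt0// ler_pM2l//.
  have : (2 * t) `^ (2 - p) <= 2 * t `^ (2 - p).
    by apply: powR_double; [lra|move: p12 => /andP[]; lra].
  lra.
rewrite powR2p//.
(* Origin of 3840, twice this 1920: [12 * 16] from the radius and the threshold [t / 4], 2 from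
   doubling the scale, 5 from the logarithm of the pool. *)
have -> : K * (384 * (t ^+ 2 / t `^ p)) / t ^+ 2 * (5 * q) = 1920 * (K * q * (t `^ p)^-1).
  by field; rewrite !gt_eqF.
have : 0 <= K * q * (t `^ p)^-1 by rewrite mulr_ge0// invr_ge0 ltW.
have := C_ge; set z := K * q * _ => hC z0.
have -> : C / 2 * (K * q) / t `^ p = C / 2 * z by rewrite /z; ring.
by rewrite ler_wpM2r//; lra.
Qed.

(** Induction on the number of doublings that carry [t] above [Tmax], where the whole ball is a
    single piece. *)
Lemma entropy_le_lball_dot t : 0 < t ->
  entropy_le ball (close2 t) (C * (K * q) * (t `^ p)^-1).
Proof.
move=> t0; have [t1|t1] := leP t 1; first by apply: entropy_fine; rewrite t0.
have [n Tn] : exists n, Tmax K p <= 2 ^+ n * t.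
  exists (Num.truncn (Tmax K p)).+1.
  apply: (le_trans (ltW (truncnS_gt _))).
  rewrite -[leLHS]mulr1 ler_pM// ?(ltW t1)// -natrX ler_nat.
  exact/ltnW/ltn_expl.
elim: n t t0 t1 Tn => [|n IH] t t0 t1 Tn.
  by apply: entropy_coarse; rewrite expr0 mul1r in Tn.
apply: entropy_step; first exact: ltW.
by apply: IH; [lra|lra|rewrite mulrA -exprSr].
Qed.

(** The L^2 cover at scale [tau] costs [K q tau^(-p)], and refining it on the sample costs a
    multiple of [K tau^(2-p) l / t^2]. The choice [tau^2 = t^2 q / l] equalizes both and turns
    [q tau^(-p)] into [l^(p/2) q^(1-p/2) t^(-p)]. *)
Lemma entropy_le_lball_sample (J : finType) (x : J -> T) t : (2 <= #|J|)%N -> 0 < t ->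
  entropy_le ball (fun c c' => forall j, `|ev u c (x j) - ev u c' (x j)| <= t)
    (2 * C * (K * (ln #|J|%:R `^ (p / 2) * q `^ (1 - p / 2))) * (t `^ p)^-1).
Proof.
move=> J2 t0; set l := ln #|J|%:R.
have J2' : 2 <= #|J|%:R :> R by rewrite ler_nat.
have l0 : 0 < l by rewrite ln_gt0//; lra.
have q0' : 0 < q by have := q1; lra.
set tau := t * (q / l) `^ 2^-1.
have ql0 : 0 < q / l by rewrite divr_gt0.
have tau0 : 0 < tau by rewrite mulr_gt0// powR_gt0.
have tau2 : tau ^+ 2 = t ^+ 2 * (q / l).
  rewrite /tau exprMn -[(_ `^ _) ^+ 2]powR_mulrn ?powR_ge0// -powRrM mulVf// powRr1//.
  exact: ltW.
have taup : tau `^ p = t `^ p * ((q / l) `^ (p / 2)).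
  by rewrite /tau (@powRM _ t) ?powR_ge0 ?(ltW t0)// -powRrM [_ * p]mulrC.
set Lq := l `^ (p / 2) * q `^ (1 - p / 2).
have e1 : q / tau `^ p = Lq / t `^ p.
  rewrite taup powRM ?invr_ge0 ?(ltW l0) ?(ltW q0')// -[l^-1]powR_inv1 ?(ltW l0)//.
  rewrite -powRrM mulN1r powRN /Lq powRB ?(gt_eqF q0') ?implybT//.
  rewrite powRr1 ?(ltW q0')//.
  by field; rewrite !gt_eqF ?powR_gt0.
have Lt0 : 0 <= Lq / t `^ p by rewrite divr_ge0 ?mulr_ge0 ?powR_ge0.
have B0 : 0 <= C * (K * Lq) * (t `^ p)^-1.
  have -> : C * (K * Lq) / t `^ p = C * (K * (Lq / t `^ p)) by ring.
  by rewrite mulr_ge0// mulr_ge0.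
have t2 : 0 < t / 2 by rewrite divr_gt0.
have r0 : 0 <= 12 * tau `^ (2 - p) by rewrite mulr_ge0 ?powR_ge0.
suff H2 c0 : ball c0 -> entropy_le (ball `&` close2 tau c0)
    (fun c c' => forall j, `|ev u c (x j) - ev u c' (x j)| <= t)
    (C * (K * Lq) * (t `^ p)^-1).
  apply: entropy_le_sub (entropy_le_comp B0 (entropy_le_lball_dot tau0) H2);
    [by []| |by move=> c c' _ _].
  have -> : C * (K * q) / tau `^ p = C * K * (q / tau `^ p) by ring.
  by rewrite e1 le_eqVlt; apply/orP; left; apply/eqP; ring.
move=> Sc0.
have := @entropy_le_perceptron _ _ J (u \o x) K (t / 2) K0 t2 (fun j => uK _)
  (ball `&` close2 tau c0) c0 _ r0.
case=> [c [_]|n [lab [nB lP]]]; first by rewrite /close2 dot_subC.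
exists n, lab; split; last first.
  move=> c c' Sc Sc' ll j; rewrite -evB; have := lP c c' Sc Sc' ll j.
  by have -> : 2 * (t / 2) = t by field.
apply: (le_trans nB); rewrite ler_expR.
have lJ : ln (2 * #|J|%:R + 1) <= 3 * l.
  have -> : 3 * l = ln (#|J|%:R ^+ 3) by rewrite lnXn ?mulr_natl//; lra.
  have J3 : 2 * #|J|%:R + 1 <= #|J|%:R ^+ 3 :> R.
    by rewrite !exprS expr0; move: J2'; set z := _%:R => z2; nra.
  by rewrite ler_ln ?posrE//; lra.
have w0 : 0 <= K * (12 * tau `^ (2 - p)) / (t / 2) ^+ 2.
  by rewrite divr_ge0 ?sqr_ge0// mulr_ge0.
apply: (le_trans (ler_wpM2l w0 lJ)).
rewrite powR2p// tau2.
have -> : K * (12 * (t ^+ 2 * (q / l) / tau `^ p)) / (t / 2) ^+ 2 * (3 * l) =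
    144 * (K * (q / tau `^ p)).
  by field; rewrite !gt_eqF ?powR_gt0.
rewrite e1.
have -> : C * (K * Lq) / t `^ p = C * (K * (Lq / t `^ p)) by ring.
apply: ler_wpM2r; first exact: mulr_ge0 K0' Lt0.
by have := C_ge; lra.
Qed.

End ball_entropy.

(** * The expected deviation *)

(** The integral of a nonnegative function is a supremum over the simple functions below it, hence
    monotone without measurability. This lets the supremum over the whole ball be integrated as it
    stands. *)
Lemma ge0_le_integral_nonmeasurable {d : measure_display} {T : measurableType d}
    {R : realType} (mu : {measure set T -> \bar R}) (f g : T -> \bar R) :
  (forall x, 0 <= f x)%E -> (forall x, f x <= g x)%E ->
  (\int[mu]_x f x <= \int[mu]_x g x)%E.
Proof.
move=> f0 fg; rewrite !ge0_integralTE//; last first.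
  by move=> x; exact: le_trans (fg x).
apply: ereal_sup_le => _ [h hf <-]; exists h => // x.
exact: le_trans (hf x) (fg x).
Qed.

Section mean_bool.
Context {d : measure_display} {T : measurableType d} {R : realType}.
Variables (mu : probability T R) (Q : T -> bool).
Hypothesis mQ : measurable [set x | Q x].

Lemma bmeas_set : bmeas (fun x => (Q x)%:R : R).
Proof.
apply: bmeas_bool; apply: (measurable_fun_bool true).
rewrite setTI (_ : _ @^-1` _ = [set x | Q x])//.
Qed.

Lemma mean_boolE : (mean mu (fun x => (Q x)%:R))%:E = mu [set x | Q x].
Proof.
rewrite mean_EFin; last exact: bmeas_set.
transitivity (\int[mu]_x (\1_[set x | Q x] x)%:E)%E.
  apply: eq_integral => x _; rewrite indicE; congr (_%:R%:E); congr nat_of_bool.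
  by apply/idP/idP; rewrite inE.
rewrite (integral_indic mu measurableT mQ); congr (mu _); exact: setIT.
Qed.

End mean_bool.

(** * The law of a quantized independent sample *)

Section quantized_sample.
Context {d0 d : measure_display} {T0 : measurableType d0} {T : measurableType d}.
Context {R : realType} {G : finType} {m : nat}.
Variables (P : probability T0 R) (mu : probability T R) (q : T -> G).
Variable X : 'I_m -> T0 -> T.
Hypothesis mq : forall i, measurable (q @^-1` [set i]).
Hypothesis mX : forall j, measurable_fun [set: T0] (X j).
Hypothesis iid : forall A : 'I_m -> set T, (forall j, measurable (A j)) ->
  P (\bigcap_(j in [set: 'I_m]) (X j @^-1` A j)) = (\prod_j mu (A j))%E.

Definition cell_weight (i : G) : R := mean mu (fun x => (q x == i)%:R).

Definition cells (w : T0) : {ffun 'I_m -> G} := [ffun j => q (X j w)].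

Let mq' i : measurable [set x | q x == i].
Proof.
rewrite (_ : [set x | _] = q @^-1` [set i])//.
by apply/seteqP; split => x /= /eqP.
Qed.

Let bq i : bmeas (fun x => (q x == i)%:R : R).
Proof. exact: bmeas_set. Qed.

Lemma mean_quantized (v : G -> R) :
  mean mu (fun x => v (q x)) = \sum_i cell_weight i * v i.
Proof.
have -> : (fun x => v (q x)) = (fun x => \sum_i v i * (q x == i)%:R).
  apply/funext => x; rewrite (bigD1 (q x))//= eqxx mulr1 big1 ?addr0// => i.
  by rewrite eq_sym => /negbTE ->; rewrite mulr0.
rewrite mean_sum; last by move=> i; exact: bmeasZ.
by apply: eq_bigr => i _; rewrite meanZ// mulrC.
Qed.

Lemma bmeas_quantized (v : G -> R) : bmeas (fun x => v (q x)).
Proof.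
have -> : (fun x => v (q x)) = (fun x => \sum_i v i * (q x == i)%:R).
  apply/funext => x; rewrite (bigD1 (q x))//= eqxx mulr1 big1 ?addr0// => i.
  by rewrite eq_sym => /negbTE ->; rewrite mulr0.
by apply: bmeas_sum => i; exact: bmeasZ.
Qed.

Lemma cell_weight_ge0 i : 0 <= cell_weight i.
Proof. exact: mean_ge0. Qed.

Lemma sum_cell_weight : \sum_i cell_weight i = 1.
Proof.
rewrite -[RHS](mean_cst mu) (mean_quantized (fun=> 1)).
by apply: eq_bigr => i _; rewrite mulr1.
Qed.

Let cell_weightE i : (cell_weight i)%:E = mu (q @^-1` [set i]).
Proof.
rewrite /cell_weight mean_boolE//; congr (mu _).
by apply/seteqP; split => x /= /eqP.
Qed.

Let cellsE (x : {ffun 'I_m -> G}) :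
  [set w | cells w == x] = \bigcap_(j in [set: 'I_m]) (X j @^-1` (q @^-1` [set x j])).
Proof.
apply/seteqP; split => w /=.
  by move=> /eqP <- j _ /=; rewrite ffunE.
by move=> H; apply/eqP/ffunP => j; rewrite ffunE; exact: (H j I).
Qed.

Let mcells x : measurable [set w | cells w == x].
Proof.
rewrite cellsE; apply: fin_bigcap_measurable => // j _.
by rewrite -[X in measurable X]setTI; apply: mX.
Qed.

(** Independence enters here: a prescribed vector of cells is an intersection of preimages, one for
    each sample point. *)
Lemma prob_cells x :
  mean P (fun w => (cells w == x)%:R) = weight cell_weight x.
Proof.
apply: EFin_inj; rewrite mean_boolE// cellsE iid//.
by rewrite /weight -prodEFin; apply: eq_bigr => j _; rewrite cell_weightE.
Qed.

Let cells_sum (v : {ffun 'I_m -> G} -> R) :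
  (fun w => v (cells w)) = (fun w => \sum_x v x * (cells w == x)%:R).
Proof.
apply/funext => w; rewrite (bigD1 (cells w))//= eqxx mulr1 big1 ?addr0// => x.
by rewrite eq_sym => /negbTE ->; rewrite mulr0.
Qed.

Lemma bmeas_cells (v : {ffun 'I_m -> G} -> R) : bmeas (fun w => v (cells w)).
Proof.
by rewrite cells_sum; apply: bmeas_sum => x; apply: bmeasZ; exact: bmeas_set.
Qed.

Lemma mean_cells (v : {ffun 'I_m -> G} -> R) :
  mean P (fun w => v (cells w)) = \sum_x weight cell_weight x * v x.
Proof.
rewrite cells_sum mean_sum; last by move=> x; apply: bmeasZ; exact: bmeas_set.
by apply: eq_bigr => x _; rewrite meanZ; [rewrite prob_cells mulrC|exact: bmeas_set].
Qed.

End quantized_sample.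

Lemma measurable_grid_label {d : measure_display} {T : measurableType d}
    {R : realType} N (u : T -> 'rV[R]_N) (r e : R) i :
  0 < e -> (forall k, measurable_fun [set: T] (fun x => u x 0 k)) ->
  (forall x k, `|u x 0 k| <= r) ->
  measurable ((fun x => grid_label r e (u x)) @^-1` [set i]).
Proof.
move=> e0 mcoord ur.
pose h k x := (u x 0 k + r) / e.
have -> : (fun x => grid_label r e (u x)) @^-1` [set i] =
    \bigcap_(k in [set: 'I_N]) \bigcup_(n in [set n | inord n = i k])
      (h k @^-1` `[n%:R, n.+1%:R[).
  have h0 k x : 0 <= h k x.
    by rewrite divr_ge0 ?(ltW e0)//; have := ur x k; rewrite ler_norml; lra.
  apply/seteqP; split => x /=.
    move=> /ffunP H k _; exists (Num.truncn (h k x)); first by rewrite -(H k) ffunE.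
    by rewrite /= in_itv /=; exact: truncn_itv.
  move=> H; apply/ffunP => k; have [n /= nk] := H k Logic.I.
  rewrite in_itv /= => hn; rewrite ffunE -nk; congr inord.
  by apply: truncn_def.
apply: fin_bigcap_measurable => // k _; apply: bigcup_measurable => n _.
rewrite -[X in measurable X]setTI.
have mh : measurable_fun [set: T] (h k).
  by apply: measurable_funM => //; apply: measurable_funD => //; exact: mcoord.
exact: mh.
Qed.

Section expectation.
Context {d : measure_display} {T : measurableType d} {R : realType}.
Variables (mu : probability T R) (N : nat) (u : T -> 'rV[R]_N) (K p : R).
Hypotheses (p12 : 1 < p < 2) (N0 : (0 < N)%N).
Hypothesis bu : forall i, bmeas (fun x => u x 0 i).
Hypothesis ortho : forall i j, mean mu (fun x => u x 0 i * u x 0 j) = (i == j)%:R.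
Hypothesis uK : forall x, dot (u x) (u x) <= K.
Context {d0 : measure_display} {T0 : measurableType d0} (P : probability T0 R).
Variables (m : nat) (X : 'I_m -> T0 -> T).
Hypothesis m2 : (2 <= m)%N.
Hypothesis mX : forall j, measurable_fun [set: T0] (X j).
Hypothesis iid : forall A : 'I_m -> set T, (forall j, measurable (A j)) ->
  P (\bigcap_(j in [set: 'I_m]) (X j @^-1` A j)) = (\prod_j mu (A j))%E.

Local Notation ball := (lball mu u p).
Local Notation q := (logK K).
Let Lq : R := ln m%:R `^ (p / 2) * q `^ (1 - p / 2).
Variable C : R.
Hypothesis C_ge : 3840 <= C.
Let H : R := 2 * C * (K * Lq).
Let cc := chain_const p.

Let K1 : 1 <= K. Proof. exact: K_ge1 N0 bu ortho uK. Qed.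
Let K0 : 0 < K. Proof. by have := K1; lra. Qed.
Let m0 : 0 < m%:R :> R. Proof. by rewrite ltr0n; exact: ltn_trans m2. Qed.
Let C0 : 0 <= C. Proof. by have := C_ge; lra. Qed.
Let Lq0 : 0 <= Lq. Proof. by rewrite mulr_ge0 ?powR_ge0. Qed.
Let H0 : 0 <= H. Proof.
by apply: mulr_ge0; [exact: mulr_ge0|exact: mulr_ge0 (ltW K0) Lq0].
Qed.
Let p0 : p != 0. Proof. by apply/eqP; move: p12 => /andP[]; lra. Qed.

Let ball0 : ball 0.
Proof.
rewrite /lball /= /npow (_ : (fun x => _) = fun=> 0); first by rewrite mean_cst.
by apply/funext => x; rewrite /ev dot0l normr0 powR0.
Qed.

Let evp_le c x : ball c -> `|ev u c x| `^ p <= K.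
Proof.
move=> Sc; rewrite -[leRHS](TmaxE p12 N0 bu ortho uK) ge0_ler_powR ?nnegrE ?powR_ge0//.
  by move: p12 => /andP[]; lra.
exact: lball_ev p12 N0 bu ortho uK _ _ Sc.
Qed.

Section quantization.
Variables (eta th : R) (n : nat).
Hypotheses (eta01 : 0 < eta <= 1) (th4 : 4 * cc <= th) (mn : (m <= 2 ^ n)%N).

(** Within a cell [ev c] varies by at most [N K del <= K^2 del], hence [|ev c|^p] by at most
    [2 K^2 del K = eta]. *)
Let del := eta / (2 * K ^+ 3).
Let del0 : 0 < del.
Proof. by rewrite divr_gt0 ?mulr_gt0 ?exprn_gt0//; case/andP: eta01. Qed.

Let uc x k : `|u x 0 k| <= K.
Proof.
rewrite -(@ler_pXn2r _ 2) ?nnegrE// ?(ltW K0)// real_normK ?num_real//.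
apply: (le_trans (sqr_le_dot _ _)); apply: (le_trans (uK x)).
by rewrite expr2 ler_peMl// ltW.
Qed.

Let qz x := grid_label K del (u x).
(** Cells are represented by points of the space, so the quantized functions are sampled values of
    the original ones and the entropy bound applies to them unchanged. An empty cell gets an
    arbitrary point. *)
Let rep i : T := if pselect (exists x, qz x = i) is left e then projT1 (cid e) else point.
Let repE x : qz (rep (qz x)) = qz x.
Proof.
by rewrite /rep; case: pselect => [e|[]]; [exact: projT2 (cid e)|exists x].
Qed.

Let g (c : 'rV[R]_N) i := `|ev u c (rep i)| `^ p.

Let g_close c x : ball c -> `| `|ev u c x| `^ p - g c (qz x)| <= eta.
Proof.
move=> Sc; set T1 := Tmax K p.
have T10 : 0 < T1 by exact: powR_gt0.
have e1 : 0 <= `|ev u c x| <= T1.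
  by rewrite normr_ge0; exact: lball_ev p12 N0 bu ortho uK _ _ Sc.
have e2 : 0 <= `|ev u c (rep (qz x))| <= T1.
  by rewrite normr_ge0; exact: lball_ev p12 N0 bu ortho uK _ _ Sc.
apply: (le_trans (powR_lipschitz p12 e1 e2)).
have TK : T1 <= K := Tmax_leK p12 N0 bu ortho uK.
have Tp : T1 `^ (p - 1) <= K.
  apply: (@le_trans _ _ (K `^ (p - 1))).
    rewrite ge0_ler_powR ?nnegrE ?(ltW T10) ?(ltW K0)//.
    by move: p12 => /andP[]; lra.
  by apply: ler1_powR => //; move: p12 => /andP[]; lra.
have dl : `| `|ev u c x| - `|ev u c (rep (qz x))| | <= K * (K * del).
  apply: (le_trans (ler_dist_dist _ _)).
  rewrite /ev -dotBr; apply: (@le_trans _ _ (N%:R * (K * del))).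
    apply: dot_le_sum.
      by move=> i; exact: lball_coord p12 N0 bu ortho uK _ _ Sc.
    move=> i; rewrite !mxE; apply: (grid_label_eq del0 (uc _) (uc _)).
    exact/esym/(repE x).
  by rewrite ler_wpM2r ?(dim_le bu ortho uK)// mulr_ge0 ?(ltW K0)// ltW.
apply: (@le_trans _ _ (2 * (K * (K * del)) * K)).
  apply: ler_pM Tp; [exact: mulr_ge0|exact: powR_ge0|by rewrite ler_pM2l].
rewrite le_eqVlt; apply/orP; left; apply/eqP; rewrite /del; field.
by rewrite gt_eqF.
Qed.

Let bg c : bmeas (fun x => g c (qz x)).
Proof.
apply: bmeas_quantized => i; apply: measurable_grid_label => // k.
by case: (bu k).
Qed.

Let mq i : measurable (qz @^-1` [set i]).
Proof. by apply: measurable_grid_label => // k; case: (bu k). Qed.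

Let w := cell_weight mu qz.

Let wmeanE c : wmean w g c = mean mu (fun x => g c (qz x)).
Proof. by rewrite (mean_quantized mu mq). Qed.

Let wmean_close c : ball c -> `|wmean w g c - npow mu u p c| <= eta.
Proof.
move=> Sc; rewrite wmeanE.
have b1 : bmeas (fun x => `|ev u c x| `^ p).
  apply: bmeas_powR; first by move: p12 => /andP[]; lra.
  exact: bmeas_ev.
have h1 : mean mu (fun x => g c (qz x)) <= npow mu u p c + eta.
  rewrite -[X in _ + X](mean_cst mu) -meanD//; last exact: bmeas_cst.
  apply: le_mean => //; first by apply: bmeasD => //; exact: bmeas_cst.
  by move=> x; have := g_close x Sc; rewrite ler_norml; lra.
have h2 : npow mu u p c <= mean mu (fun x => g c (qz x)) + eta.
  rewrite -[X in _ + X](mean_cst mu) -meanD//; last exact: bmeas_cst.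
  apply: le_mean => //; first by apply: bmeasD => //; exact: bmeas_cst.
  by move=> x; have := g_close x Sc; rewrite ler_norml; lra.
by rewrite ler_norml; apply/andP; split; lra.
Qed.

Let gK c i : ball c -> 0 <= g c i <= K.
Proof. by move=> Sc; rewrite powR_ge0 evp_le. Qed.

Let th0 : 0 < th.
Proof. by have := chain_const_gt0 p12; have := th4; rewrite /cc; lra. Qed.

Let A := 6 * K + 16 * th * n%:R * (5 * H + K).

Local Notation sample := {ffun 'I_m -> {ffun 'I_N -> 'I_(Num.truncn (2 * K / del)).+1}}.

Let deviation_bound :
  \sum_(x : sample) weight w x * deviation w ball g x <= 4 * A + 4 * (cc / th) * m%:R * 2 :> R.
Proof.
apply: (deviation_le_chaining (B := K) (v0 := 0)) => //.
- by move=> i; exact: cell_weight_ge0.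
- exact: sum_cell_weight.
- rewrite divr_ge0 ?(ltW th0)//=; last exact: ltW (chain_const_gt0 p12).
  by rewrite ler_pdivrMr//; have := th4; lra.
(* The bound 2 on the mean is 1 from the unit ball plus the quantization error [eta <= 1]. *)
- move=> c Sc; have := wmean_close Sc; rewrite ler_norml.
  by move: Sc eta01; rewrite /lball /= => h /andP[h1 h2] /andP[h3 h4]; lra.
- move=> x; pose a c (j : 'I_m) := ev u c (rep (x j)).
  have T10 : 0 < Tmax K p by exact: powR_gt0.
  have aT c j : ball c -> `|a c j| <= Tmax K p.
    by move=> Sc; exact: lball_ev p12 N0 bu ortho uK _ _ Sc.
  have ent t : 0 < t -> entropy_le ball
      (fun c c' => forall j, `|a c j - a c' j| <= t) (H * (t `^ p)^-1).
    move=> t0; have := @entropy_le_lball_sample _ _ _ _ _ _ _ _ _ p12 N0 C_ge bu ortho uK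
      'I_m (fun j => rep (x j)) t.
    by rewrite card_ord; apply.
  have mn' : (#|'I_m| <= 2 ^ n)%N by rewrite card_ord.
  have [Psi [P1 _ P3]] := chaining 0 p12 T10 H0 aT ent mn' th0.
  by exists Psi; split => //; rewrite /A -{1 2}(TmaxE p12 N0 bu ortho uK).
Qed.

Lemma expectation_quantized :
  (\int[P]_w ereal_sup [set `|sample_mean p (ev u c) (fun j => X j w)
        - npow mu u p c|%:E | c in ball]
   <= ((4 * A + 8 * (cc / th) * m%:R) / m%:R + 2 * eta)%:E)%E.
Proof.
(* One [eta] comes from quantizing the empirical mean, the other from quantizing the expectation. *)
have dev_le om c : ball c ->
    `|sample_mean p (ev u c) (fun j => X j om) - npow mu u p c| <=
    m%:R^-1 * deviation w ball g (cells qz X om) + 2 * eta.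
  move=> Sc.
  have -> : sample_mean p (ev u c) (fun j => X j om) - npow mu u p c =
      m%:R^-1 * (\sum_j (g c (cells qz X om j) - wmean w g c)) +
      m%:R^-1 * (\sum_j (`|ev u c (X j om)| `^ p - g c (cells qz X om j))) +
      (wmean w g c - npow mu u p c).
    rewrite /sample_mean !sumrB sumr_const card_ord -[_ *+ m]mulr_natl.
    by field; rewrite gt_eqF.
  have h1 : `|m%:R^-1 * (\sum_j (g c (cells qz X om j) - wmean w g c))| <=
      m%:R^-1 * deviation w ball g (cells qz X om).
    rewrite normrM ger0_norm ?invr_ge0 ?(ltW m0)// ler_pM2l ?invr_gt0//.
    apply: (deviation_ub (B := K)) => //.
    - by move=> i; exact: cell_weight_ge0.
    - exact: sum_cell_weight.
  have h2 : `|m%:R^-1 * (\sum_j (`|ev u c (X j om)| `^ p - g c (cells qz X om j)))| <= eta.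
    rewrite normrM ger0_norm ?invr_ge0 ?(ltW m0)// ler_pdivrMl//.
    apply: (le_trans (ler_norm_sum _ _ _)).
    have -> : m%:R * eta = \sum_(j < m) eta by rewrite sumr_const card_ord mulr_natl.
    by apply: ler_sum => j _; rewrite ffunE; exact: g_close.
  have := wmean_close Sc.
  have := ler_normD (m%:R^-1 * (\sum_j (g c (cells qz X om j) - wmean w g c)) +
      m%:R^-1 * (\sum_j (`|ev u c (X j om)| `^ p - g c (cells qz X om j))))
      (wmean w g c - npow mu u p c).
  have := ler_normD (m%:R^-1 * (\sum_j (g c (cells qz X om j) - wmean w g c)))
      (m%:R^-1 * (\sum_j (`|ev u c (X j om)| `^ p - g c (cells qz X om j)))).
  lra.
pose v (x : sample) := m%:R^-1 * deviation w ball g x + 2 * eta.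
apply: (@le_trans _ _ (\int[P]_om (v (cells qz X om))%:E)%E).
  apply: ge0_le_integral_nonmeasurable => om.
    apply: le_ereal_sup_tmp; exists (`|sample_mean p (ev u 0) (fun j => X j om)
        - npow mu u p 0|%:E); first by exists 0.
    by rewrite lee_fin.
  by apply: ge_ereal_sup => _ [c Sc <-]; rewrite lee_fin; exact: dev_le.
rewrite -mean_EFin; last exact: bmeas_cells.
rewrite (mean_cells mq mX iid) lee_fin -/w.
have -> : \sum_(x : sample) weight w x * v x =
    m%:R^-1 * (\sum_(x : sample) weight w x * deviation w ball g x) +
    2 * eta * \sum_(x : sample) weight w x.
  by rewrite !mulr_sumr -big_split; apply: eq_bigr => x _; rewrite /v /=; ring.
rewrite sum_weight; last exact: sum_cell_weight.
rewrite mulr1 lerD2r mulrC ler_pM2r ?invr_gt0//.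
by apply: (le_trans deviation_bound); rewrite lerD2l; lra.
Qed.

End quantization.
End expectation.

Definition expectation_const (R : realType) (p C : R) : R :=
  96 + 64 * (40 * C + 8) * (4 * chain_const p + 1) + 8 * chain_const p.

(** Here [k = K / m], [l = ln m], and [L] is the logarithmic factor of the entropy. With
    [th = 4 cc + r^(-1/2)], the growing term is [th r = 4 cc r + r^(1/2)] and the decreasing one is
    [cc / th <= cc r^(1/2)]. The bounds [l, L >= 1/2] absorb the lower order terms into [r]. *)
Lemma rate_arith (R : realType) (k l L n C cc r : R) :
  0 < k -> 2^-1 <= l -> 2^-1 <= L -> n <= 4 * l -> 0 <= n -> 0 <= C -> 0 < cc ->
  r = l * L * k ->
  24 * k + 64 * (4 * cc + (Num.sqrt r)^-1) * n * (5 * (2 * C * (k * L)) + k)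
    + 8 * (cc / (4 * cc + (Num.sqrt r)^-1))
  <= (96 + 64 * (40 * C + 8) * (4 * cc + 1) + 8 * cc) * (r + Num.sqrt r).
Proof.
move=> k0 l2 L2 nl n0 C0 cc0 rE.
have lL : 4^-1 <= l * L.
  by have -> : 4^-1 = 2^-1 * 2^-1 :> R by [field]; rewrite ler_pM.
have l0 : 0 < l by lra.
have L0 : 0 < L by lra.
have r0 : 0 < r by rewrite rE !mulr_gt0.
set s := Num.sqrt r; have s0 : 0 < s by rewrite sqrtr_gt0.
have s2 : r = s * s by rewrite -expr2 sqr_sqrtr// ltW.
have h1 : 24 * k <= 96 * r.
  by have := ler_wpM2r (ltW k0) lL; rewrite -rE; lra.
have h2 : n * (5 * (2 * C * (k * L)) + k) <= (40 * C + 8) * r.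
  have e0 : 0 <= 5 * (2 * C * (k * L)) + k.
    by rewrite addr_ge0 ?(ltW k0)// !mulr_ge0 ?(ltW k0) ?(ltW L0).
  apply: (le_trans (ler_wpM2r e0 nl)).
  have -> : 4 * l * (5 * (2 * C * (k * L)) + k) = 40 * C * r + 4 * (l * k) by rewrite rE; ring.
  have : l * k * 2^-1 <= l * k * L by rewrite ler_wpM2l// mulr_ge0 ?(ltW l0) ?(ltW k0).
  by rewrite (_ : l * k * L = r); [lra|rewrite rE; ring].
have th0 : 0 < 4 * cc + s^-1 by rewrite addr_gt0 ?mulr_gt0 ?invr_gt0.
have h3 : cc / (4 * cc + s^-1) <= cc * s.
  rewrite ler_pM2l// -[leRHS]invrK lef_pV2 ?posrE ?invr_gt0//.
  by rewrite lerDr mulr_ge0 ?(ltW cc0).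
have h4 : (4 * cc + s^-1) * r = 4 * cc * r + s by rewrite s2; field; rewrite gt_eqF.
have h5 : 64 * (4 * cc + s^-1) * n * (5 * (2 * C * (k * L)) + k) <=
    64 * (40 * C + 8) * (4 * cc * r + s).
  rewrite -h4; have := ler_wpM2l (ltW th0) h2; lra.
have B0 : 0 <= 64 * (40 * C + 8) by lra.
have h6 : 64 * (40 * C + 8) * (4 * cc * r + s) <= 64 * (40 * C + 8) * ((4 * cc + 1) * (r + s)).
  rewrite ler_wpM2l//; have := mulr_ge0 (ltW cc0) (ltW s0).
  have := mulr_ge0 (ltW cc0) (ltW r0).
  lra.
have h7 := mulr_ge0 (ltW cc0) (ltW r0).
lra.
Qed.

Section expectation_bound.
Context {d : measure_display} {T : measurableType d} {R : realType}.
Variables (mu : probability T R) (N : nat) (u : T -> 'rV[R]_N) (K p : R).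
Hypotheses (p12 : 1 < p < 2) (N0 : (0 < N)%N).
Hypothesis bu : forall i, bmeas (fun x => u x 0 i).
Hypothesis ortho : forall i j, mean mu (fun x => u x 0 i * u x 0 j) = (i == j)%:R.
Hypothesis uK : forall x, dot (u x) (u x) <= K.
Context {d0 : measure_display} {T0 : measurableType d0} (P : probability T0 R).
Variables (m : nat) (X : 'I_m -> T0 -> T).
Hypothesis m2 : (2 <= m)%N.
Hypothesis mX : forall j, measurable_fun [set: T0] (X j).
Hypothesis iid : forall A : 'I_m -> set T, (forall j, measurable (A j)) ->
  P (\bigcap_(j in [set: 'I_m]) (X j @^-1` A j)) = (\prod_j mu (A j))%E.
Variable C : R.
Hypothesis C_ge : 3840 <= C.

Lemma expectation_bound (r : R) :
  r = ln m%:R `^ (1 + p / 2) * logK K `^ (1 - p / 2) / m%:R * K ->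
  (\int[P]_w ereal_sup [set `|sample_mean p (ev u c) (fun j => X j w)
        - npow mu u p c|%:E | c in lball mu u p]
   <= (expectation_const p C * (r + Num.sqrt r))%:E)%E.
Proof.
move=> rE.
have K1 : 1 <= K := K_ge1 N0 bu ortho uK.
have q1 : 1 <= logK K := logK_ge1 N0 bu ortho uK.
have m2' : 2 <= m%:R :> R by rewrite ler_nat.
have m0 : 0 < m%:R :> R by lra.
set l := ln m%:R in rE.
have l2 : 2^-1 <= l.
  by apply: (le_trans (ln2_ge_half R)); rewrite ler_ln ?posrE.
have [p1 p2] : 1 < p /\ p < 2 by move/andP: p12.
set L := l `^ (p / 2) * logK K `^ (1 - p / 2).
have L2 : 2^-1 <= L.
  rewrite -[leLHS]mulr1; apply: ler_pM => //.
    apply: (@le_trans _ _ (2^-1 `^ (p / 2))).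
      by apply: ger1_powR; lra.
    by rewrite ge0_ler_powR ?nnegrE//; lra.
  by rewrite -[leLHS](powRr0 (logK K)); apply: ler_powR => //; lra.
have rE' : r = l * L * (K / m%:R).
  rewrite rE powRD; last by rewrite gt_eqF ?implybT//; lra.
  by rewrite powRr1 /L; [ring|lra].
set n := up_log 2 m.
have nP : (m <= 2 ^ n)%N by exact: up_logP.
(* [n - 1 <= l / ln 2 <= 2 l], and [1 <= 2 l]. *)
have nl : n%:R <= 4 * l.
  have /andP[h _] := up_log_bounds (isT : (1 < 2)%N) m2.
  have h' : n.-1%:R * ln 2 <= l.
    rewrite mulr_natl -lnXn// ler_ln ?posrE ?exprn_gt0// -natrX ler_nat.
    exact: ltnW.
  have : n.-1%:R * 2^-1 <= n.-1%:R * ln 2 :> R by rewrite ler_wpM2l// ln2_ge_half.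
  have : n%:R <= n.-1%:R + 1 :> R by rewrite natr1 ler_nat leqSpred.
  lra.
have C0 : 0 <= C by have := C_ge; lra.
have cc0 := chain_const_gt0 p12.
have k0 : 0 < K / m%:R by rewrite divr_gt0//; lra.
(* The quantization can be made arbitrarily fine, so its error is absorbed by an arbitrary [e]. *)
apply/lee_addgt0Pr => e e0; rewrite -EFinD.
set eta := Num.min (e / 2) 1.
have eta01 : 0 < eta <= 1.
  by rewrite lt_min ge_min lexx orbT andbT ltr01 andbT divr_gt0.
have etae : 2 * eta <= e.
  by have : eta <= e / 2 by [rewrite ge_min lexx]; lra.
set th := 4 * chain_const p + (Num.sqrt r)^-1.
have th4 : 4 * chain_const p <= th by rewrite lerDl invr_ge0 sqrtr_ge0.
apply: (le_trans (expectation_quantized p12 N0 bu ortho uK m2 mX iid C_ge eta01 th4 nP)).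
rewrite lee_fin; apply: lerD => //.
apply: le_trans (rate_arith k0 l2 L2 nl (ler0n _ _) C0 cc0 rE').
rewrite -/th -/l -/L le_eqVlt; apply/orP; left; apply/eqP.
have thn0 : th != 0 by rewrite gt_eqF//; lra.
by field; rewrite thn0 gt_eqF.
Qed.

End expectation_bound.

(** * Orthonormal bases of Nikolskii subspaces *)

Section continuous_borel.
Context {R : realType} {Omega : ptopologicalType}.
Hypothesis compactO : compact [set: Omega].
Variable f : Omega -> R.
Hypothesis cf : continuous f.

Lemma continuous_norm_le : exists B, forall x, `|f x| <= B.
Proof.
have cK : compact (f @` [set: Omega]).
  by apply: continuous_compact => //; exact: continuous_subspaceT.
have [B [_ hB]] := compact_bounded cK.
exists (B + 1) => x; apply: (hB (B + 1)); first by rewrite ltrDl.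
by exists x.
Qed.

Lemma continuous_bmeas : bmeas (f : borel Omega -> R).
Proof.
split; last exact: continuous_norm_le.
apply: (measurability _ (RGenOInfty.measurableE R)) => //.
move=> /= _ [_ [a ->] <-]; rewrite setTI.
apply: sub_sigma_algebra.
by apply: open_comp; [move=> x _; exact: cf|exact: interval_open].
Qed.

Lemma le_supnorm x : `|f x| <= supnorm f.
Proof.
have [B fB] := continuous_norm_le.
apply: ub_le_sup; last by exists x.
by exists B => _ [y _ <-].
Qed.

End continuous_borel.

Section rnorm_mean.
Context {R : realType} {Omega : ptopologicalType}.
Variable mu : probability (borel Omega) R.

Lemma rnormE (r : R) (f : Omega -> R) : 0 < r -> bmeas (f : borel Omega -> R) ->
  rnorm mu r f = mean mu (fun x : borel Omega => `|f x| `^ r) `^ r^-1.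
Proof.
move=> r0 bf; rewrite /rnorm unlock /=.
have -> : (\int[mu]_x (`|(f x)%:E| `^ r))%E =
    (mean mu (fun x : borel Omega => `|f x| `^ r))%:E.
  by rewrite mean_EFin//; exact: bmeas_powR (ltW r0) bf.
by rewrite poweR_EFin.
Qed.

Lemma rnorm_powR (r : R) (f : Omega -> R) : 0 < r -> bmeas (f : borel Omega -> R) ->
  rnorm mu r f `^ r = mean mu (fun x : borel Omega => `|f x| `^ r).
Proof.
move=> r0 bf; rewrite rnormE// -powRrM mulVf ?gt_eqF// powRr1//.
by apply: mean_ge0 => x; exact: powR_ge0.
Qed.

Lemma rnorm2_sqr (f : Omega -> R) : bmeas (f : borel Omega -> R) ->
  rnorm mu 2 f ^+ 2 = mean mu (fun x : borel Omega => f x ^+ 2).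
Proof.
move=> bf; rewrite -(powR_mulrn 2) ?fine_ge0 ?Lnorm_ge0// rnorm_powR//.
by congr (mean mu _); apply/funext => x; rewrite powR_mulrn// real_normK// num_real.
Qed.

End rnorm_mean.

Section gram_schmidt.
Context {d : measure_display} {T : measurableType d} {R : realType}.
Variables (mu : probability T R) (L : set (T -> R)).
Hypothesis LD : forall (f g : T -> R) a, L f -> L g -> L (fun x => f x + a * g x).
Hypothesis Lb : forall f, L f -> bmeas f.
Hypothesis Lpos : forall f, L f -> mean mu (fun x => f x ^+ 2) = 0 -> forall x, f x = 0.

Let orthonormal n (u : T -> 'rV[R]_n) : Prop :=
  (forall i, L (fun x => u x 0 i)) /\
  forall i j, mean mu (fun x => u x 0 i * u x 0 j) = (i == j)%:R.

(** The functions are treated pointwise, not modulo null sets, which is possible because a member of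
    [L] with zero L^2 norm vanishes everywhere. The length [n] is left existential: later estimates
    see only the kernel bound. *)
Lemma gram_schmidt (s : seq (T -> R)) : (forall i, (i < size s)%N -> L (nth (fun=> 0) s i)) ->
  exists n (u : T -> 'rV[R]_n), orthonormal u /\
    forall i, (i < size s)%N -> exists c, nth (fun=> 0) s i = ev u c.
Proof.
elim: s => [_|f s IH Ls].
  by exists 0%N, (fun=> 0); split => //; split => [[]|[]].
have [|n [u [[Lu ou] su]]] := IH; first by move=> i si; exact: (Ls i.+1).
have Lf : L f by exact: (Ls 0%N).
pose a : 'rV[R]_n := \row_i mean mu (fun x => f x * u x 0 i).
have bu i : bmeas (fun x => u x 0 i) by exact: Lb.
have Lev c (s' : seq 'I_n) : L (fun x => f x - \sum_(i <- s') c 0 i * u x 0 i).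
  elim: s' => [|i s' IHs].
    by rewrite (_ : (fun x => _) = f)//; apply/funext => x; rewrite big_nil subr0.
  rewrite (_ : (fun x => _) = fun x =>
      (f x - \sum_(i <- s') c 0 i * u x 0 i) + (- c 0 i) * u x 0 i).
    exact: LD.
  by apply/funext => x; rewrite big_cons; ring.
pose v x := f x - ev u a x.
have Lv : L v by exact: Lev.
have bv := Lb Lv.
have vu j : mean mu (fun x => v x * u x 0 j) = 0.
  have -> : (fun x => v x * u x 0 j) =
      (fun x => f x * u x 0 j - \sum_i a 0 i * (u x 0 i * u x 0 j)).
    apply/funext => x; rewrite /v /ev /dot mulrBl mulr_suml; congr (_ - _).
    by apply: eq_bigr => i _; rewrite mulrA.
  have bb i : bmeas (fun x => a 0 i * (u x 0 i * u x 0 j)).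
    by apply: bmeasZ; exact: bmeasM.
  rewrite meanB; [|by apply: bmeasM => //; exact: Lb|exact: bmeas_sum].
  rewrite mean_sum// (bigD1 j)//= big1 ?addr0.
    by rewrite meanZ; [rewrite ou eqxx mulr1 mxE subrr|exact: bmeasM].
  by move=> i ij; rewrite meanZ; [rewrite ou (negbTE ij) mulr0|exact: bmeasM].
(* A vanishing residue means that [f] already lies in the span, and the system is kept. *)
have [v0|vn0] := eqVneq (mean mu (fun x => v x ^+ 2)) 0.
  exists n, u; split => // -[_|i /su//].
  by exists a; apply/funext => x; have := Lpos Lv v0 x; rewrite /v /=; lra.
have v2 : 0 < mean mu (fun x => v x ^+ 2).
  by rewrite lt_def vn0 mean_ge0// => x; exact: sqr_ge0.
set b := Num.sqrt (mean mu (fun x => v x ^+ 2)).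
have b0 : 0 < b by rewrite sqrtr_gt0.
have b2 : b * b = mean mu (fun x => v x ^+ 2) by rewrite -expr2 sqr_sqrtr// ltW.
pose u' x : 'rV[R]_n.+1 := \row_i (if unlift ord_max i is Some j then u x 0 j else b^-1 * v x).
have u'max x : u' x 0 ord_max = b^-1 * v x by rewrite mxE unlift_none.
have u'lift x j : u' x 0 (lift ord_max j) = u x 0 j by rewrite mxE liftK.
exists n.+1, u'; split.
  split.
    move=> i; case: (unliftP ord_max i) => [j ->|->].
      by rewrite (_ : (fun x => _) = fun x => u x 0 j)//; apply/funext => x; rewrite u'lift.
    rewrite (_ : (fun x => _) = fun x => v x + (b^-1 - 1) * v x); first exact: LD.
    by apply/funext => x; rewrite u'max; ring.
  have vb i : mean mu (fun x => b^-1 * v x * u x 0 i) = 0.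
    rewrite (_ : (fun x => _) = fun x => b^-1 * (v x * u x 0 i)); last first.
      by apply/funext => x; rewrite mulrA.
    by rewrite meanZ; [rewrite vu mulr0|exact: bmeasM].
  move=> i j; case: (unliftP ord_max i) => [i' ->|->]; case: (unliftP ord_max j) => [j' ->|->].
  - under eq_fun do rewrite !u'lift.
    by rewrite ou (inj_eq lift_inj).
  - under eq_fun do rewrite u'lift u'max mulrC.
    by rewrite vb eq_sym (negbTE (neq_lift _ _)).
  - under eq_fun do rewrite u'lift u'max.
    by rewrite vb (negbTE (neq_lift _ _)).
  - under eq_fun do rewrite !u'max.
    rewrite (_ : (fun x => _) = fun x => b^-1 ^+ 2 * v x ^+ 2); last first.
      by apply/funext => x; ring.
    rewrite meanZ ?eqxx; last exact: bmeasX.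
    by rewrite -b2 /=; field; rewrite gt_eqF.
have evS (c : 'rV[R]_n.+1) x :
    ev u' c x = \sum_(j < n) c 0 (lift ord_max j) * u x 0 j + c 0 ord_max * (b^-1 * v x).
  rewrite /ev /dot big_ord_recr /= u'max; congr (_ + _); apply: eq_bigr => j _.
  rewrite -u'lift; congr (c 0 _ * u' x 0 _); apply: val_inj => /=;
    by rewrite /bump leqNgt ltn_ord.
move=> [_|i si].
  exists (\row_i (if unlift ord_max i is Some j then a 0 j else b)).
  apply/funext => x /=; rewrite evS mxE unlift_none.
  under eq_bigr do rewrite mxE liftK.
  have -> : b * (b^-1 * v x) = v x by field; rewrite gt_eqF.
  by rewrite /v /ev /dot; ring.
have [c cE] := su i si.
exists (\row_i (if unlift ord_max i is Some j then c 0 j else 0)).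
apply/funext => x; rewrite /= cE evS mxE unlift_none mul0r addr0.
by apply: eq_bigr => j _; rewrite mxE liftK.
Qed.

End gram_schmidt.

Section nikolskii_basis.
Context {R : realType} {Omega : ptopologicalType}.
Variables (mu : probability (borel Omega) R) (p : R) (N : nat) (M : R).
Variable L : set (Omega -> R).
Hypothesis compactO : compact [set: Omega].
Hypothesis nikL : nikolskii_subspace mu p N M L.

Let Lb (f : borel Omega -> R) : L f -> bmeas f.
Proof. by case: nikL => _ _ cL _ /cL; exact: continuous_bmeas. Qed.

Let LD (f g : Omega -> R) a : L f -> L g -> L (fun x => f x + a * g x).
Proof.
case: nikL => -[e [_ ->]] _ _ _ [c _ <-] [c' _ <-].
exists (fun i => c i + a * c' i) => //; apply/funext => x.
rewrite !fct_sumE mulr_sumr -big_split; apply: eq_bigr => i _ /=.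
have sE k (h : Omega -> R) : (k *: h) x = k * h x by [].
by rewrite !sE mulrDl mulrA.
Qed.

Let L0 : L (fun=> 0).
Proof.
case: nikL => -[e [_ ->]] _ _ _; exists (fun=> 0) => //.
by apply/funext => x; rewrite fct_sumE big1// => i _; rewrite scale0r.
Qed.

Let supL f x : L f -> `|f x| <= M * Num.sqrt N%:R * rnorm mu 2 f.
Proof.
move=> Lf; case: nikL => _ _ cL nL.
by apply: le_trans (nL _ Lf); apply: le_supnorm => //; exact: cL.
Qed.

Let rnorm2_ge0 (f : Omega -> R) : 0 <= rnorm mu 2 f.
Proof. by rewrite fine_ge0 ?Lnorm_ge0. Qed.

(** The bound on the kernel is the Nikolskii inequality applied to the kernel function [ev u (u x)]:
    its value at [x] and its squared L^2 norm are both [D = dot (u x) (u x)], so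
    [D^2 <= M^2 N D]. *)
Lemma nikolskii_basis : exists n (u : borel Omega -> 'rV[R]_n),
  [/\ (forall i, bmeas (fun x => u x 0 i)) ,
      (forall i j, mean mu (fun x => u x 0 i * u x 0 j) = (i == j)%:R),
      (forall x, dot (u x) (u x) <= M ^+ 2 * N%:R) &
      (forall f, L f <-> exists c, f = ev u c)].
Proof.
have Lpos (f : borel Omega -> R) : L f -> mean mu (fun x => f x ^+ 2) = 0 ->
    forall x, f x = 0.
  move=> Lf f0 x; have := supL x Lf; have := rnorm2_sqr mu (Lb Lf).
  rewrite f0 => /eqP; rewrite sqrf_eq0 => /eqP ->.
  by rewrite mulr0 normr_le0 => /eqP.
have := nikL => -[[e [_ LE]] _ cL nL].
have Le i : L (e i).
  rewrite LE; exists (fun j => (j == i)%:R) => //.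
  rewrite (bigD1 i)//= eqxx scale1r big1 ?addr0// => j /negbTE ->.
  by rewrite scale0r.
pose s := mkseq (fun k => if insub k is Some i then e i else fun=> 0) N.
have sE (i : 'I_N) : nth (fun=> 0) s i = e i by rewrite nth_mkseq// valK.
have Ls k : (k < size s)%N -> L (nth (fun=> 0) s k).
  rewrite size_mkseq => kN; rewrite (_ : k = Ordinal kN)// sE//.
have [n [u [[Lu ou] su]]] :=
  @gram_schmidt _ (borel Omega) R mu L LD Lb Lpos s Ls.
have bu i : bmeas (fun x => u x 0 i) by exact: Lb.
have Lev c : L (ev u c).
  rewrite (_ : ev u c = fun x => \sum_(i < n) c 0 i * u x 0 i)//.
  elim: (index_enum 'I_n) => [|i r IH].
    by rewrite (_ : (fun x => _) = fun=> 0)//; apply/funext => x; rewrite big_nil.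
  rewrite (_ : (fun x => _) =
      fun x => (\sum_(i <- r) c 0 i * u x 0 i) + c 0 i * u x 0 i); first exact: LD.
  by apply/funext => x; rewrite big_cons addrC.
exists n, u; split => //.
- move=> x; set D := dot (u x) (u x).
  have D0 : 0 <= D by exact: dotvv_ge0.
  have := supL x (Lev (u x)); rewrite /ev -/D (ger0_norm D0) => hD.
  have [->|Dn0] := eqVneq D 0; first by rewrite mulr_ge0 ?sqr_ge0.
  have Dgt0 : 0 < D by rewrite lt_def Dn0.
  have h2 : D ^+ 2 <= (M * Num.sqrt N%:R * rnorm mu 2 (ev u (u x))) ^+ 2.
    by rewrite lerXn2r ?nnegrE// (le_trans D0).
  move: h2; rewrite !exprMn rnorm2_sqr ?sqr_sqrtr//; last exact: bmeas_ev.
  by rewrite (mean_ev_sqr bu ou) -/D expr2 ler_pM2r.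
- move=> f; split => [|[c ->]]; last exact: Lev.
  rewrite {1}LE => -[c _ <-].
  have /choice[a aE] : forall i, exists a, e i = ev u a.
    by move=> i; rewrite -sE; apply: su; rewrite size_mkseq.
  exists (\sum_i c i *: a i); apply/funext => x.
  rewrite fct_sumE /ev dot_suml; apply: eq_bigr => i _.
  by rewrite dotZl aE.
Qed.

End nikolskii_basis.

Section part1.
Context {R : realType} (p : R) {Omega : ptopologicalType}.
Variables (mu : probability (borel Omega) R) (N : nat) (M : R).
Variable L : set (Omega -> R).
Hypothesis p12 : 1 < p < 2.
Hypothesis compactO : compact [set: Omega].
Hypothesis nikL : nikolskii_subspace mu p N M L.
Context {d : measure_display} {T : measurableType d} (P : probability T R).
Variables (m : nat) (X : 'I_m -> {RV P >-> borel Omega}).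
Hypothesis m2 : (2 <= m)%N.
Hypothesis iidX : iid_sample mu X.
Variable C : R.
Hypothesis C_ge : 3840 <= C.

Lemma expectation_sup_le :
  (\int[P]_w ereal_sup
        [set `|sample_mean p f (fun j => X j w) - rnorm mu p f `^ p|%:E
         | f in unit_ball mu p L]
     <= (expectation_const p C * (rate p m N M + Num.sqrt (rate p m N M)))%:E)%E.
Proof.
have [n [u [bu ou uK Lu]]] := nikolskii_basis compactO nikL.
have p0 : 0 < p by move/andP: p12 => -[]; lra.
have npE c : rnorm mu p (ev u c) `^ p = npow mu u p c.
  by rewrite rnorm_powR//; exact: bmeas_ev.
have np_ball f : unit_ball mu p L f -> exists2 c, lball mu u p c & f = ev u c.
  move=> [/Lu[c fE] f1]; exists c => //; rewrite /lball /= -npE -fE.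
  have -> : 1 = 1 `^ p :> R by rewrite powR1.
  by rewrite ge0_ler_powR ?nnegrE ?(ltW p0)// fine_ge0 ?Lnorm_ge0.
have rate0 : 0 <= rate p m N M.
  apply: mulr_ge0; last by rewrite mulr_ge0 ?sqr_ge0.
  by rewrite divr_ge0// mulr_ge0 ?powR_ge0.
have ball0 : unit_ball mu p L (fun=> 0).
  split.
    apply/Lu; exists 0; apply/funext => x; by rewrite /ev dot0l.
  rewrite rnormE//; last exact: bmeas_cst.
  rewrite (_ : (fun x => _) = fun=> 0).
    by rewrite mean_cst powR0 ?invr_eq0 ?gt_eqF.
  by apply/funext => x; rewrite normr0 powR0// gt_eqF.
have sup_ge0 w : (0 <= ereal_sup
    [set `|sample_mean p f (fun j => X j w) - rnorm mu p f `^ p|%:E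
         | f in unit_ball mu p L])%E.
  apply: le_ereal_sup_tmp; exists (`|sample_mean p (fun=> 0) (fun j => X j w)
        - rnorm mu p (fun=> 0) `^ p|%:E); first by exists (fun=> 0).
  by rewrite lee_fin.
(* For the zero subspace the supremum is 0; [K >= 1] need not hold then. *)
have [n0|n0] := posnP n.
  have cc0 : 0 <= expectation_const p C.
    have := chain_const_gt0 p12; rewrite /expectation_const => c0.
    have c2 : 0 <= (40 * C + 8) * (4 * chain_const p + 1).
      by rewrite mulr_ge0//; have := C_ge; lra.
    lra.
  apply: (@le_trans _ _ (\int[P]_w 0)%E); last first.
    by rewrite integral0 lee_fin mulr_ge0// addr_ge0 ?sqrtr_ge0.
  apply: ge0_le_integral_nonmeasurable => // w.
  apply: ge_ereal_sup => _ [f /np_ball[c _ ->] <-].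
  rewrite lee_fin npE; have ev0 x : ev u c x = 0.
    by rewrite /ev /dot; apply: big1 => i; exfalso; move: (i); rewrite n0 => -[].
  rewrite /sample_mean /npow.
  under eq_bigr do rewrite ev0 normr0 powR0 ?gt_eqF//.
  rewrite (_ : (fun x => _) = fun=> 0); last first.
    by apply/funext => x; rewrite ev0 normr0 powR0// gt_eqF.
  by rewrite big1// mulr0 mean_cst subr0 normr0.
have iid A : (forall j, measurable (A j)) ->
    P (\bigcap_(j in [set: 'I_m]) (X j @^-1` A j)) = (\prod_j mu (A j))%E.
  move=> mA; have [ind same] := iidX.
  have := ind [set: 'I_m]%SET A (fun j _ => mA j).
  rewrite (_ : [set` [set: 'I_m]%SET] = [set: 'I_m]); last first.
    by apply/seteqP; split => // j _; rewrite /= inE.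
  move=> ->; rewrite (eq_bigl xpredT); last by move=> j; rewrite inE.
  by apply: eq_bigr => j _; rewrite -(same j _ (mA j)).
have mX j : measurable_fun [set: T] (X j) by exact: measurable_funPT.
have rE : rate p m N M = ln m%:R `^ (1 + p / 2) *
    logK (M ^+ 2 * N%:R) `^ (1 - p / 2) / m%:R * (M ^+ 2 * N%:R).
  by rewrite /rate /logK (mulrA 4).
apply: le_trans (expectation_bound p12 n0 bu ou uK m2 mX iid C_ge rE).
apply: ge0_le_integral_nonmeasurable => // w.
apply: ereal_sup_le => _ [f fB <-]; have [c cB ->] := np_ball f fB.
by exists c => //; rewrite npE.
Qed.

End part1.

(** * Discretization with high probability *)

(** Write [m = c K q^2]. Then [ln m <= (ln c + 3) q], and the two powers of logarithms multiply to
    at most [(ln m)^2]; the factor [K q^2] cancels, leaving [(ln c + 3)^2 / c], which tends to 0. *)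
Lemma rate_small (R : realType) (p y : R) : 1 < p < 2 -> 0 < y ->
  exists2 c0, 0 < c0 & forall (K : R) (m : nat), 1 <= K ->
    c0 * K * ln (4 * K) ^+ 2 <= m%:R -> (2 <= m)%N /\
    ln m%:R `^ (1 + p / 2) * ln (4 * K) `^ (1 - p / 2) / m%:R * K <= y.
Proof.
(* The 4 ensures [m >= 4 K], hence [m >= 2] and [q <= ln m]. With [s = c^(1/4)], [ln c + 3 <= 7 s],
   so the final bound is [49 / s^2], and [c >= (49 / y)^2] makes it at most [y]. *)
move=> /andP[p1 p2] y0; set c0 := 4 + (49 / y) ^+ 2.
have c04 : 4 <= c0 by rewrite lerDl sqr_ge0.
exists c0; first lra.
move=> K m K1; set q := ln (4 * K) => hm.
have K0 : 0 < K by lra.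
have q1 : 1 <= q.
  have e4 := expR1_le4 R.
  by rewrite -ler_expR lnK ?posrE//; lra.
have q0 : 0 < q by lra.
have q2 : 1 <= q ^+ 2 by rewrite exprn_ege1.
have Kq0 : 0 < K * q ^+ 2 by rewrite mulr_gt0 ?exprn_gt0.
have KqK : K <= K * q ^+ 2 by rewrite ler_peMr// ltW.
set c := m%:R / (K * q ^+ 2).
have cc0 : c0 <= c by rewrite ler_pdivlMr// mulrA.
have c00 : 0 < c by lra.
have mE : m%:R = c * K * q ^+ 2 by rewrite /c -mulrA divfK// gt_eqF.
have m4K : 4 * K <= m%:R.
  rewrite mE -mulrA; apply: ler_pM => //; lra.
have m0 : 0 < m%:R :> R by lra.
split; first by rewrite -(ler_nat R); lra.
set l := ln m%:R.
have ql : q <= l by rewrite ler_ln ?posrE//; lra.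
have l0 : 0 < l by lra.
have lu : l <= (ln c + 3) * q.
  have -> : l = ln c + ln K + 2 * ln q.
    have cK0 : 0 < c * K by exact: mulr_gt0.
    have qq0 : 0 < q ^+ 2 by rewrite exprn_gt0.
    by rewrite /l mE lnM ?posrE// lnM ?posrE// lnXn// [2 * _]mulr_natl.
  have lnc0 : 0 <= ln c by apply: ln_ge0; lra.
  have h1 : ln K <= q by rewrite ler_ln ?posrE//; lra.
  have h2 : ln q <= q.
    by rewrite -ler_expR lnK ?posrE//; have := expR_ge1Dx q; lra.
  have : ln c <= ln c * q by rewrite ler_peMr.
  lra.
have lq : l `^ (1 + p / 2) * q `^ (1 - p / 2) <= l ^+ 2.
  rewrite -(powR_mulrn 2 (ltW l0)).
  rewrite [leRHS](_ : _ = l `^ (1 + p / 2) * l `^ (1 - p / 2)); last first.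
    rewrite -powRD; last by rewrite (gt_eqF l0) implybT.
    by congr (_ `^ _); lra.
  apply: ler_wpM2l; first exact: powR_ge0.
  by rewrite ge0_ler_powR ?nnegrE ?(ltW l0) ?(ltW q0)//; lra.
set s := Num.sqrt (Num.sqrt c).
have s2 : s ^+ 2 = Num.sqrt c by rewrite sqr_sqrtr// sqrtr_ge0.
have s4 : c = s ^+ 4 by rewrite (exprM s 2 2) s2 sqr_sqrtr// ltW.
have s0 : 0 < s by rewrite sqrtr_gt0 sqrtr_gt0.
have s1 : 1 <= s.
  rewrite leNgt; apply/negP => s1; have : s ^+ 4 < 1 by rewrite exprn_ilt1// ltW.
  lra.
have lnc : ln c + 3 <= 7 * s.
  have : ln s <= s - 1.
    by rewrite -ler_expR lnK ?posrE//; have := expR_ge1Dx (s - 1); lra.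
  rewrite s4 lnXn// -[ln s *+ 4]mulr_natl; lra.
have lnc0 : 0 <= ln c by apply: ln_ge0; lra.
have sq : 49 / y <= s ^+ 2.
  have h : (49 / y) ^+ 2 <= (s ^+ 2) ^+ 2 by rewrite -exprM -s4; apply: le_trans cc0; rewrite lerDr.
  by rewrite -(@ler_pXn2r _ 2) ?nnegrE ?sqr_ge0// divr_ge0// ltW.
have s20 : 0 < s ^+ 2 by rewrite exprn_gt0.
apply: (@le_trans _ _ (((7 * s) * q) ^+ 2 / m%:R * K)).
  rewrite ler_pM2r// ler_pM2r ?invr_gt0//; apply: (le_trans lq).
  rewrite lerXn2r ?nnegrE ?(ltW l0)//; first by rewrite !mulr_ge0 ?(ltW s0) ?(ltW q0).
  by apply: (le_trans lu); rewrite ler_pM2r.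
have -> : (7 * s * q) ^+ 2 / m%:R * K = 49 / s ^+ 2.
  by rewrite mE s4; field; rewrite !gt_eqF.
by rewrite ler_pdivrMr// mulrC -ler_pdivrMr.
Qed.

(** The upper bound loses [k] in passing from [s] to [t] and [(1 + eps) k <= 2 k] in passing from
    [b] to [a]; hence the 3. *)
Lemma band_perturb (R : realType) (a b s t k eps e : R) : 0 <= k -> 0 < eps < 1 ->
  3 * k <= e -> a <= b + k -> b <= a + k -> `|s - t| <= k ->
  (1 - eps) * b <= t <= (1 + eps) * b ->
  (1 - eps) * a <= s + e /\ s <= (1 + eps) * a + e.
Proof.
move=> k0 /andP[ep0 ep1] ke ab ba; rewrite ler_norml => /andP[st1 st2] /andP[t1 t2].
have h1 : (1 - eps) * a <= (1 - eps) * (b + k) by rewrite ler_wpM2l// subr_ge0 ltW.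
have h2 : (1 + eps) * b <= (1 + eps) * (a + k) by rewrite ler_wpM2l// addr_ge0// ltW.
have h3 : eps * k <= k by rewrite ler_piMl// ltW.
have h4 : 0 <= eps * k by rewrite mulr_ge0// ltW.
by split; lra.
Qed.

Section part2.
Context {R : realType} (p : R) {Omega : ptopologicalType}.
Variables (mu : probability (borel Omega) R) (N : nat) (M : R).
Variable L : set (Omega -> R).
Hypothesis p12 : 1 < p < 2.
Hypothesis compactO : compact [set: Omega].
Hypothesis nikL : nikolskii_subspace mu p N M L.
Context {d : measure_display} {T : measurableType d} (P : probability T R).
Variables (m : nat) (X : 'I_m -> {RV P >-> borel Omega}).
Variable eps : R.
Hypothesis eps01 : 0 < eps < 1.

Let good (f : Omega -> R) (w : T) : Prop :=
  (1 - eps) * rnorm mu p f `^ p <= sample_mean p f (fun j => X j w)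
     <= (1 + eps) * rnorm mu p f `^ p.

Let p0 : 0 < p. Proof. by move/andP: p12 => -[]; lra. Qed.

Let sample_mean_close (f g : Omega -> R) w k :
  (forall x, `| `|f x| `^ p - `|g x| `^ p| <= k) -> 0 <= k ->
  `|sample_mean p f (fun j => X j w) - sample_mean p g (fun j => X j w)| <= k.
Proof.
move=> fg k0; rewrite /sample_mean -mulrBr -sumrB normrM.
rewrite ger0_norm ?invr_ge0//.
have [->|mn0] := eqVneq m%:R (0 : R); first by rewrite invr0 mul0r.
have m0 : 0 < m%:R :> R by rewrite lt_def mn0 ler0n.
rewrite ler_pdivrMl//; apply: (le_trans (ler_norm_sum _ _ _)).
have -> : m%:R * k = \sum_(j < m) k by rewrite sumr_const card_ord mulr_natl.
by apply: ler_sum => j _; exact: fg.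
Qed.

Let measurable_good f : bmeas (f : borel Omega -> R) -> measurable [set w | good f w].
Proof.
move=> bf; pose h w := sample_mean p f (fun j => X j w).
have mh : measurable_fun [set: T] h.
  have [bh _] : bmeas h.
    apply: bmeasZ; apply: bmeas_sum => j; have [mfp [B fB]] := bmeas_powR (ltW p0) bf.
    split; last by exists B.
    exact: (measurableT_comp mfp (@measurable_funPT _ _ _ _ (X j))).
  exact: bh.
have := mh measurableT `[(1 - eps) * rnorm mu p f `^ p, (1 + eps) * rnorm mu p f `^ p]%classic.
by rewrite setTI; apply; exact: measurable_itv.
Qed.

Section coordinates.
Variables (n : nat) (u : borel Omega -> 'rV[R]_n).
Hypothesis bu : forall i, bmeas (fun x => u x 0 i).
Hypothesis ou : forall i j, mean mu (fun x => u x 0 i * u x 0 j) = (i == j)%:R.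
Hypothesis uK : forall x, dot (u x) (u x) <= M ^+ 2 * N%:R.
Hypothesis Lu : forall f, L f <-> exists c, f = ev u c.

Let Kb := M ^+ 2 * N%:R + 1.
Let Kb1 : 1 <= Kb. Proof. by rewrite /Kb lerDr mulr_ge0 ?sqr_ge0. Qed.

Let u_le x i : `|u x 0 i| <= Kb.
Proof.
have K0 : 0 <= M ^+ 2 * N%:R by rewrite mulr_ge0 ?sqr_ge0.
rewrite -(@ler_pXn2r _ 2) ?nnegrE//; last by have := Kb1; lra.
rewrite real_normK ?num_real//.
apply: (le_trans (sqr_le_dot _ _)); apply: (le_trans (uK x)).
by rewrite /Kb; nra.
Qed.

Let npE c : rnorm mu p (ev u c) `^ p = npow mu u p c.
Proof. by rewrite rnorm_powR//; exact: bmeas_ev. Qed.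

(* Both sides of the inequality are continuous in the coordinates, so rational
   coordinates suffice. *)
Let good_rational w :
  (forall c : 'rV[rat]_n, good (ev u (map_mx ratr c)) w) -> forall c, good (ev u c) w.
Proof.
move=> H c.
pose cm := \sum_i `|c 0 i| + 1.
have cm1 : 1 <= cm by rewrite lerDr sumr_ge0.
have c_le i : `|c 0 i| + 1 <= cm.
  by rewrite lerD2r (bigD1 i)//= lerDl sumr_ge0.
pose Bd := n%:R * (cm * Kb).
pose kap := 2 * (n%:R * Kb) * Bd `^ (p - 1).
have Kb0 : 0 <= Kb by have := Kb1; lra.
have kap0 : 0 <= kap by rewrite !mulr_ge0 ?powR_ge0.
suff key e : 0 < e -> (1 - eps) * npow mu u p c <= sample_mean p (ev u c) (fun j => X j w) + e
    /\ sample_mean p (ev u c) (fun j => X j w) <= (1 + eps) * npow mu u p c + e.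
  by rewrite /good npE; apply/andP; split; apply/ler_addgt0Pr => e /key[].
move=> e0; set del := Num.min 1 (e / (3 * kap + 1)).
have k30 : 0 < 3 * kap + 1 by lra.
have del0 : 0 < del by rewrite lt_min ltr01 divr_gt0.
have del1 : del <= 1 by rewrite ge_min lexx.
have dele : 3 * (kap * del) <= e.
  have : del <= e / (3 * kap + 1) by rewrite ge_min lexx orbT.
  by rewrite ler_pdivlMr//; lra.
have /choice[r rP] : forall i, exists r : rat, `|c 0 i - ratr r| <= del.
  move=> i; have [|r] := @rat_in_itvoo R (c 0 i - del) (c 0 i + del); first lra.
  rewrite in_itv /= => /andP[h1 h2]; exists r.
  by rewrite ler_norml; apply/andP; split; lra.
pose c' : 'rV[rat]_n := \row_i r i.
have := H c'; set c1 := map_mx _ c'; rewrite /good !npE.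
have cc i : `|(c - c1) 0 i| <= del by rewrite !mxE.
have c1_le i : `|c1 0 i| <= cm.
  have := c_le i; have := cc i; have := ler_normB (c 0 i) ((c - c1) 0 i).
  have -> : c 0 i - (c - c1) 0 i = c1 0 i by rewrite !mxE; ring.
  lra.
have close x : `| `|ev u c x| `^ p - `|ev u c1 x| `^ p| <= kap * del.
  have e1 : 0 <= `|ev u c x| <= Bd.
    rewrite normr_ge0; apply: dot_le_sum (u_le x) => i; have := c_le i; lra.
  have e2 : 0 <= `|ev u c1 x| <= Bd.
    by rewrite normr_ge0; apply: dot_le_sum (u_le x).
  apply: (le_trans (powR_lipschitz p12 e1 e2)).
  have -> : kap * del = 2 * (n%:R * (del * Kb)) * Bd `^ (p - 1) by rewrite /kap; ring.
  apply: ler_wpM2r; first exact: powR_ge0.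
  rewrite ler_pM2l//; apply: (le_trans (ler_dist_dist _ _)).
  by rewrite -evB; apply: dot_le_sum (u_le x).
have kd0 : 0 <= kap * del by rewrite mulr_ge0// ltW.
have := sample_mean_close w close kd0.
have bev (c2 : 'rV[R]_n) : bmeas (fun x => `|ev u c2 x| `^ p).
  by apply: bmeas_powR; [exact: ltW|exact: bmeas_ev].
have np_le (c2 c3 : 'rV[R]_n) :
    (forall x, `| `|ev u c2 x| `^ p - `|ev u c3 x| `^ p| <= kap * del) ->
    npow mu u p c2 <= npow mu u p c3 + kap * del.
  move=> h; rewrite -[X in _ + X](mean_cst mu) -meanD//; last exact: bmeas_cst.
  apply: le_mean => //; first by apply: bmeasD => //; exact: bmeas_cst.
  by move=> x; have := h x; rewrite ler_norml; lra.
have h1 := np_le c c1 close.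
have h2 : npow mu u p c1 <= npow mu u p c + kap * del.
  by apply: np_le => x; rewrite distrC.
move=> hs hg; exact: (band_perturb kd0 eps01 dele h1 h2 hs hg).
Qed.

(** By [good_rational] the event is an intersection over the countable type of rational coefficient
    vectors, enumerated by [unpickle]. Measurability is needed to pass from the probability of the
    complement to that of the event. *)
Let measurable_event : measurable [set w | forall f, L f -> good f w].
Proof.
pose F (k : nat) : set T :=
  if unpickle k is Some c then [set w | good (ev u (map_mx ratr (c : 'rV[rat]_n))) w]
  else setT.
rewrite (_ : [set w | _] = \bigcap_(k in [set: nat]) F k).
  apply: bigcapT_measurable => k; rewrite /F; case: (unpickle k) => // c.
  by apply: measurable_good; exact: bmeas_ev.
apply/seteqP; split => w /=.
  move=> H k _; rewrite /F; case: (unpickle k) => // c.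
  by apply: H; apply/Lu; exists (map_mx ratr c).
move=> H f /Lu[c ->]; apply: good_rational => c'.
by have := H (pickle c') Logic.I; rewrite /F pickleK.
Qed.

(** Both sides are homogeneous of degree [p], so a violating [f] can be scaled to p-norm 1. If its
    p-norm is 0, all its coefficients vanish and nothing is violated. *)
Let violation w f : L f -> ~ good f w ->
  exists2 g, unit_ball mu p L g &
    eps <= `|sample_mean p g (fun j => X j w) - rnorm mu p g `^ p|.
Proof.
move=> /Lu[c ->] bad.
have bev : bmeas (fun x => `|ev u c x| `^ p).
  by apply: bmeas_powR; [exact: ltW|exact: bmeas_ev].
have np0 : 0 <= npow mu u p c by apply: mean_ge0 => x; exact: powR_ge0.
have [n0|nn0] := eqVneq (npow mu u p c) 0.
  exfalso; apply: bad; rewrite /good npE n0 !mulr0.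
  have [_ [B cB]] := bmeas_ev bu c.
  have B0 : 0 <= B by exact: le_trans (cB point).
  have := dot_le_npow p12 bu ou B0 cB; rewrite n0 mulr0 add0r.
  rewrite (_ : (fun x => _) = fun=> 0); last first.
    by apply/funext => x; rewrite ltNge cB.
  rewrite mean_cst mulr0 => cc0.
  have c0 : c = 0.
    apply/rowP => i; rewrite mxE; apply/eqP; rewrite -sqrf_eq0 eq_le sqr_ge0 andbT.
    exact: le_trans (sqr_le_dot _ _) cc0.
  rewrite /sample_mean big1 ?mulr0 ?lexx// => j _.
  by rewrite c0 /ev dot0l normr0 powR0 ?gt_eqF.
set a := npow mu u p c in np0 nn0.
have a0 : 0 < a by rewrite lt_def nn0.
set l := a `^ (- p^-1).
have lp : l `^ p = a^-1.
  by rewrite -powRrM mulNr mulVf ?gt_eqF// powR_inv1// ltW.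
have l0 : 0 <= l by exact: powR_ge0.
have evl x : `|ev u (l *: c) x| `^ p = a^-1 * `|ev u c x| `^ p.
  by rewrite /ev dotZl normrM (ger0_norm l0) powRM// lp.
have npl : npow mu u p (l *: c) = 1.
  rewrite /npow (_ : (fun x => _) = fun x => a^-1 * `|ev u c x| `^ p).
    by rewrite meanZ// mulVf// gt_eqF.
  by apply/funext => x; exact: evl.
exists (ev u (l *: c)).
  split; first by apply/Lu; exists (l *: c).
  by rewrite rnormE ?npl; [rewrite -/(npow _ _ _ _) npl powR1| |exact: bmeas_ev].
rewrite npE npl.
have -> : sample_mean p (ev u (l *: c)) (fun j => X j w) =
    a^-1 * sample_mean p (ev u c) (fun j => X j w).
  rewrite /sample_mean mulrCA [in RHS]mulr_sumr; congr (_ * _).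
  by apply: eq_bigr => j _; exact: evl.
move: bad; rewrite /good npE -/a; set sm := sample_mean _ _ _ => bad.
rewrite leNgt; apply/negP => small; apply: bad.
have : `|sm - a| < eps * a.
  rewrite (_ : sm - a = a * (a^-1 * sm - 1)); last by field; rewrite gt_eqF.
  by rewrite normrM (gtr0_norm a0) mulrC ltr_pM2r.
by rewrite ltr_norml => /andP[h1 h2]; apply/andP; split; lra.
Qed.

(** Markov's inequality: by [violation], [eps] times the indicator of the bad event is below the
    supremum. *)
Lemma event_prob_gt (B delta : R) :
  (\int[P]_w ereal_sup
        [set `|sample_mean p f (fun j => X j w) - rnorm mu p f `^ p|%:E
         | f in unit_ball mu p L] <= B%:E)%E -> B < eps * delta ->
  ((1 - delta)%:E < P [set w | forall f, L f -> good f w])%E.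
Proof.
move=> intB Bed.
have [ep0 ep1] : 0 < eps /\ eps < 1 by move/andP: eps01.
set E := [set w | _].
pose Q w := ~~ `[< E w >].
have QE : [set w | Q w] = ~` E.
  by apply/seteqP; split => w /=; [move=> /asboolPn|move=> h; apply/asboolPn].
have mQ : measurable [set w | Q w] by rewrite QE; exact: measurableC.
have ba := bmeas_set mQ (R := R).
set a := mean P (fun w => (Q w)%:R).
have aE : a%:E = P (~` E) by rewrite mean_boolE// QE.
have ad : eps * a <= B.
  rewrite -lee_fin; apply: le_trans intB.
  rewrite -(meanZ P eps ba) mean_EFin; last exact: bmeasZ.
  apply: ge0_le_integral_nonmeasurable => w; first by rewrite lee_fin mulr_ge0 ?(ltW ep0).
  rewrite /Q; case: asboolP => Ew /=.
    rewrite mulr0; apply: le_ereal_sup_tmp.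
    exists (`|sample_mean p (fun=> 0) (fun j => X j w)
        - rnorm mu p (fun=> 0) `^ p|%:E); last by rewrite lee_fin.
    exists (fun=> 0) => //; split.
      by apply/Lu; exists 0; apply/funext => x; rewrite /ev dot0l.
    rewrite rnormE//; last exact: bmeas_cst.
    rewrite (_ : (fun x => _) = fun=> 0).
      by rewrite mean_cst powR0 ?invr_eq0 ?gt_eqF.
    by apply/funext => x; rewrite normr0 powR0// gt_eqF.
  have [f [Lf bad]] : exists f, L f /\ ~ good f w.
    by move: Ew => /existsNP[f /not_implyP]; exists f.
  have [g gB ge] := violation Lf bad.
  rewrite mulr1; apply: le_ereal_sup_tmp.
  exists (`|sample_mean p g (fun j => X j w) - rnorm mu p g `^ p|%:E).
    by exists g.
  by rewrite lee_fin.
have a_lt : a < delta by rewrite -(ltr_pM2l ep0); exact: le_lt_trans ad Bed.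
have PE : P E = (1 - a)%:E.
  rewrite -[E]setCK probability_setC; last exact: measurableC.
  by rewrite -aE EFinB.
by rewrite PE lte_fin; lra.
Qed.

End coordinates.

Lemma event_prob_gt_of_expectation (B delta : R) :
  (\int[P]_w ereal_sup
        [set `|sample_mean p f (fun j => X j w) - rnorm mu p f `^ p|%:E
         | f in unit_ball mu p L] <= B%:E)%E -> B < eps * delta ->
  ((1 - delta)%:E < P [set w | forall f, L f -> good f w])%E.
Proof.
have [n [u [bu ou uK Lu]]] := nikolskii_basis compactO nikL.
by move=> h1 h2; apply: (event_prob_gt bu ou uK Lu h1 h2).
Qed.

End part2.

(** Separates off the zero subspace: there [M^2 N] may be less than 1 and the condition on [m] may
    carry no information. *)
Lemma nikolskii_trivial_or_ge1 (R : realType) (Omega : ptopologicalType)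
    (mu : probability (borel Omega) R) (p : R) (N : nat) (M : R)
    (L : set (Omega -> R)) : compact [set: Omega] -> nikolskii_subspace mu p N M L ->
  (forall f, L f -> f = fun=> 0) \/ 1 <= M ^+ 2 * N%:R.
Proof.
move=> cO nikL; have [n [u [bu ou uK Lu]]] := nikolskii_basis cO nikL.
have [n0|n0] := posnP n; [left|right; exact: K_ge1 n0 bu ou uK].
move=> f /Lu[c ->]; apply/funext => x; rewrite /ev /dot.
by apply: big1 => i; exfalso; move: (i); rewrite n0 => -[].
Qed.

Theorem corollary4p11 (R : realType) (p : R) (hp : 1 < p < 2) :
  (exists C : R,
    forall (Omega : ptopologicalType) (mu : probability (borel Omega) R)
      (N : nat) (M : R) (L : set (Omega -> R)),
    compact [set: Omega] -> nikolskii_subspace mu p N M L ->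
    forall (m : nat), (2 <= m)%N ->
    forall (d : measure_display) (T : measurableType d) (P : probability T R)
      (X : 'I_m -> {RV P >-> borel Omega}),
    iid_sample mu X ->
    (\int[P]_w ereal_sup
        [set `|sample_mean p f (fun j => X j w) - rnorm mu p f `^ p|%:E
         | f in unit_ball mu p L]
     <= (C * (rate p m N M + Num.sqrt (rate p m N M)))%:E)%E) /\
  (forall eps delta : R, 0 < eps < 1 -> 0 < delta < 1 ->
    exists c : R,
    forall (Omega : ptopologicalType) (mu : probability (borel Omega) R)
      (N : nat) (M : R) (L : set (Omega -> R)),
    compact [set: Omega] -> nikolskii_subspace mu p N M L ->
    forall (m : nat),
    c * M ^+ 2 * N%:R * ln (4 * M ^+ 2 * N%:R) ^+ 2 <= m%:R ->
    forall (d : measure_display) (T : measurableType d) (P : probability T R)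
      (X : 'I_m -> {RV P >-> borel Omega}),
    iid_sample mu X ->
    ((1 - delta)%:E <
      P [set w | forall f, L f ->
          ((1 - eps) * rnorm mu p f `^ p <= sample_mean p f (fun j => X j w)
             <= (1 + eps) * rnorm mu p f `^ p)%R])%E).
Proof.
have [C C_ge] : exists C : R, 3840 <= C by exists 3840; exact: lexx.
set C1 := expectation_const p C.
split.
  exists C1 => Omega mu N M L cO nikL m m2 d T P X iidX.
  exact: (expectation_sup_le hp cO nikL m2 iidX C_ge).
move=> eps delta eps01 /andP[d0 d1]; have /andP[ep0 ep1] := eps01.
have C10 : 0 <= C1.
  have := chain_const_gt0 hp; rewrite /C1 /expectation_const => c0.
  have c2 : 0 <= (40 * C + 8) * (4 * chain_const p + 1) by rewrite mulr_ge0//; lra.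
  lra.
have ed0 : 0 < eps * delta by rewrite mulr_gt0.
(* If the rate is at most [z^2], its square root and itself are at most [z], so the expectation is
   at most [2 C1 z], which is less than [eps * delta]. *)
set z := Num.min 1 (eps * delta / (4 * (C1 + 1))).
have z0 : 0 < z by rewrite lt_min ltr01 divr_gt0// mulr_gt0//; lra.
have z1 : z <= 1 by rewrite ge_min lexx.
have zC : z * (4 * (C1 + 1)) <= eps * delta.
  rewrite -ler_pdivlMr; last by rewrite mulr_gt0//; lra.
  by rewrite ge_min lexx orbT.
have z20 : 0 < z ^+ 2 by rewrite exprn_gt0.
have [c c0 hc] := rate_small hp z20.
exists c => Omega mu N M L cO nikL m hm d T P X iidX.
have [L0|K1] := nikolskii_trivial_or_ge1 cO nikL.
  have p0 : 0 < p by move/andP: hp => -[]; lra.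
  rewrite (_ : [set w | _] = [set: T]); first by rewrite probability_setT lte_fin; lra.
  apply/seteqP; split => // w _ f /L0 -> /=.
  rewrite rnorm_powR//; last exact: bmeas_cst.
  rewrite (_ : (fun x => _) = fun=> 0); last first.
    by apply/funext => x; rewrite normr0 powR0// gt_eqF.
  rewrite mean_cst !mulr0 /sample_mean big1 ?mulr0 ?lexx// => j _.
  by rewrite normr0 powR0// gt_eqF.
have hm' : c * (M ^+ 2 * N%:R) * ln (4 * (M ^+ 2 * N%:R)) ^+ 2 <= m%:R.
  by rewrite (mulrA c) (mulrA 4).
have [m2 rz] := hc _ _ K1 hm'.
have {}rz : rate p m N M <= z ^+ 2 by rewrite /rate -(mulrA 4).
set r := rate p m N M in rz *.
apply: (event_prob_gt_of_expectation hp cO nikL eps01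
  (expectation_sup_le hp cO nikL m2 iidX C_ge)).
rewrite -/r -/C1.
have sr : Num.sqrt r <= z.
  by rewrite -(gtr0_norm z0) -sqrtr_sqr ler_wsqrtr.
have zz : z ^+ 2 <= z by rewrite expr2 ler_piMr// ltW.
have : C1 * (r + Num.sqrt r) <= C1 * (z + z) by rewrite ler_wpM2l// lerD// (le_trans rz).
lra.
Qed.
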